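(* Let $x$ be a complex number with $0<|x|<1$, and set $z={}_2F_1\left(\frac12,\frac12;1;x\right)$ and $y=\pi\,\frac{{}_2F_1\left(\frac12,\frac12;1;1-x\right)}{{}_2F_1\left(\frac12,\frac12;1;x\right)}$. Then $$1-24\sum_{n=1}^{\infty}\frac{2n-1}{e^{(2n-1)y}+1}=(1-2x)z^2.$$
   Context: ${}_2F_1$ is the Gaussian hypergeometric function, with ${}_2F_1\left(\frac12,\frac12;1;1-x\right)$ given by the principal branch of its analytic continuation; for real $x\in(-1,0)$, where $1-x$ lies on the branch cut, either boundary value may be used, since they change $y$ only by an integer multiple of $2\pi i$ and leave $e^{y}$ unchanged. *)

(* Defs.v *)
(* Stdlib reals; complex numbers, series and derivatives from Coquelicot. *)
From Stdlib Require Import Reals Factorial.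
From Coquelicot Require Export Coquelicot.

Local Open Scope C_scope.

Definition Cexp (u : C) : C := ((exp (Re u) * cos (Im u))%R, (exp (Re u) * sin (Im u))%R).

(* Rising factorial (a)_n = a (a+1) ... (a+n-1). *)
Fixpoint poch (a : C) (n : nat) : C :=
  match n with
  | O => 1
  | S m => poch a m * (a + INR m)
  end.

Definition gauss_term (a b c u : C) (n : nat) : C :=
  poch a n * poch b n / (poch c n * INR (fact n)) * u ^ n.

(* Coquelicot's total [Series] is real-valued, hence the split into real and
   imaginary parts.  Meaningful where the Gauss series converges, in
   particular for [Cmod u < 1] and [c] not a nonpositive integer. *)
Definition gauss_2F1 (a b c u : C) : C :=
  (Series (fun n => Re (gauss_term a b c u n)),
   Series (fun n => Im (gauss_term a b c u n))).

Definition on_cut (u : C) : Prop := Im u = 0%R /\ (1 <= Re u)%R.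

(* [F] is holomorphic on the connected open set C \ [1, +oo) and equals the
   Gauss series on the unit disc, so its values off the cut are unique; its
   values on the cut are irrelevant. *)
Definition principal_branch_2F1 (a b c : C) (F : C -> C) : Prop :=
  (forall u : C, ~ on_cut u -> ex_derive F u) /\
  (forall u : C, (Cmod u < 1)%R -> F u = gauss_2F1 a b c u).

Definition upper_half_plane (u : C) : Prop := (0 < Im u)%R.
Definition lower_half_plane (u : C) : Prop := (Im u < 0)%R.

(* [v] is the limit of [F] at [u] along the open half-plane [H]. *)
Definition boundary_value (H : C -> Prop) (F : C -> C) (u v : C) : Prop :=
  filterlim F (within H (locally u)) (locally v).

(* [v] is the value at [u] of the principal branch; on the cut, either of the
   two boundary values is allowed. *)
Definition is_2F1 (a b c u v : C) : Prop :=
  exists F : C -> C,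
    principal_branch_2F1 a b c F /\
    ((~ on_cut u /\ v = F u) \/
     (on_cut u /\ (boundary_value upper_half_plane F u v \/
                   boundary_value lower_half_plane F u v))).

(* Main.v *)
(* Write F(x) = 2F1(1/2, 1/2; 1; x) and Y(x) = - ln Q(x), where Q(x) = (x / 16) exp (L(x)) and L is the power series with
   L(0) = 0 and 1 + x L'(x) = 1 / ((1 - x) F(x)^2); thus F Y is a second solution of the hypergeometric equation.

   On (0, 1): Landen's transformation gives F(4l/(1+l)^2) = (1+l) F(l^2), hence Y(l^2) = 2 Y(4l/(1+l)^2), and
   y = pi F(1-x)/F(x) doubles in the same way.  The Wronskian shows that y is an affine function of Y, the doubling that it
   is linear, and Wallis' product that y = Y.  The theta function identities theta(q)^2 + theta(-q)^2 = 2 theta(q^2)^2 and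
   theta(q) + theta(-q) = 2 theta(q^4) show that X(q) = 1 - (theta(-q)/theta(q))^4 is transformed by q -> q^2 according to
   Landen's rule, so that Q(X(q)) = q; with the triple product for theta(-q)/theta(q), the same doubling argument gives
   X (1 - X) chi(q)^24 = 16 q, where chi(q) is the product of the 1 + q^(2k+1).  The logarithmic derivative of this relation
   along q = Q(x) is the claim.

   In the disc: the coefficients of F^2 decrease, so (1 - x) F(x)^2 = 1 - x D(x) where D has nonnegative coefficients; hence
   so has L, and |Q(x)| <= Q(|x|) < 1.  Both the claim and the formula pi F(1-x) = - F(x) (ln (x/16) + L(x)) for the
   principal branch are then identities between holomorphic functions of s, x = e^s, in a half-strip that hold on the
   negative real axis; they extend by unique continuation, which is obtained from Goursat's theorem. *)
Require Import Defs.
From Stdlib Require Import Reals ZArith List Lra Lia ClassicalEpsilon.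
From Stdlib Require FinFun.
From Coquelicot Require Import Coquelicot.

(** * Goursat's theorem and unique continuation *)

Local Open Scope R_scope.

(** Two facts are invisible in the quotient y: Re y > 0, which convergence on the left requires, and
    the single-valuedness of e^(-y) in x. Building the nome from a power series makes the second
    evident. For the first, y is visibly positive on (0, 1), so Q < 1 there, and the signs of the
    coefficients carry this bound to the disc. The doubling arguments share one mechanism: f(q^2) =
    2 f(q) gives f(q^(2^n)) = 2^n f(q) while q^(2^n) tends to 0, so any bound for f near 0 forces f
    = 0. Crude inequalities near 0 thus replace exact asymptotics. The variable s is a logarithm of
    x. The map 1 - e^s takes the half-strip Re s < 0, |Im s| < pi off the cut and its two edges to
    the two sides of the cut; the two boundary values at a point therefore belong to two values of s
    with the same e^s, hence with the same Q. Holomorphy is used as bare pointwise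
    differentiability. A bound of h(p) by the maximum of |h| on a circle about p is the only
    consequence drawn from the contour argument; discs of zeros are pushed along segments with
    it. *)

Lemma bisection_2d (P : R -> R -> nat -> Prop) (x0 y0 w h : R) :
  0 < w -> 0 < h ->
  (forall n x y, x0 <= x -> y0 <= y ->
     x + w / 2 ^ n <= x0 + w -> y + h / 2 ^ n <= y0 + h ->
     P x y (S n) -> P (x + w / 2 ^ S n) y (S n) ->
     P x (y + h / 2 ^ S n) (S n) -> P (x + w / 2 ^ S n) (y + h / 2 ^ S n) (S n) ->
     P x y n) ->
  ~ P x0 y0 O ->
  exists X Y, x0 <= X <= x0 + w /\ y0 <= Y <= y0 + h /\
    forall n, exists x y, ~ P x y n /\
      x0 <= x /\ y0 <= y /\ x + w / 2 ^ n <= x0 + w /\ y + h / 2 ^ n <= y0 + h /\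
      x <= X <= x + w / 2 ^ n /\ y <= Y <= y + h / 2 ^ n.
Proof.
intros Hw Hh Hstep H0.
assert (Hp : forall n, 0 < / 2 ^ n) by (intros n; apply Rinv_0_lt_compat, pow_lt; lra).
assert (Hhalf : forall n c, c / 2 ^ n = c / 2 ^ S n + c / 2 ^ S n).
{ intros n c; simpl; field; apply pow_nonzero; lra. }
assert (Hwn : forall n, 0 < w / 2 ^ n) by (intros n; apply Rmult_lt_0_compat; auto).
assert (Hhn : forall n, 0 < h / 2 ^ n) by (intros n; apply Rmult_lt_0_compat; auto).
pose (inv := fun n (p : R * R) => ~ P (fst p) (snd p) n /\ x0 <= fst p /\ y0 <= snd p /\
   fst p + w / 2 ^ n <= x0 + w /\ snd p + h / 2 ^ n <= y0 + h).
assert (Hs : forall n p, inv n p -> exists p', inv (S n) p' /\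
   fst p <= fst p' <= fst p + w / 2 ^ S n /\ snd p <= snd p' <= snd p + h / 2 ^ S n).
{ intros n [x y] [H1 [H2 [H3 [H4 H5]]]]; simpl fst in *; simpl snd in *.
  assert (E1 := Hhalf n w). assert (E2 := Hhalf n h).
  assert (E3 := Hwn (S n)). assert (E4 := Hhn (S n)).
  apply NNPP; intros Hc; apply H1.
  assert (D : forall x' y', x' = x \/ x' = x + w / 2 ^ S n -> y' = y \/ y' = y + h / 2 ^ S n ->
     P x' y' (S n)).
  { intros x' y' Hx Hy; apply NNPP; intros Hn; apply Hc.
    exists (x', y'); unfold inv; simpl fst; simpl snd.
    repeat split; auto; lra. }
  apply Hstep; auto. }
(* A bad quarter is chosen at each level. The fallback [p] is never reached, because [inv] is
   propagated along the sequence. *)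
pose (nxt := fun n p => match excluded_middle_informative (inv n p) with
  | left H => proj1_sig (constructive_indefinite_description _ (Hs n p H))
  | right _ => p end).
pose (s := fix s n := match n with O => (x0, y0) | S m => nxt m (s m) end).
assert (Hinv0 : inv O (s O)) by (unfold inv, s; simpl; repeat split; auto; lra).
assert (Hall : forall n, inv n (s n) /\ inv (S n) (s (S n)) /\
  fst (s n) <= fst (s (S n)) <= fst (s n) + w / 2 ^ S n /\
  snd (s n) <= snd (s (S n)) <= snd (s n) + h / 2 ^ S n).
{ assert (A : forall n, inv n (s n) -> inv (S n) (s (S n)) /\
   fst (s n) <= fst (s (S n)) <= fst (s n) + w / 2 ^ S n /\
   snd (s n) <= snd (s (S n)) <= snd (s n) + h / 2 ^ S n).
  { intros n Hn. change (s (S n)) with (nxt n (s n)). unfold nxt.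
    destruct (excluded_middle_informative (inv n (s n))) as [Hi|Hi]; [|contradiction].
    destruct (constructive_indefinite_description _ _) as [p' Hp']; simpl proj1_sig; tauto. }
  intros n; assert (inv n (s n)); [induction n; auto; now apply A | split; auto]. }
assert (lim : forall (f : nat -> R) (c lo : R), 0 < c ->
   (forall n, f n <= f (S n) <= f n + c / 2 ^ S n) -> 
   exists X, forall n, f n <= X <= f n + c / 2 ^ n).
{ intros f c lo Hc Hf.
  assert (M : forall n k, f n <= f (n + k)%nat /\ f (n + k)%nat + c / 2 ^ (n + k) <= f n + c / 2 ^ n).
  { intros n k; induction k.
    - rewrite Nat.add_0_r; lra.
    - rewrite Nat.add_succ_r. specialize (Hf (n + k)%nat).
      assert (E := Hhalf (n + k)%nat c). lra. }
  assert (Hcn : forall n, 0 < c / 2 ^ n) by (intros n; apply Rmult_lt_0_compat; auto).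
  assert (Hub : forall n m, f m <= f n + c / 2 ^ n).
  { intros n m. destruct (Nat.le_ge_cases n m) as [L|L].
    - replace m with (n + (m - n))%nat by lia. destruct (M n (m - n)%nat).
      specialize (Hcn (n + (m - n))%nat). lra.
    - replace n with (m + (n - m))%nat by lia. destruct (M m (n - m)%nat).
      specialize (Hcn (m + (n - m))%nat). lra. }
  destruct (completeness (fun z => exists n, z = f n)) as [X [HX1 HX2]].
  - exists (f O + c / 2 ^ 0); intros z [n ->]; apply Hub.
  - now exists (f O), O.
  - exists X; intros n; split.
    + apply HX1; now exists n.
    + apply HX2; intros z [m ->]; apply Hub. }
destruct (lim (fun n => fst (s n)) w 0 Hw) as [X HX]; [intros n; apply Hall|].
destruct (lim (fun n => snd (s n)) h 0 Hh) as [Y HY]; [intros n; apply Hall|].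
exists X, Y; split; [|split].
- specialize (HX O). simpl in HX. lra.
- specialize (HY O). simpl in HY. lra.
- intros n; exists (fst (s n)), (snd (s n)).
  destruct (Hall n) as [[I1 [I2 [I3 [I4 I5]]]] _].
  specialize (HX n); specialize (HY n); simpl in HX, HY. repeat split; auto; lra.
Qed.

(** Total differentiability at one point, with partial derivatives [a] and [b]. Nothing is asked
    about how the partials vary, which is the generality of Goursat's argument. *)
Definition diff2_at (U : R -> R -> R) (x0 y0 a b : R) : Prop :=
  forall eps, 0 < eps -> exists d, 0 < d /\ forall x y,
    Rabs (x - x0) < d -> Rabs (y - y0) < d ->
    Rabs (U x y - U x0 y0 - a * (x - x0) - b * (y - y0)) <=
    eps * (Rabs (x - x0) + Rabs (y - y0)).

Lemma diff2_at_continuous_l U x0 y0 a b :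
  diff2_at U x0 y0 a b -> continuous (fun x => U x y0) x0.
Proof.
intros H. apply (@ex_derive_continuous R_AbsRing R_NormedModule). exists a.
apply is_derive_Reals. intros eps Heps.
destruct (H (eps / 2)) as [d [Hd H']]; [lra|].
exists (mkposreal d Hd); intros h Hh Hhd; simpl in Hhd.
specialize (H' (x0 + h) y0).
replace (x0 + h - x0) with h in H' by ring.
replace (y0 - y0) with 0 in H' by ring. rewrite Rabs_R0 in H'.
specialize (H' Hhd Hd). rewrite Rmult_0_r, Rminus_0_r, Rplus_0_r in H'.
replace ((U (x0 + h) y0 - U x0 y0) / h - a) with
  ((U (x0 + h) y0 - U x0 y0 - a * h) * / h) by (field; auto).
rewrite Rabs_mult, Rabs_inv. assert (0 < Rabs h) by now apply Rabs_pos_lt.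
apply Rle_lt_trans with (eps / 2 * Rabs h * / Rabs h).
- apply Rmult_le_compat_r; auto. left; now apply Rinv_0_lt_compat.
- rewrite Rmult_assoc, Rinv_r; lra.
Qed.

Lemma diff2_at_swap U x0 y0 a b :
  diff2_at U x0 y0 a b -> diff2_at (fun y x => U x y) y0 x0 b a.
Proof.
intros H eps He. destruct (H eps He) as [d [Hd H']]. exists d; split; auto.
intros y x Hy Hx. specialize (H' x y Hx Hy).
replace (U x y - U x0 y0 - b * (y - y0) - a * (x - x0)) with
  (U x y - U x0 y0 - a * (x - x0) - b * (y - y0)) by ring. lra.
Qed.

Lemma RInt_Rminus (f g : R -> R) (a b : R) : ex_RInt f a b -> ex_RInt g a b ->
  RInt (fun x => f x - g x) a b = RInt f a b - RInt g a b.
Proof. apply (RInt_minus (V := R_CompleteNormedModule)). Qed.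

(* Goursat's bisection argument, run on a single Cauchy-Riemann equation. *)
Lemma divergence_free_flux (U V : R -> R -> R) (x0 y0 w h : R) :
  0 < w -> 0 < h ->
  (forall x y, x0 <= x <= x0 + w -> y0 <= y <= y0 + h ->
     exists a b c, diff2_at U x y a b /\ diff2_at V x y c a) ->
  RInt (fun y => U (x0 + w) y - U x0 y) y0 (y0 + h) =
  RInt (fun x => V x (y0 + h) - V x y0) x0 (x0 + w).
Proof.
intros Hw Hh HD.
assert (IU : forall x a b, x0 <= x <= x0 + w -> y0 <= a <= y0 + h -> y0 <= b <= y0 + h ->
   ex_RInt (fun y => U x y) a b).
{ intros x a b Hx Ha Hb. apply (@ex_RInt_continuous R_CompleteNormedModule).
  intros z Hz. destruct (HD x z Hx) as [a' [b' [c' [H1 _]]]].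
  - revert Hz. unfold Rmin, Rmax. destruct (Rle_dec a b); lra.
  - apply diff2_at_swap in H1. now apply diff2_at_continuous_l in H1. }
assert (IV : forall y a b, y0 <= y <= y0 + h -> x0 <= a <= x0 + w -> x0 <= b <= x0 + w ->
   ex_RInt (fun x => V x y) a b).
{ intros y a b Hy Ha Hb. apply (@ex_RInt_continuous R_CompleteNormedModule).
  intros z Hz. destruct (HD z y) as [a' [b' [c' [_ H1]]]]; auto.
  - revert Hz. unfold Rmin, Rmax. destruct (Rle_dec a b); lra.
  - now apply diff2_at_continuous_l in H1. }
(* Boundary flux of the rectangle with corner (x, y) and sides s, t. Splitting each integral makes
   additivity under quartering an instance of Chasles' relation. *)
pose (J := fun x y s t => RInt (fun z => U (x + s) z) y (y + t) - RInt (fun z => U x z) y (y + t)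
   - (RInt (fun z => V z (y + t)) x (x + s) - RInt (fun z => V z y) x (x + s))).
assert (HJ : forall x y s t, x0 <= x -> 0 <= s -> x + s <= x0 + w ->
   y0 <= y -> 0 <= t -> y + t <= y0 + h ->
   J x y s t = RInt (fun z => U (x + s) z - U x z) y (y + t) -
     RInt (fun z => V z (y + t) - V z y) x (x + s)).
{ intros. unfold J. rewrite (RInt_Rminus (fun z => U (x + s) z)), (RInt_Rminus (fun z => V z (y + t))).
  1: reflexivity. 1, 2: apply IV; lra. all: apply IU; lra. }
cut (J x0 y0 w h = 0).
{ rewrite HJ; lra. }
apply NNPP; intros Hne.
set (c0 := Rabs (J x0 y0 w h)).
assert (Hc0 : 0 < c0) by now apply Rabs_pos_lt.
assert (Hp : forall n, 0 < / 2 ^ n) by (intros n; apply Rinv_0_lt_compat, pow_lt; lra).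
assert (Hhalf : forall n c, c / 2 ^ n = c / 2 ^ S n + c / 2 ^ S n).
{ intros n c; simpl; field; apply pow_nonzero; lra. }
assert (Hwn : forall n, 0 < w / 2 ^ n) by (intros n; apply Rmult_lt_0_compat; auto).
assert (Hhn : forall n, 0 < h / 2 ^ n) by (intros n; apply Rmult_lt_0_compat; auto).
(* The threshold scales with the area: four quarters below c0 / 4^(n+1) add up to less than c0 /
   4^n. *)
pose (P := fun x y n => Rabs (J x y (w / 2 ^ n) (h / 2 ^ n)) < c0 * (/ 2 ^ n) ^ 2).
destruct (bisection_2d P x0 y0 w h Hw Hh) as [X [Y [HX [HY HXY]]]].
- intros n x y Hx Hy Hxw Hyh. unfold P.
  assert (E1 := Hwn (S n)). assert (E2 := Hhn (S n)).
  rewrite (Hhalf n w) in Hxw; rewrite (Hhalf n h) in Hyh.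
  rewrite (Hhalf n w), (Hhalf n h).
  set (s := w / 2 ^ S n) in *. set (t := h / 2 ^ S n) in *.
  assert (EJ : J x y (s + s) (t + t) = J x y s t + J (x + s) y s t + J x (y + t) s t
     + J (x + s) (y + t) s t).
  { unfold J. rewrite <- !Rplus_assoc.
    rewrite <- (RInt_Chasles (fun z => U (x + s + s) z) y (y + t) (y + t + t)) by (apply IU; lra).
    rewrite <- (RInt_Chasles (fun z => U x z) y (y + t) (y + t + t)) by (apply IU; lra).
    rewrite <- (RInt_Chasles (fun z => V z (y + t + t)) x (x + s) (x + s + s)) by (apply IV; lra).
    rewrite <- (RInt_Chasles (fun z => V z y) x (x + s) (x + s + s)) by (apply IV; lra).
    unfold plus; simpl. lra. }
  rewrite EJ.
  replace (/ 2 ^ n) with (2 * / 2 ^ S n) by (simpl; field; apply pow_nonzero; lra).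
  intros H1 H2 H3 H4.
  pose proof (Rabs_triang (J x y s t + J (x + s) y s t + J x (y + t) s t) (J (x + s) (y + t) s t)).
  pose proof (Rabs_triang (J x y s t + J (x + s) y s t) (J x (y + t) s t)).
  pose proof (Rabs_triang (J x y s t) (J (x + s) y s t)).
  replace (c0 * (2 * / 2 ^ S n) ^ 2) with (4 * (c0 * (/ 2 ^ S n) ^ 2)) by ring. lra.
- unfold P. simpl. rewrite Rinv_1, !Rmult_1_r. unfold Rdiv.
  rewrite !Rinv_1, !Rmult_1_r. fold c0. lra.
- destruct (HD X Y HX HY) as [a [b [c [D1 D2]]]].
  (* Chosen so that the final estimate 2 eps (s + t)^2 is half of the threshold c0 / 4^N. *)
  set (eps := c0 / (4 * (w + h) ^ 2)).
  assert (Heps : 0 < eps).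
  { apply Rdiv_lt_0_compat; auto. apply Rmult_lt_0_compat; [lra|]. apply pow_lt; lra. }
  destruct (D1 eps Heps) as [d1 [Hd1 D1']]. destruct (D2 eps Heps) as [d2 [Hd2 D2']].
  set (d := Rmin d1 d2). assert (Hd : 0 < d) by now apply Rmin_pos.
  assert (Hd1' : d <= d1) by apply Rmin_l. assert (Hd2' : d <= d2) by apply Rmin_r.
  destruct (pow_lt_1_zero (/ 2)) with (y := d / (w + h)) as [N HN].
  { rewrite Rabs_pos_eq; lra. }
  { apply Rdiv_lt_0_compat; lra. }
  specialize (HN N (le_n N)). rewrite pow_inv, Rabs_pos_eq in HN by (left; apply Hp).
  assert (HN' : (w + h) * / 2 ^ N < d).
  { apply Rmult_lt_reg_r with (/ (w + h)); [apply Rinv_0_lt_compat; lra|].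
    replace ((w + h) * / 2 ^ N * / (w + h)) with (/ 2 ^ N); [exact HN|].
    field; split; try (apply pow_nonzero); lra. }
  destruct (HXY N) as [x [y [HP [Hx [Hy [Hxw [Hyh [HxX HyY]]]]]]]].
  apply HP. unfold P.
  assert (E1 := Hwn N). assert (E2 := Hhn N).
  set (s := w / 2 ^ N) in *. set (t := h / 2 ^ N) in *.
  assert (Est : s + t = (w + h) * / 2 ^ N) by (unfold s, t; lra).
  assert (Bx : forall z, x <= z <= x + s -> Rabs (z - X) <= s).
  { intros z Hz. apply Rabs_le. lra. }
  assert (By : forall z, y <= z <= y + t -> Rabs (z - Y) <= t).
  { intros z Hz. apply Rabs_le. lra. }
  assert (FU : forall u z, x <= u <= x + s -> y <= z <= y + t ->
     Rabs (U u z - U X Y - a * (u - X) - b * (z - Y)) <= eps * (s + t)).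
  { intros u z Hu Hz. specialize (Bx u Hu). specialize (By z Hz).
    eapply Rle_trans; [apply D1'; lra|]. apply Rmult_le_compat_l; lra. }
  assert (FV : forall u z, x <= u <= x + s -> y <= z <= y + t ->
     Rabs (V u z - V X Y - c * (u - X) - a * (z - Y)) <= eps * (s + t)).
  { intros u z Hu Hz. specialize (Bx u Hu). specialize (By z Hz).
    eapply Rle_trans; [apply D2'; lra|]. apply Rmult_le_compat_l; lra. }
  (* The linear parts contribute a s t to both integrals and cancel because U and V share the
     coefficient [a]; the terms in [b] and [c] drop out in the differences across opposite sides. *)
  assert (EJ : J x y s t = RInt (fun z => U (x + s) z - U x z - a * s) y (y + t) -
     RInt (fun z => V z (y + t) - V z y - a * t) x (x + s)).
  { rewrite HJ by lra.
    assert (ex1 : ex_RInt (fun z => U (x + s) z - U x z) y (y + t)).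
    { apply (@ex_RInt_minus R_NormedModule); apply IU; lra. }
    assert (ex2 : ex_RInt (fun z => V z (y + t) - V z y) x (x + s)).
    { apply (@ex_RInt_minus R_NormedModule); apply IV; lra. }
    rewrite (RInt_Rminus (fun z => U (x + s) z - U x z)) by (auto; apply @ex_RInt_const).
    rewrite (RInt_Rminus (fun z => V z (y + t) - V z y)) by (auto; apply @ex_RInt_const).
    rewrite !RInt_const. unfold scal; simpl. unfold mult; simpl. ring. }
  rewrite EJ.
  assert (B1 : Rabs (RInt (fun z => U (x + s) z - U x z - a * s) y (y + t)) <= (y + t - y) * (2 * eps * (s + t))).
  { apply abs_RInt_le_const; [lra| |].
    - apply (@ex_RInt_minus R_NormedModule); [|apply @ex_RInt_const].
      apply (@ex_RInt_minus R_NormedModule); apply IU; lra.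
    - intros z Hz. assert (F1 := FU (x + s) z ltac:(lra) Hz). assert (F2 := FU x z ltac:(lra) Hz).
      replace (U (x + s) z - U x z - a * s) with
       ((U (x + s) z - U X Y - a * (x + s - X) - b * (z - Y)) - (U x z - U X Y - a * (x - X) - b * (z - Y))) by ring.
      eapply Rle_trans; [apply Rabs_triang|]. rewrite Rabs_Ropp. lra. }
  assert (B2 : Rabs (RInt (fun z => V z (y + t) - V z y - a * t) x (x + s)) <= (x + s - x) * (2 * eps * (s + t))).
  { apply abs_RInt_le_const; [lra| |].
    - apply (@ex_RInt_minus R_NormedModule); [|apply @ex_RInt_const].
      apply (@ex_RInt_minus R_NormedModule); apply IV; lra.
    - intros z Hz. assert (F1 := FV z (y + t) Hz ltac:(lra)). assert (F2 := FV z y Hz ltac:(lra)).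
      replace (V z (y + t) - V z y - a * t) with
       ((V z (y + t) - V X Y - c * (z - X) - a * (y + t - Y)) - (V z y - V X Y - c * (z - X) - a * (y - Y))) by ring.
      eapply Rle_trans; [apply Rabs_triang|]. rewrite Rabs_Ropp. lra. }
  eapply Rle_lt_trans; [apply Rabs_triang|]. rewrite Rabs_Ropp.
  apply Rle_lt_trans with (2 * eps * (s + t) ^ 2); [lra|].
  rewrite Est. unfold eps.
  replace (2 * (c0 / (4 * (w + h) ^ 2)) * ((w + h) * / 2 ^ N) ^ 2) with (c0 * (/ 2 ^ N) ^ 2 / 2).
  2:{ field. split; try (apply pow_nonzero); lra. }
  assert (0 < c0 * (/ 2 ^ N) ^ 2) by (apply Rmult_lt_0_compat; auto; apply pow_lt; auto). lra.
Qed.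

Local Open Scope C_scope.

(** * Complex derivatives in epsilon-delta form, and the exponential *)

Definition cdiff (f : C -> C) (u l : C) : Prop :=
  forall eps : R, (0 < eps)%R -> exists d : R, (0 < d)%R /\ forall v,
    (Cmod (v - u) < d)%R -> (Cmod (f v - f u - l * (v - u)) <= eps * Cmod (v - u))%R.

Lemma im_le_Cmod (u : C) : (Rabs (Im u) <= Cmod u)%R.
Proof.
eapply Rle_trans; [|apply Rmax_Cmod]. apply Rmax_r.
Qed.

Lemma Cmod_le_re_im (u : C) : (Cmod u <= Rabs (Re u) + Rabs (Im u))%R.
Proof.
assert (H0 := Cmod_ge_0 u). assert (H := Cmod2_alt u).
assert (A1 : (Rabs (Re u) * Rabs (Re u) = Re u ^ 2)%R) by (rewrite <- Rabs_mult, Rabs_pos_eq; nra).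
assert (A2 : (Rabs (Im u) * Rabs (Im u) = Im u ^ 2)%R) by (rewrite <- Rabs_mult, Rabs_pos_eq; nra).
assert (H1 := Rabs_pos (Re u)). assert (H2 := Rabs_pos (Im u)). nra.
Qed.

Lemma Cmod_minus_sym (u v : C) : Cmod (u - v) = Cmod (v - u).
Proof. rewrite <- Cmod_opp. f_equal; ring. Qed.

Lemma Cmod_triangle_inv (u v : C) : (Cmod u - Cmod v <= Cmod (u - v))%R.
Proof.
assert (H := Cmod_triangle (u - v) v). replace (u - v + v) with u in H by ring. lra.
Qed.

Lemma ex_derive_cdiff (f : C -> C) (u : C) : ex_derive f u -> exists l, cdiff f u l.
Proof.
intros [l [_ H]]. exists l. intros eps He.
specialize (H u (fun P HP => HP) (mkposreal eps He)).
destruct H as [d Hd]. exists d; split; [apply cond_pos|].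
intros v Hv. specialize (Hd v Hv). simpl in Hd.
replace (f v - f u - l * (v - u)) with
  (minus (minus (f v) (f u)) (scal (minus v u) l)); [exact Hd|].
unfold minus, plus, opp, scal; simpl. unfold mult; simpl.
unfold Cminus. ring.
Qed.

Lemma cdiff_ext_loc (f g : C -> C) (u l : C) (d : R) :
  (0 < d)%R -> (forall v, (Cmod (v - u) < d)%R -> f v = g v) -> cdiff f u l -> cdiff g u l.
Proof.
intros Hd H Hf eps He. destruct (Hf eps He) as [d' [Hd' H']].
exists (Rmin d d'); split; [now apply Rmin_pos|]. intros v Hv.
assert (A := Rmin_l d d'). assert (B := Rmin_r d d').
rewrite <- !H; [apply H'; lra| |lra].
replace (u - u) with (RtoC 0) by ring. now rewrite Cmod_0.
Qed.

Lemma cdiff_const (c u : C) : cdiff (fun _ => c) u 0.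
Proof.
intros eps He. exists 1%R; split; [lra|]. intros v _.
replace (c - c - 0 * (v - u)) with (RtoC 0) by ring. rewrite Cmod_0.
apply Rmult_le_pos; [lra|apply Cmod_ge_0].
Qed.

Lemma cdiff_id (u : C) : cdiff (fun v => v) u 1.
Proof.
intros eps He. exists 1%R; split; [lra|]. intros v _.
replace (v - u - 1 * (v - u)) with (RtoC 0) by ring. rewrite Cmod_0.
apply Rmult_le_pos; [lra|apply Cmod_ge_0].
Qed.

Lemma cdiff_plus (f g : C -> C) (u l m : C) :
  cdiff f u l -> cdiff g u m -> cdiff (fun v => f v + g v) u (l + m).
Proof.
intros Hf Hg eps He.
destruct (Hf (eps / 2)%R) as [d1 [Hd1 H1]]; [lra|].
destruct (Hg (eps / 2)%R) as [d2 [Hd2 H2]]; [lra|].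
exists (Rmin d1 d2); split; [now apply Rmin_pos|]. intros v Hv.
assert (A := Rmin_l d1 d2). assert (B := Rmin_r d1 d2).
specialize (H1 v ltac:(lra)). specialize (H2 v ltac:(lra)).
replace (f v + g v - (f u + g u) - (l + m) * (v - u)) with
  ((f v - f u - l * (v - u)) + (g v - g u - m * (v - u))) by ring.
eapply Rle_trans; [apply Cmod_triangle|]. lra.
Qed.

Lemma cdiff_lipschitz (f : C -> C) (u l : C) : cdiff f u l ->
  exists d : R, (0 < d)%R /\ forall v, (Cmod (v - u) < d)%R ->
    (Cmod (f v - f u) <= (Cmod l + 1) * Cmod (v - u))%R.
Proof.
intros H. destruct (H 1%R) as [d [Hd H']]; [lra|]. exists d; split; auto.
intros v Hv. specialize (H' v Hv).
replace (f v - f u) with ((f v - f u - l * (v - u)) + l * (v - u)) by ring.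
eapply Rle_trans; [apply Cmod_triangle|]. rewrite Cmod_mult. lra.
Qed.

Lemma cdiff_continuous (f : C -> C) (u l : C) : cdiff f u l ->
  forall eps : R, (0 < eps)%R -> exists d : R, (0 < d)%R /\ forall v,
    (Cmod (v - u) < d)%R -> (Cmod (f v - f u) < eps)%R.
Proof.
intros H eps He. destruct (cdiff_lipschitz f u l H) as [d [Hd H']].
assert (Hl := Cmod_ge_0 l).
exists (Rmin d (eps / (Cmod l + 1))); split.
- apply Rmin_pos; auto. apply Rdiv_lt_0_compat; lra.
- intros v Hv. assert (A := Rmin_l d (eps / (Cmod l + 1))). assert (B := Rmin_r d (eps / (Cmod l + 1))).
  specialize (H' v ltac:(lra)). eapply Rle_lt_trans; [exact H'|].
  apply Rlt_le_trans with ((Cmod l + 1) * (eps / (Cmod l + 1)))%R.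
  + apply Rmult_lt_compat_l; lra.
  + right; field; lra.
Qed.

Lemma cdiff_mult (f g : C -> C) (u l m : C) :
  cdiff f u l -> cdiff g u m -> cdiff (fun v => f v * g v) u (l * g u + f u * m).
Proof.
intros Hf Hg eps He.
set (K := (1 + Cmod (g u) + Cmod (f u) + Cmod l)%R).
assert (A1 := Cmod_ge_0 (g u)). assert (A2 := Cmod_ge_0 (f u)). assert (A3 := Cmod_ge_0 l).
set (e := (Rmin 1 (eps / (3 * K)))%R).
assert (HK : (0 < eps / (3 * K))%R) by (apply Rdiv_lt_0_compat; unfold K; lra).
assert (He' : (0 < e)%R) by (apply Rmin_pos; lra).
assert (He1 : (e <= 1)%R) by apply Rmin_l. assert (He2 : (e <= eps / (3 * K))%R) by apply Rmin_r.
assert (He3 : (e * (3 * K) <= eps)%R).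
{ apply Rle_trans with (eps / (3 * K) * (3 * K))%R.
  - apply Rmult_le_compat_r; auto. unfold K; lra.
  - right; field. unfold K; lra. }
destruct (Hf e He') as [d1 [Hd1 H1]]. destruct (Hg e He') as [d2 [Hd2 H2]].
destruct (cdiff_continuous g u m Hg e He') as [d3 [Hd3 H3]].
exists (Rmin d1 (Rmin d2 d3)); split; [repeat apply Rmin_pos; auto|]. intros v Hv.
assert (B1 := Rmin_l d1 (Rmin d2 d3)). assert (B2 := Rmin_r d1 (Rmin d2 d3)).
assert (B3 := Rmin_l d2 d3). assert (B4 := Rmin_r d2 d3).
specialize (H1 v ltac:(lra)). specialize (H2 v ltac:(lra)). specialize (H3 v ltac:(lra)).
replace (f v * g v - f u * g u - (l * g u + f u * m) * (v - u)) with
  ((f v - f u - l * (v - u)) * (g u + (g v - g u)) + (l * (v - u) * (g v - g u) + f u * (g v - g u - m * (v - u)))) by ring.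
assert (Hvu := Cmod_ge_0 (v - u)).
assert (T := Cmod_triangle (g u) (g v - g u)).
eapply Rle_trans; [apply Cmod_triangle|].
apply Rle_trans with (e * Cmod (v - u) * K + (Cmod l * Cmod (v - u) * e + Cmod (f u) * (e * Cmod (v - u))))%R.
- apply Rplus_le_compat.
  + rewrite Cmod_mult. apply Rmult_le_compat; try apply Cmod_ge_0; auto. unfold K; lra.
  + eapply Rle_trans; [apply Cmod_triangle|]. rewrite !Cmod_mult. apply Rplus_le_compat.
    * apply Rmult_le_compat_l; [apply Rmult_le_pos; auto|lra].
    * apply Rmult_le_compat_l; auto.
- apply Rle_trans with (e * (3 * K) * Cmod (v - u))%R; [|apply Rmult_le_compat_r; auto].
  replace (e * Cmod (v - u) * K + (Cmod l * Cmod (v - u) * e + Cmod (f u) * (e * Cmod (v - u))))%R with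
   (e * (K + Cmod l + Cmod (f u)) * Cmod (v - u))%R by ring.
  apply Rmult_le_compat_r; auto. apply Rmult_le_compat_l; unfold K; lra.
Qed.

Lemma cdiff_comp (f g : C -> C) (u l m : C) :
  cdiff f (g u) l -> cdiff g u m -> cdiff (fun v => f (g v)) u (l * m).
Proof.
intros Hf Hg eps He.
assert (Hl := Cmod_ge_0 l). assert (Hm := Cmod_ge_0 m).
set (e1 := (eps / (2 * (Cmod m + 1)))%R). set (e2 := (eps / (2 * (Cmod l + 1)))%R).
assert (He1 : (0 < e1)%R) by (apply Rdiv_lt_0_compat; lra).
assert (He2 : (0 < e2)%R) by (apply Rdiv_lt_0_compat; lra).
destruct (Hf e1 He1) as [d1 [Hd1 H1]]. destruct (Hg e2 He2) as [d2 [Hd2 H2]].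
destruct (cdiff_continuous g u m Hg d1 Hd1) as [d3 [Hd3 H3]].
destruct (cdiff_lipschitz g u m Hg) as [d4 [Hd4 H4]].
exists (Rmin (Rmin d2 d3) d4); split; [repeat apply Rmin_pos; auto|]. intros v Hv.
assert (B1 := Rmin_l (Rmin d2 d3) d4). assert (B2 := Rmin_r (Rmin d2 d3) d4).
assert (B3 := Rmin_l d2 d3). assert (B4 := Rmin_r d2 d3).
specialize (H2 v ltac:(lra)). specialize (H3 v ltac:(lra)). specialize (H4 v ltac:(lra)).
specialize (H1 (g v) H3).
replace (f (g v) - f (g u) - l * m * (v - u)) with
  ((f (g v) - f (g u) - l * (g v - g u)) + l * (g v - g u - m * (v - u))) by ring.
eapply Rle_trans; [apply Cmod_triangle|]. rewrite Cmod_mult.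
apply Rle_trans with (e1 * ((Cmod m + 1) * Cmod (v - u)) + (Cmod l + 1) * (e2 * Cmod (v - u)))%R.
- apply Rplus_le_compat.
  + eapply Rle_trans; [exact H1|]. apply Rmult_le_compat_l; lra.
  + apply Rmult_le_compat; try apply Cmod_ge_0; auto; lra.
- right. unfold e1, e2. field. lra.
Qed.

Lemma cdiff_inv (u : C) : u <> 0 -> cdiff (fun v => / v) u (- / (u * u)).
Proof.
intros Hu eps He. assert (Hp : (0 < Cmod u)%R) by now apply Cmod_gt_0.
set (c := Cmod u) in *.
assert (Hd' : (0 < eps * c ^ 3 / 2)%R) by (apply Rdiv_lt_0_compat; [apply Rmult_lt_0_compat; auto; apply pow_lt; auto|lra]).
exists (Rmin (c / 2) (eps * c ^ 3 / 2))%R; split.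
{ apply Rmin_pos; lra. }
intros v Hv. assert (B1 := Rmin_l (c / 2) (eps * c ^ 3 / 2)). assert (B2 := Rmin_r (c / 2) (eps * c ^ 3 / 2)).
assert (T := Cmod_triangle_inv u v). rewrite Cmod_minus_sym in T. fold c in T.
assert (Hvc : (c / 2 < Cmod v)%R) by lra.
assert (Hv0 : v <> 0) by (apply Cmod_gt_0; lra).
replace (/ v - / u - - / (u * u) * (v - u)) with ((v - u) * (v - u) / (u * u * v)) by (field; auto).
rewrite Cmod_div; [|repeat apply Cmult_neq_0; auto]. rewrite !Cmod_mult. fold c.
assert (Hvu := Cmod_ge_0 (v - u)).
apply Rmult_le_reg_r with (c * c * Cmod v)%R; [repeat apply Rmult_lt_0_compat; lra|].
unfold Rdiv. rewrite Rmult_assoc, Rinv_l, Rmult_1_r; [|repeat apply Rmult_integral_contrapositive_currified; lra].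
replace (eps * Cmod (v - u) * (c * c * Cmod v))%R with (Cmod (v - u) * (eps * (c * c) * Cmod v))%R by ring.
apply Rmult_le_compat_l; auto.
apply Rle_trans with (eps * (c * c) * (c / 2))%R; [|apply Rmult_le_compat_l; [|lra]].
- left. eapply Rlt_le_trans; [exact Hv|]. eapply Rle_trans; [exact B2|]. right; simpl; field.
- repeat apply Rmult_le_pos; lra.
Qed.

Lemma Re_Cexp u : Re (Cexp u) = (exp (Re u) * cos (Im u))%R. Proof. reflexivity. Qed.
Lemma Im_Cexp u : Im (Cexp u) = (exp (Re u) * sin (Im u))%R. Proof. reflexivity. Qed.

Lemma Cexp_plus (u v : C) : Cexp (u + v) = Cexp u * Cexp v.
Proof.
unfold Cexp, Cmult, Re, Im; simpl. rewrite exp_plus, cos_plus, sin_plus. f_equal; ring.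
Qed.

Lemma Cexp_RtoC (r : R) : Cexp (RtoC r) = RtoC (exp r).
Proof. unfold Cexp, RtoC; simpl. rewrite cos_0, sin_0. f_equal; ring. Qed.

Lemma Cexp_0 : Cexp 0 = 1.
Proof. rewrite Cexp_RtoC, exp_0. reflexivity. Qed.

Lemma Cmod_Cexp (u : C) : Cmod (Cexp u) = exp (Re u).
Proof.
assert (H := Cmod2_alt (Cexp u)). rewrite Re_Cexp, Im_Cexp in H.
assert (Hs := sin2_cos2 (Im u)). unfold Rsqr in Hs.
assert (Hp := exp_pos (Re u)). assert (H0 := Cmod_ge_0 (Cexp u)).
assert (E : (Cmod (Cexp u) ^ 2 = exp (Re u) ^ 2)%R).
{ rewrite H. transitivity (exp (Re u) ^ 2 * (sin (Im u) * sin (Im u) + cos (Im u) * cos (Im u)))%R; [ring|].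
  rewrite Hs; ring. }
nra.
Qed.

Lemma Cexp_neq_0 (u : C) : Cexp u <> 0.
Proof. apply Cmod_gt_0. rewrite Cmod_Cexp. apply exp_pos. Qed.

Lemma Cexp_opp (u : C) : Cexp (- u) = / Cexp u.
Proof.
assert (H : Cexp (- u) * Cexp u = 1).
{ rewrite <- Cexp_plus. replace (- u + u) with (RtoC 0) by ring. apply Cexp_0. }
assert (Hn := Cexp_neq_0 u).
transitivity (Cexp (- u) * Cexp u * / Cexp u); [field; auto|]. rewrite H. ring.
Qed.

Lemma Cexp_INR_mult (n : nat) (u : C) : Cexp (INR n * u) = Cexp u ^ n.
Proof.
induction n as [|n IH].
- simpl INR. replace (0%R * u) with (RtoC 0) by ring. rewrite Cexp_0. reflexivity.
- rewrite S_INR, RtoC_plus. replace ((INR n + 1%R) * u) with (INR n * u + u) by ring.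
  rewrite Cexp_plus, IH, Cpow_S. ring.
Qed.

Lemma derivable_pt_lim_at_0 (f : R -> R) (l eps : R) :
  derivable_pt_lim f 0 l -> (0 < eps)%R -> exists d : R, (0 < d)%R /\
  forall t, (Rabs t < d -> Rabs (f t - f 0 - l * t) <= eps * Rabs t)%R.
Proof.
intros H He. destruct (H eps He) as [d Hd]. exists d; split; [apply cond_pos|].
intros t Ht. destruct (Req_dec t 0) as [->|Hn].
- replace (f 0 - f 0 - l * 0)%R with 0%R by ring. rewrite Rabs_R0. lra.
- specialize (Hd t Hn Ht). rewrite Rplus_0_l in Hd.
  replace (f t - f 0 - l * t)%R with (((f t - f 0) / t - l) * t)%R by (field; auto).
  rewrite Rabs_mult. apply Rmult_le_compat_r; [apply Rabs_pos|lra].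
Qed.

Lemma cdiff_exp (u : C) : cdiff Cexp u (Cexp u).
Proof.
assert (Z : cdiff Cexp 0 1).
(* The errors below add up to 2 e |x| + 6 e |y|, which is at most 8 e |v|; [e <= 1] keeps |x| and
   |y| below 1. *)
{ intros eps He. set (e := Rmin 1 (eps / 8)).
  assert (He0 : (0 < e)%R) by (apply Rmin_pos; lra).
  assert (He1 : (e <= 1)%R) by apply Rmin_l. assert (He2 : (e <= eps / 8)%R) by apply Rmin_r.
  assert (P1 := derivable_pt_lim_exp 0). rewrite exp_0 in P1.
  destruct (derivable_pt_lim_at_0 exp 1 e P1 He0) as [d1 [Hd1 H1]].
  assert (P2 := derivable_pt_lim_cos 0). rewrite sin_0 in P2.
  destruct (derivable_pt_lim_at_0 cos (-0) e P2 He0) as [d2 [Hd2 H2]].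
  assert (P3 := derivable_pt_lim_sin 0). rewrite cos_0 in P3.
  destruct (derivable_pt_lim_at_0 sin 1 e P3 He0) as [d3 [Hd3 H3]].
  exists (Rmin (Rmin d1 d2) (Rmin d3 e)); split; [repeat apply Rmin_pos; lra|].
  intros v Hv. replace (v - 0) with v in * by ring.
  assert (B1 := Rmin_l (Rmin d1 d2) (Rmin d3 e)). assert (B2 := Rmin_r (Rmin d1 d2) (Rmin d3 e)).
  assert (B3 := Rmin_l d1 d2). assert (B4 := Rmin_r d1 d2).
  assert (B5 := Rmin_l d3 e). assert (B6 := Rmin_r d3 e).
  assert (X := re_le_Cmod v). assert (Y := im_le_Cmod v).
  rewrite Cexp_0. set (x := Re v) in *. set (y := Im v) in *.
  specialize (H1 x ltac:(lra)). specialize (H2 y ltac:(lra)). specialize (H3 y ltac:(lra)).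
  rewrite exp_0 in H1. rewrite cos_0 in H2. rewrite sin_0 in H3.
  replace (cos y - 1 - -0 * y)%R with (cos y - 1)%R in H2 by ring.
  replace (sin y - 0 - 1 * y)%R with (sin y - y)%R in H3 by ring.
  replace (exp x - 1 - 1 * x)%R with (exp x - 1 - x)%R in H1 by ring.
  eapply Rle_trans; [apply Cmod_le_re_im|].
  replace (Re (Cexp v - 1 - 1 * v)) with ((exp x - 1 - x) * cos y + (1 + x) * (cos y - 1))%R.
  2:{ unfold Cexp; simpl. fold x y. unfold x, y, Re, Im. ring. }
  replace (Im (Cexp v - 1 - 1 * v)) with ((exp x - 1 - x) * y + x * y + exp x * (sin y - y))%R.
  2:{ unfold Cexp; simpl. fold x y. unfold x, y, Re, Im. ring. }
  assert (Hcos : (Rabs (cos y) <= 1)%R) by (apply Rabs_le, COS_bound).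
  assert (Hx0 := Rabs_pos x). assert (Hy0 := Rabs_pos y).
  assert (Hex : (0 <= exp x <= 3)%R).
  { split; [left; apply exp_pos|]. assert (Hb := Rabs_le_between (exp x - 1 - x) (e * Rabs x)).
    apply Hb in H1. assert (x <= Rabs x)%R by apply Rle_abs. nra. }
  assert (Habs1 : (Rabs (1 + x) <= 2)%R).
  { eapply Rle_trans; [apply Rabs_triang|]. rewrite Rabs_R1. lra. }
  apply Rle_trans with ((e * Rabs x) * 1 + 2 * (e * Rabs y) + (e * Rabs x * 1 + e * Rabs y + 3 * (e * Rabs y)))%R.
  - apply Rplus_le_compat.
    + eapply Rle_trans; [apply Rabs_triang|]. rewrite !Rabs_mult.
      apply Rplus_le_compat; apply Rmult_le_compat; auto; apply Rabs_pos.
    + eapply Rle_trans; [apply Rabs_triang|]. apply Rplus_le_compat.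
      * eapply Rle_trans; [apply Rabs_triang|]. rewrite !Rabs_mult. apply Rplus_le_compat.
        { apply Rmult_le_compat; auto; try apply Rabs_pos. lra. }
        { apply Rmult_le_compat_r; auto. lra. }
      * rewrite Rabs_mult. rewrite (Rabs_pos_eq (exp x)) by lra. apply Rmult_le_compat; auto; try lra. apply Rabs_pos.
  - assert (Hc0 := Cmod_ge_0 v). nra. }
(* The addition theorem moves the derivative at 0 to an arbitrary point. *)
assert (H : cdiff (fun v => Cexp u * Cexp (v + - u)) u (0 * Cexp (u + - u) + Cexp u * (1 * (1 + 0)))).
{ apply (cdiff_mult (fun _ => Cexp u) (fun v => Cexp (v + - u))); [apply cdiff_const|].
  apply (cdiff_comp Cexp (fun v => v + - u)).
  - replace (u + - u) with (RtoC 0) by ring. exact Z.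
  - apply (cdiff_plus (fun v => v) (fun _ => - u)); [apply cdiff_id|apply cdiff_const]. }
replace (0 * Cexp (u + - u) + Cexp u * (1 * (1 + 0))) with (Cexp u) in H by ring.
eapply cdiff_ext_loc; [apply Rlt_0_1| |exact H].
intros v _. simpl. rewrite <- Cexp_plus. f_equal. ring.
Qed.

(** Multiplication by [l] is a real matrix with rows (Re l, - Im l) and (Im l, Re l). The shared
    diagonal entry is the Cauchy-Riemann equation that [divergence_free_flux] asks for. *)
Lemma cdiff_diff2 (g : C -> C) (x y : R) (l : C) : cdiff g (x, y) l ->
  diff2_at (fun s t => Re (g (s, t))) x y (Re l) (- Im l) /\
  diff2_at (fun s t => Im (g (s, t))) x y (Im l) (Re l).
Proof.
intros H. split; intros eps He; destruct (H eps He) as [d [Hd H']];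
(exists (d / 2)%R; split; [lra|]; intros s t Hs Ht;
 specialize (H' (s, t));
 assert (B := Cmod_le_re_im ((s, t) - (x, y)));
 change (Re ((s, t) - (x, y))) with (s - x)%R in B;
 change (Im ((s, t) - (x, y))) with (t - y)%R in B;
 specialize (H' ltac:(lra))).
- apply Rle_trans with (Rabs (Re (g (s, t) - g (x, y) - l * ((s, t) - (x, y))))).
  + right; f_equal. unfold Re, Im; simpl. ring.
  + eapply Rle_trans; [apply re_le_Cmod|]. eapply Rle_trans; [exact H'|].
    apply Rmult_le_compat_l; lra.
- apply Rle_trans with (Rabs (Im (g (s, t) - g (x, y) - l * ((s, t) - (x, y))))).
  + right; f_equal. unfold Re, Im; simpl. ring.
  + eapply Rle_trans; [apply im_le_Cmod|]. eapply Rle_trans; [exact H'|].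
    apply Rmult_le_compat_l; lra.
Qed.

(* In the coordinate [s] with [u = p + e^s], a punctured disc about [p] becomes a half-plane on which [h] is periodic. *)
Lemma mean_value_bound (h : C -> C) (p : C) (b M : R) :
  (forall u, (Cmod (u - p) <= exp b)%R -> exists l, cdiff h u l) ->
  (forall t : R, (0 <= t <= 2 * PI)%R -> (Cmod (h (p + Cexp (b, t))%C) <= M)%R) ->
  (Cmod (h p) <= M)%R.
Proof.
intros Hd HM. apply Rnot_lt_le; intros Hlt.
assert (HM0 : (0 <= M)%R).
{ eapply Rle_trans; [apply Cmod_ge_0|apply (HM 0%R)]. assert (P := PI_RGT_0). lra. }
assert (Hp0 : (0 < Cmod (h p))%R) by lra.
(* A rotation making c h(p) real and equal to |h(p)|, so that real parts are enough. *)
set (c := Cconj (h p) / Cmod (h p)).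
assert (Hc0 : RtoC (Cmod (h p)) <> 0) by (intros E; apply RtoC_inj in E; lra).
assert (Hc : Cmod c = 1%R).
{ unfold c. rewrite Cmod_div; auto. rewrite Cmod_conj, Cmod_R, Rabs_pos_eq by lra. field; lra. }
assert (Hcp : c * h p = Cmod (h p)).
{ unfold c. replace (Cconj (h p) / Cmod (h p) * h p) with ((h p * Cconj (h p)) / Cmod (h p)) by (field; auto).
  rewrite <- Cmod2_conj. rewrite RtoC_pow. field; auto. }
set (eps := ((Cmod (h p) - M) / 2)%R).
assert (He : (0 < eps)%R) by (unfold eps; lra).
destruct (Hd p) as [l0 Hl0].
{ replace (p - p) with (RtoC 0) by ring. rewrite Cmod_0. left; apply exp_pos. }
destruct (cdiff_continuous h p l0 Hl0 eps He) as [d [Hd0 Hcont]].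
(* Far enough to the left for the circle of radius e^a to lie where h is within [eps] of h(p). *)
set (a := Rmin (b - 1) (ln (d / 2))).
assert (Hab : (a < b)%R) by (assert (A := Rmin_l (b - 1) (ln (d / 2))); unfold a; lra).
assert (Had : (exp a < d)%R).
{ apply Rle_lt_trans with (exp (ln (d / 2))).
  - destruct (Rmin_r (b - 1) (ln (d / 2))) as [A|A]; [left; now apply exp_increasing|unfold a; rewrite A; lra].
  - rewrite exp_ln; lra. }
set (g := fun s => c * h (p + Cexp s)).
assert (Hg : forall x y : R, (x <= b)%R -> exists l, cdiff g (x, y) l).
{ intros x y Hx. destruct (Hd (p + Cexp (x, y))) as [l Hl].
  { replace (p + Cexp (x, y) - p) with (Cexp (x, y)) by ring. rewrite Cmod_Cexp. simpl.
    destruct Hx as [Hx|Hx]; [left; now apply exp_increasing|rewrite Hx; lra]. }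
  eexists. apply (cdiff_mult (fun _ => c) (fun s => h (p + Cexp s))); [apply cdiff_const|].
  apply (cdiff_comp h (fun s => p + Cexp s)); [exact Hl|].
  apply (cdiff_plus (fun _ => p) Cexp); [apply cdiff_const|apply cdiff_exp]. }
assert (HPI := PI_RGT_0).
assert (F := divergence_free_flux (fun x y => Re (g (x, y))) (fun x y => Im (g (x, y))) a 0 (b - a) (2 * PI)).
replace (a + (b - a))%R with b in F by ring. rewrite Rplus_0_l in F.
(* By periodicity the two horizontal sides cancel, so the integral of Re g over a vertical side is
   the same at [a] and at [b]. *)
assert (Per : forall x, g (x, (2 * PI)%R) = g (x, 0%R)).
{ intros x. unfold g, Cexp; simpl. rewrite cos_2PI, sin_2PI, cos_0, sin_0. reflexivity. }
rewrite (RInt_ext (fun x => Im (g (x, (2 * PI)%R)) - Im (g (x, 0%R)))%R (fun _ => 0%R)) in F.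
2:{ intros x _. rewrite Per. unfold Rminus. apply Rplus_opp_r. }
rewrite RInt_const in F. change (scal (b - a)%R 0%R) with ((b - a) * 0)%R in F. rewrite Rmult_0_r in F.
specialize (F ltac:(lra) ltac:(lra)).
assert (D : forall x y : R, (a <= x <= b)%R -> (0 <= y <= 2 * PI)%R -> exists a0 b0 c0 : R,
   diff2_at (fun x0 y0 : R => Re (g (x0, y0))) x y a0 b0 /\
   diff2_at (fun x0 y0 : R => Im (g (x0, y0))) x y c0 a0).
{ intros x y Hx _. destruct (Hg x y) as [l Hl]; [lra|].
  destruct (cdiff_diff2 g x y l Hl) as [D1 D2]. eauto. }
specialize (F D).
assert (IR : forall x, (a <= x <= b)%R -> ex_RInt (fun y => Re (g (x, y))) 0 (2 * PI)).
{ intros x Hx. apply (@ex_RInt_continuous R_CompleteNormedModule). intros z Hz.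
  rewrite Rmin_left, Rmax_right in Hz by lra.
  destruct (D x z Hx Hz) as [a0 [b0 [c0 [D1 _]]]]. apply diff2_at_swap in D1.
  now apply diff2_at_continuous_l in D1. }
assert (L : (RInt (fun y => Re (g (b, y)) - Re (g (a, y)))%R 0 (2 * PI) <= RInt (fun _ => (M - (Cmod (h p) - eps))%R) 0 (2 * PI))%R).
{ apply RInt_le; [lra| |apply @ex_RInt_const|].
  - apply (@ex_RInt_minus R_NormedModule); apply IR; lra.
  - intros y Hy.
    assert (E1 : (Re (g (b, y)) <= M)%R).
    { eapply Rle_trans; [apply Rle_abs|]. eapply Rle_trans; [apply re_le_Cmod|].
      unfold g. rewrite Cmod_mult, Hc, Rmult_1_l. apply HM; lra. }
    assert (E2 : (Rabs (Re (g (a, y) - Cmod (h p))) <= eps)%R).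
    { eapply Rle_trans; [apply re_le_Cmod|]. rewrite <- Hcp. unfold g.
      replace (c * h (p + Cexp (a, y)) - c * h p) with (c * (h (p + Cexp (a, y)) - h p)) by ring.
      rewrite Cmod_mult, Hc, Rmult_1_l. left. apply Hcont.
      replace (p + Cexp (a, y) - p) with (Cexp (a, y)) by ring. rewrite Cmod_Cexp. exact Had. }
    change (Re (g (a, y) - Cmod (h p))) with (Re (g (a, y)) - Cmod (h p))%R in E2.
    apply Rabs_le_between in E2. lra. }
rewrite F, RInt_const in L. change (scal (2 * PI - 0)%R (M - (Cmod (h p) - eps))%R) with ((2 * PI - 0) * (M - (Cmod (h p) - eps)))%R in L.
assert (X : (0 < (2 * PI - 0) * (Cmod (h p) - eps - M))%R) by (apply Rmult_lt_0_compat; unfold eps; lra).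
lra.
Qed.

Lemma Cmod_plus_sqr (u v : C) :
  (Cmod (u + v) ^ 2 = Cmod u ^ 2 + Cmod v ^ 2 + 2 * (Re u * Re v + Im u * Im v))%R.
Proof.
rewrite !Cmod2_alt. unfold Re, Im; simpl. ring.
Qed.

(* Apply [mean_value_bound] to [G * (k0 / (u - q))^n] with [q] inside the zero disc: the weight is 1 in modulus at [p]
   and uniformly below 1 on the part of the circle lying outside the zero disc. *)
Lemma zero_disc_enlarge (G : C -> C) (c : C) (r : R) :
  (0 < r)%R -> (forall u, (Cmod (u - c) < 3 * r)%R -> exists l, cdiff G u l) ->
  (forall u, (Cmod (u - c) < r)%R -> G u = 0) ->
  forall p, (Cmod (p - c) < 5 / 4 * r)%R -> G p = 0.
Proof.
intros Hr HG HZ p Hp.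
destruct (Rlt_le_dec (Cmod (p - c)) r) as [Hlt|Hge]; [now apply HZ|].
set (t := Cmod (p - c)) in *.
set (k0 := (t - r / 2)%R). assert (Hk0 : (r / 2 <= k0)%R) by (unfold k0; lra).
(* The pole of the weight lies on the segment from c to p, at distance r/2 from c, where G vanishes
   identically. *)
set (q := c + (p - c) * RtoC (r / 2 / t)).
assert (Hpq : p - q = (p - c) * RtoC (k0 / t)).
{ unfold q. replace (k0 / t)%R with (1 - r / 2 / t)%R by (unfold k0; field; lra). rewrite RtoC_minus. ring. }
assert (Hpqm : Cmod (p - q) = k0).
{ rewrite Hpq, Cmod_mult, Cmod_R, Rabs_pos_eq. fold t. field; lra.
  apply Rmult_le_pos; [lra|]. left; apply Rinv_0_lt_compat; lra. }
(* On the circle |u - p| = r outside the zero disc, |u - q|^2 >= k0^2 + r^2 - t k0. Since t < 5r/4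
   and k0 = t - r/2 < 3r/4, the product t k0 is at most 15 r^2 / 16. *)
set (k1 := sqrt (k0 ^ 2 + r ^ 2 / 16)).
assert (Hk1 : (k1 ^ 2 = k0 ^ 2 + r ^ 2 / 16)%R).
{ unfold k1. rewrite pow2_sqrt; nra. }
assert (Hk1p : (0 <= k1)%R) by apply sqrt_pos.
assert (Hk01 : (k0 < k1)%R) by nra.
assert (Hcirc : forall u, Cmod (u - p) = r -> (r <= Cmod (u - c))%R -> (k1 <= Cmod (u - q))%R).
{ intros u Hup Huc. set (e := u - p) in *.
  assert (E1 := Cmod_plus_sqr (p - c) e). replace (p - c + e) with (u - c) in E1 by (unfold e; ring).
  assert (E2 := Cmod_plus_sqr (p - q) e). replace (p - q + e) with (u - q) in E2 by (unfold e; ring).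
  rewrite Hpqm, Hup in E2. rewrite Hup in E1. fold t in E1.
  set (A := (Re (p - c) * Re e + Im (p - c) * Im e)%R) in *.
  replace (Re (p - q) * Re e + Im (p - q) * Im e)%R with (k0 / t * A)%R in E2.
  2:{ rewrite Hpq. unfold A. unfold Re, Im, RtoC; simpl. ring. }
  assert (H0 := Cmod_ge_0 (u - q)). assert (H1 := Cmod_ge_0 (u - c)).
  assert (HA : (- t ^ 2 <= 2 * A)%R) by nra.
  assert (HA' : (- (t * k0) <= 2 * (k0 / t * A))%R).
  { replace (2 * (k0 / t * A))%R with (k0 / t * (2 * A))%R by ring.
    replace (- (t * k0))%R with (k0 / t * (- t ^ 2))%R by (field; lra).
    apply Rmult_le_compat_l; auto. apply Rmult_le_pos; [lra|]. left; apply Rinv_0_lt_compat; lra. }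
  assert (HB : (t * k0 <= 15 / 16 * r ^ 2)%R) by (unfold k0; nra).
  nra. }
set (W := fun u => RtoC k0 * / (u - q)).
assert (HW : forall u, u <> q -> exists l, cdiff W u l).
{ intros u Hu. eexists. apply (cdiff_mult (fun _ => RtoC k0) (fun u => / (u - q))); [apply cdiff_const|].
  apply (cdiff_comp Cinv (fun u => u + - q)).
  - apply cdiff_inv. intros E. apply Hu. replace u with (u + - q + q) by ring. rewrite E. ring.
  - apply (cdiff_plus (fun u => u) (fun _ => - q)); [apply cdiff_id|apply cdiff_const]. }
assert (Hqc : (Cmod (q - c) < r)%R).
{ unfold q. replace (c + (p - c) * (r / 2 / t)%R - c) with ((p - c) * (r / 2 / t)%R) by ring.
  rewrite Cmod_mult, Cmod_R, Rabs_pos_eq. fold t. replace (t * (r / 2 / t))%R with (r / 2)%R by (field; lra). lra.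
  apply Rmult_le_pos; [lra|]. left; apply Rinv_0_lt_compat; lra. }
assert (Hdisc : forall u, (Cmod (u - p) <= r)%R -> (Cmod (u - c) < 3 * r)%R).
{ intros u Hu. assert (T := Cmod_triangle (u - p) (p - c)).
  replace (u - p + (p - c)) with (u - c) in T by ring. fold t in T. lra. }
assert (Hh : forall n u, (Cmod (u - p) <= r)%R -> exists l, cdiff (fun v => G v * W v ^ n) u l).
{ intros n u Hu. destruct (Rlt_le_dec (Cmod (u - c)) r) as [Hl|Hl].
  - exists 0. apply cdiff_ext_loc with (f := fun _ => 0) (d := (r - Cmod (u - c))%R); [lra| |apply cdiff_const].
    intros v Hv. rewrite HZ; [ring|]. assert (T := Cmod_triangle (v - u) (u - c)).
    replace (v - u + (u - c)) with (v - c) in T by ring. lra.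
  - assert (Huq : u <> q) by (intros ->; lra).
    destruct (HG u (Hdisc u Hu)) as [l Hl']. destruct (HW u Huq) as [m Hm].
    assert (HP : exists l, cdiff (fun v => W v ^ n) u l).
    { induction n as [|n [ln IH]].
      - exists 0. apply (cdiff_const 1).
      - eexists. apply (cdiff_mult W (fun v => W v ^ n)); eauto. }
    destruct HP as [ln Hln]. eexists. apply (cdiff_mult G (fun v => W v ^ n)); eauto. }
assert (Hb : exp (ln r) = r) by now apply exp_ln.
assert (Hcm : forall s, Cmod (p + Cexp (ln r, s) - p) = r).
{ intros s. replace (p + Cexp (ln r, s) - p) with (Cexp (ln r, s)) by ring. rewrite Cmod_Cexp. exact Hb. }
assert (HB : exists M, (0 <= M)%R /\ forall s : R, (0 <= s <= 2 * PI)%R -> (Cmod (G (p + Cexp (ln r, s))%C) <= M)%R).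
{ assert (HPI := PI_RGT_0).
  destruct (continuity_ab_maj (fun s => Cmod (G (p + Cexp (ln r, s)))) 0 (2 * PI)) as [Mx [HMx _]]; [lra| |].
  - intros s _ eps He.
    destruct (HG (p + Cexp (ln r, s))) as [l Hl]; [apply Hdisc; rewrite Hcm; lra|].
    destruct (cdiff_continuous G _ l Hl eps He) as [d [Hd Hd']].
    assert (Hce := cdiff_exp (ln r, s)).
    destruct (cdiff_continuous Cexp _ _ Hce d Hd) as [d2 [Hd2 Hd2']].
    exists d2; split; auto. intros s' [_ Hs']. simpl in *. unfold R_dist in *.
    set (A := G (p + Cexp (ln r, s'))) in *. set (B := G (p + Cexp (ln r, s))) in *.
    assert (H1 : (Cmod (A - B) < eps)%R).
    { apply Hd'. replace (p + Cexp (ln r, s') - (p + Cexp (ln r, s))) with (Cexp (ln r, s') - Cexp (ln r, s)) by ring.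
      apply Hd2'. eapply Rle_lt_trans; [apply Cmod_le_re_im|]. simpl.
      replace (ln r + - ln r)%R with 0%R by ring. rewrite Rabs_R0. unfold Rminus in Hs'. lra. }
    assert (T1 := Cmod_triangle_inv A B). assert (T2 := Cmod_triangle_inv B A). rewrite Cmod_minus_sym in T2.
    apply Rabs_def1; lra.
  - exists (Cmod (G (p + Cexp (ln r, Mx)))). split; [apply Cmod_ge_0|exact HMx]. }
destruct HB as [M [HM0 HM]].
(* The weight has modulus 1 at p, so its n-th power leaves |G(p)| alone while the circle bound
   shrinks geometrically. *)
assert (Hbound : forall n, (Cmod (G p) <= M * (k0 / k1) ^ n)%R).
{ intros n.
  replace (Cmod (G p)) with (Cmod (G p * W p ^ n)).
  2:{ rewrite Cmod_mult, Cmod_pow. unfold W. rewrite Cmod_mult, Cmod_R, Rabs_pos_eq by lra.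
      rewrite Cmod_inv by (apply Cmod_gt_0; lra). rewrite Hpqm. rewrite Rinv_r by lra. rewrite pow1. ring. }
  apply (mean_value_bound (fun v => G v * W v ^ n) p (ln r)).
  - intros u Hu. rewrite Hb in Hu. now apply Hh.
  - intros s Hs. set (u := p + Cexp (ln r, s)).
    destruct (Rlt_le_dec (Cmod (u - c)) r) as [Hl|Hl].
    + rewrite HZ by auto. rewrite Cmult_0_l, Cmod_0. apply Rmult_le_pos; auto. apply pow_le.
      apply Rmult_le_pos; [lra|]. left; apply Rinv_0_lt_compat; lra.
    + rewrite Cmod_mult, Cmod_pow. specialize (Hcirc u (Hcm s) Hl).
      apply Rmult_le_compat; [apply Cmod_ge_0|apply pow_le, Cmod_ge_0|now apply HM|].
      apply pow_incr; split; [apply Cmod_ge_0|]. unfold W.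
      rewrite Cmod_mult, Cmod_R, Rabs_pos_eq by lra. rewrite Cmod_inv by (apply Cmod_gt_0; lra).
      apply Rmult_le_compat_l; [lra|]. apply Rinv_le_contravar; lra. }
apply Cmod_eq_0. apply Rle_antisym; [|apply Cmod_ge_0].
assert (L : is_lim_seq (fun n => (M * (k0 / k1) ^ n)%R) 0).
{ replace (Finite 0) with (Rbar_mult M 0) by (simpl; f_equal; ring).
  apply (is_lim_seq_scal_l (fun n => (k0 / k1) ^ n)%R M 0). apply is_lim_seq_geom. rewrite Rabs_pos_eq.
  - apply Rmult_lt_reg_r with k1; [lra|]. unfold Rdiv. rewrite Rmult_assoc, Rinv_l; lra.
  - apply Rmult_le_pos; [lra|]. left; apply Rinv_0_lt_compat; lra. }
apply (is_lim_seq_le (fun _ => Cmod (G p)) _ (Cmod (G p)) 0 Hbound); auto. apply is_lim_seq_const.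
Qed.

(** A disc of radius r whose centre moved by at most r/4 still lies in the disc of radius 5r/4 given
    by [zero_disc_enlarge]; the radius is thus kept while the centre advances. *)
Lemma zero_disc_translate (G : C -> C) (c e : C) (r : R) (n : nat) :
  (0 < r)%R -> (Cmod e <= r / 4)%R ->
  (forall k u, (k <= n)%nat -> (Cmod (u - (c + INR k * e)) < 3 * r)%R -> exists l, cdiff G u l) ->
  (forall u, (Cmod (u - c) < r)%R -> G u = 0) ->
  forall u, (Cmod (u - (c + INR n * e)) < r)%R -> G u = 0.
Proof.
intros Hr He. induction n as [|n IH]; intros HG HZ u Hu.
- apply HZ. simpl INR in Hu. replace (u - c) with (u - (c + 0 * e)) by ring. exact Hu.
- apply (zero_disc_enlarge G (c + INR n * e) r Hr).
  + intros v Hv. apply (HG n v); auto.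
  + apply IH; [intros k v Hk; apply HG; lia|exact HZ].
  + rewrite S_INR, RtoC_plus in Hu. 
    assert (T := Cmod_triangle (u - (c + (INR n + 1) * e)) e).
    replace (u - (c + (INR n + 1) * e) + e) with (u - (c + INR n * e)) in T by ring. lra.
Qed.

Lemma zero_along_segment (G : C -> C) (c p : C) (r : R) :
  (0 < r)%R ->
  (forall t u : C, Im t = 0%R -> (0 <= Re t <= 1)%R -> (Cmod (u - (c + t * (p - c))) < 3 * r)%R -> exists l, cdiff G u l) ->
  (forall u, (Cmod (u - c) < r)%R -> G u = 0) -> G p = 0.
Proof.
intros Hr HG HZ.
destruct (nfloor_ex (Cmod (p - c) / (r / 4))) as [n [_ Hn]].
{ apply Rmult_le_pos; [apply Cmod_ge_0|]. left; apply Rinv_0_lt_compat; lra. }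
assert (HN : (0 < INR (S n))%R) by (apply lt_0_INR; lia).
assert (HN' : RtoC (INR (S n)) <> 0) by (intros E; apply RtoC_inj in E; lra).
set (e := (p - c) * / RtoC (INR (S n))).
apply (zero_disc_translate G c e r (S n) Hr).
- unfold e. rewrite Cmod_mult, Cmod_inv, Cmod_R, Rabs_pos_eq by (auto; lra). rewrite S_INR in *.
  apply Rmult_le_reg_r with ((INR n + 1) / (r / 4))%R; [apply Rdiv_lt_0_compat; lra|].
  replace (Cmod (p - c) * / (INR n + 1) * ((INR n + 1) / (r / 4)))%R with (Cmod (p - c) / (r / 4))%R by (field; lra).
  replace (r / 4 * ((INR n + 1) / (r / 4)))%R with (INR n + 1)%R by (field; lra). lra.
- intros k u Hk Hu. apply (HG (RtoC (INR k / INR (S n))) u); [reflexivity| |].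
  + simpl Re. assert (K := le_INR k (S n) Hk). assert (K0 := pos_INR k). split.
    * apply Rmult_le_pos; auto. left; now apply Rinv_0_lt_compat.
    * apply Rmult_le_reg_r with (INR (S n)); auto. unfold Rdiv. rewrite Rmult_assoc, Rinv_l; lra.
  + replace ((INR k / INR (S n))%R * (p - c)) with (INR k * e); [exact Hu|].
    unfold e. rewrite RtoC_div by lra. field. auto.
- exact HZ.
- replace (p - (c + INR (S n) * e)) with (RtoC 0); [rewrite Cmod_0; auto|]. unfold e. field. auto.
Qed.

(* Reflection trick: [f] vanishes on the real axis, so [f] above it glued to 0 below it is again holomorphic. *)
Lemma zero_from_real_axis (f : C -> C) (H sg : R) : (0 < H)%R -> (sg * sg = 1)%R ->
  (forall s, (Re s < 0)%R -> (Rabs (Im s) < H)%R -> exists l, cdiff f s l) ->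
  (forall t : R, (t < 0)%R -> f (RtoC t) = 0) ->
  forall s, (Re s < 0)%R -> (0 <= sg * Im s < H)%R -> f s = 0.
Proof.
intros HH Hsg Hf H0 s Hs1 Hs2.
destruct (Req_dec (Im s) 0) as [E|E].
{ replace s with (RtoC (Re s)); [now apply H0|]. destruct s as [a b]; simpl in *. unfold RtoC; f_equal; auto. }
assert (Hpos : (0 < sg * Im s)%R) by (destruct (proj1 Hs2); auto; nra).
set (g := fun u : C => if Rlt_dec 0 (sg * Im u) then f u else 0).
assert (Hsgabs : Rabs sg = 1%R).
{ unfold Rabs; destruct (Rcase_abs sg); nra. }
assert (Hab : forall x, Rabs (sg * x) = Rabs x) by (intros x; rewrite Rabs_mult, Hsgabs; ring).
assert (Hg : forall u, (Re u < 0)%R -> (Rabs (Im u) < H)%R -> exists l, cdiff g u l).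
{ intros u Hu1 Hu2. destruct (Rtotal_order 0 (sg * Im u)) as [L|[L|L]].
  - destruct (Hf u Hu1 Hu2) as [l Hl]. exists l.
    apply cdiff_ext_loc with (f := f) (d := (sg * Im u)%R); auto.
    intros v Hv. unfold g. destruct (Rlt_dec 0 (sg * Im v)); auto. exfalso.
    assert (B := im_le_Cmod (v - u)). change (Im (v - u)) with (Im v - Im u)%R in B.
    rewrite <- (Hab (Im v - Im u)%R) in B. apply Rabs_le_between in B. lra.
  - (* differentiability of [f] at a real point, tested along the real axis, forces the derivative 0 *)
    assert (Iu : Im u = 0%R) by nra.
    assert (Eu : u = RtoC (Re u)) by (destruct u as [a b]; simpl in *; unfold RtoC; f_equal; auto).
    assert (Fu : f u = 0) by (rewrite Eu; now apply H0).
    destruct (Hf u Hu1 Hu2) as [l Hl].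
    assert (Hl0 : l = 0).
    { apply Cmod_eq_0. apply Rle_antisym; [|apply Cmod_ge_0]. apply le_epsilon. intros eps He.
      destruct (Hl eps He) as [d [Hd Hd']].
      set (k := (Rmin (d / 2) (- Re u / 2))%R).
      assert (Hk : (0 < k)%R) by (apply Rmin_pos; lra).
      assert (Hk1 : (k <= d / 2)%R) by apply Rmin_l. assert (Hk2 : (k <= - Re u / 2)%R) by apply Rmin_r.
      specialize (Hd' (u + RtoC k)). replace (u + k - u) with (RtoC k) in Hd' by ring.
      rewrite Cmod_R, Rabs_pos_eq in Hd' by lra. specialize (Hd' ltac:(lra)).
      rewrite Fu in Hd'. replace (f (u + k)) with (RtoC 0) in Hd'.
      2:{ rewrite Eu, <- RtoC_plus. symmetry; apply H0. lra. }
      replace (0 - 0 - l * k) with (- (l * k)) in Hd' by ring.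
      rewrite Cmod_opp, Cmod_mult, Cmod_R, Rabs_pos_eq in Hd' by lra. nra. }
    subst l. exists 0. intros eps He. destruct (Hl eps He) as [d [Hd Hd']].
    exists d; split; auto. intros v Hv. specialize (Hd' v Hv).
    unfold g at 2. destruct (Rlt_dec 0 (sg * Im u)) as [A|A]; [lra|].
    unfold g. destruct (Rlt_dec 0 (sg * Im v)) as [A'|A'].
    + rewrite Fu in Hd'. exact Hd'.
    + replace (0 - 0 - 0 * (v - u)) with (RtoC 0) by ring. rewrite Cmod_0.
      apply Rmult_le_pos; [lra|apply Cmod_ge_0].
  - exists 0. apply cdiff_ext_loc with (f := fun _ => 0) (d := (- (sg * Im u))%R); [lra| |apply cdiff_const].
    intros v Hv. unfold g. destruct (Rlt_dec 0 (sg * Im v)); auto. exfalso.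
    assert (B := im_le_Cmod (v - u)). change (Im (v - u)) with (Im v - Im u)%R in B.
    rewrite <- (Hab (Im v - Im u)%R) in B. apply Rabs_le_between in B. lra. }
assert (Hgs : g s = f s) by (unfold g; destruct (Rlt_dec 0 (sg * Im s)); auto; lra).
rewrite <- Hgs.
set (m := (Rmin (- Re s) (H - sg * Im s))%R).
assert (Hm : (0 < m)%R) by (apply Rmin_pos; lra).
assert (Hm1 : (m <= - Re s)%R) by apply Rmin_l. assert (Hm2 : (m <= H - sg * Im s)%R) by apply Rmin_r.
(* The starting disc lies on the far side of the axis, centred at depth r, where g = 0. The tube of
   radius 3r around the segment reaches depth at most 4r, so 5r <= m keeps it inside the strip. *)
set (r := (m / 5)%R).
apply (zero_along_segment g (Re s, (- (sg * r))%R) s r); [unfold r; lra| |].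
- intros t u Ht1 Ht2 Hu. destruct t as [t t']; simpl in Ht1, Ht2. subst t'.
  assert (B1 := re_le_Cmod (u - ((Re s, (- (sg * r))%R) + (t, 0%R) * (s - (Re s, (- (sg * r))%R))))).
  assert (B2 := im_le_Cmod (u - ((Re s, (- (sg * r))%R) + (t, 0%R) * (s - (Re s, (- (sg * r))%R))))).
  match type of B1 with (Rabs ?X <= _)%R => replace X with (Re u - Re s)%R in B1
    by (unfold Re, Im; simpl; ring) end.
  match type of B2 with (Rabs ?X <= _)%R => replace X with (Im u - ((1 - t) * (- (sg * r)) + t * Im s))%R in B2
    by (unfold Re, Im; simpl; ring) end.
  apply Hg.
  + apply Rabs_le_between in B1. unfold r in *; lra.
  + rewrite <- Hab. rewrite <- Hab in B2.
    replace (sg * (Im u - ((1 - t) * - (sg * r) + t * Im s)))%R with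
      (sg * Im u + (sg * sg) * ((1 - t) * r) - t * (sg * Im s))%R in B2 by ring.
    rewrite Hsg in B2. set (I := (sg * Im u)%R) in *. set (S := (sg * Im s)%R) in *.
    apply Rabs_le_between in B2. assert (Hr : (0 < r)%R) by (unfold r; lra).
    assert (Hr5 : (5 * r <= H - S)%R) by (unfold r; lra).
    apply Rabs_def1; nra.
- intros u Hu. unfold g. destruct (Rlt_dec 0 (sg * Im u)) as [A|A]; auto. exfalso.
  assert (B := im_le_Cmod (u - (Re s, (- (sg * r))%R))).
  change (Im (u - (Re s, (- (sg * r))%R))) with (Im u - (- (sg * r)))%R in B.
  rewrite <- Hab in B. replace (sg * (Im u - - (sg * r)))%R with (sg * Im u + (sg * sg) * r)%R in B by ring.
  rewrite Hsg in B. apply Rabs_le_between in B. lra.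
Qed.

Lemma zero_on_strip (f : C -> C) (H : R) : (0 < H)%R ->
  (forall s, (Re s < 0)%R -> (Rabs (Im s) < H)%R -> exists l, cdiff f s l) ->
  (forall t : R, (t < 0)%R -> f (RtoC t) = 0) ->
  forall s, (Re s < 0)%R -> (Rabs (Im s) < H)%R -> f s = 0.
Proof.
intros HH Hf H0 s Hs1 Hs2. apply Rabs_def2 in Hs2.
destruct (Rle_lt_dec 0 (Im s)) as [L|L].
- apply (zero_from_real_axis f H 1); auto; lra.
- apply (zero_from_real_axis f H (-1)); auto; lra.
Qed.

(** * Complex series *)

Definition CSeries (a : nat -> C) : C :=
  (Series (fun k => Re (a k)), Series (fun k => Im (a k))).

Lemma is_series_pair (a : nat -> C) (x y : R) :
  is_series (fun k => Re (a k)) x -> is_series (fun k => Im (a k)) y ->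
  is_series a ((x, y) : C).
Proof.
intros Hx Hy.
assert (E : forall n, sum_n a n = (sum_n (fun k => Re (a k)) n, sum_n (fun k => Im (a k)) n)).
{ intros n. induction n as [|n IH]; [rewrite !sum_O; now destruct (a O)|].
  rewrite !sum_Sn, IH. destruct (a (S n)); reflexivity. }
unfold is_series in *. apply filterlim_locally. intros eps.
assert (Hx' := proj1 (filterlim_locally _ _) Hx eps). assert (Hy' := proj1 (filterlim_locally _ _) Hy eps).
generalize (filter_and _ _ Hx' Hy'). apply filter_imp. intros n [H1 H2]. rewrite E. split; assumption.
Qed.

Lemma is_series_CSeries (a : nat -> C) :
  ex_series (fun k => Cmod (a k)) -> is_series a (CSeries a).
Proof.
intros H. apply is_series_pair; apply Series_correct;
 apply (@ex_series_le R_AbsRing R_CompleteNormedModule) with (b := fun k => Cmod (a k)); auto; intros n.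
- apply re_le_Cmod.
- apply im_le_Cmod.
Qed.

Lemma CSeries_unique (a : nat -> C) (s : C) : is_series a s -> CSeries a = s.
Proof.
intros H.
assert (E : forall n, sum_n a n = (sum_n (fun k => Re (a k)) n, sum_n (fun k => Im (a k)) n)).
{ intros n. induction n as [|n IH]; [rewrite !sum_O; now destruct (a O)|].
  rewrite !sum_Sn, IH. destruct (a (S n)); reflexivity. }
unfold CSeries. destruct s as [x y]. f_equal; apply is_series_unique; apply filterlim_locally; intros eps;
generalize (proj1 (filterlim_locally _ _) H eps); apply filter_imp; intros n Hn; rewrite E in Hn; apply Hn.
Qed.

Lemma Cmod_CSeries (a : nat -> C) (b : nat -> R) :
  (forall k, (Cmod (a k) <= b k)%R) -> ex_series b -> (Cmod (CSeries a) <= Series b)%R.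
Proof.
intros Hab Hb.
assert (Ha : ex_series (fun k => Cmod (a k))).
{ apply (@ex_series_le R_AbsRing R_CompleteNormedModule) with (b := b); auto. intros n.
  change (Rabs (Cmod (a n)) <= b n)%R. rewrite Rabs_pos_eq; auto. apply Cmod_ge_0. }
assert (Hs := is_series_CSeries a Ha).
assert (L1 : is_lim_seq (fun n => Cmod (sum_n a n)) (Cmod (CSeries a))).
{ apply filterlim_comp with (G := locally (CSeries a : C_NormedModule)); [exact Hs|].
  apply (filterlim_norm (V := C_NormedModule) (CSeries a)). }
assert (L2 : is_lim_seq (sum_n b) (Series b)) by now apply Series_correct.
apply (is_lim_seq_le _ _ (Cmod (CSeries a)) (Series b)) with (2 := L1) (3 := L2).
intros n. induction n as [|n IH]; [rewrite !sum_O; auto|].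
rewrite !sum_Sn. eapply Rle_trans; [apply Cmod_triangle|]. apply Rplus_le_compat; auto.
Qed.

Lemma ex_series_pos_le (a b : nat -> R) :
  (forall k, (0 <= a k <= b k)%R) -> ex_series b -> ex_series a.
Proof.
intros H Hb. apply (@ex_series_le R_AbsRing R_CompleteNormedModule) with (b := b); auto.
intros n. change (Rabs (a n) <= b n)%R. rewrite Rabs_pos_eq; apply H.
Qed.

(** Term-by-term differentiation from a summable quadratic remainder: the errors add up to Series M
    |v - u|^2, which is o(|v - u|). *)
Lemma cdiff_CSeries (f : nat -> C -> C) (l : nat -> C) (M : nat -> R) (u : C) (d : R) :
  (0 < d)%R ->
  (forall v, (Cmod (v - u) < d)%R -> ex_series (fun k => Cmod (f k v))) ->
  ex_series (fun k => Cmod (l k)) -> ex_series M ->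
  (forall k v, (Cmod (v - u) < d)%R -> (Cmod (f k v - f k u - l k * (v - u)) <= M k * Cmod (v - u) ^ 2)%R) ->
  cdiff (fun v => CSeries (fun k => f k v)) u (CSeries l).
Proof.
intros Hd Hf Hl HM Hrem eps He.
set (K := (Rabs (Series M) + 1)%R). assert (HK : (0 < K)%R) by (unfold K; assert (A := Rabs_pos (Series M)); lra).
exists (Rmin d (eps / K)); split; [apply Rmin_pos; auto; now apply Rdiv_lt_0_compat|].
intros v Hv. assert (B1 := Rmin_l d (eps / K)). assert (B2 := Rmin_r d (eps / K)).
assert (Su := is_series_CSeries (fun k => f k u)). assert (Sv := is_series_CSeries (fun k => f k v)).
specialize (Hf v ltac:(lra)) as Hfv.
assert (Hfu : ex_series (fun k => Cmod (f k u))).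
{ apply Hf. replace (u - u) with (RtoC 0) by ring. rewrite Cmod_0; auto. }
specialize (Su Hfu). specialize (Sv Hfv). assert (Sl := is_series_CSeries l Hl).
assert (S1 : is_series (fun k => f k v - f k u - l k * (v - u))
   (CSeries (fun k => f k v) - CSeries (fun k => f k u) - CSeries l * (v - u))).
{ apply (is_series_minus (V := C_NormedModule) (fun k => f k v - f k u) (fun k => l k * (v - u))).
  - now apply (is_series_minus (V := C_NormedModule) (fun k => f k v) (fun k => f k u)).
  - replace (CSeries l * (v - u)) with (scal (v - u) (CSeries l : C_NormedModule)) by (apply Cmult_comm).
    apply is_series_ext with (a := fun k => scal (v - u) (l k : C_NormedModule)); [intros k; apply Cmult_comm|].
    now apply (is_series_scal (V := C_NormedModule) (v - u) l). }
rewrite <- (CSeries_unique _ _ S1).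
eapply Rle_trans.
- apply Cmod_CSeries with (b := fun k => (M k * Cmod (v - u) ^ 2)%R).
  + intros k. apply Hrem. lra.
  + apply (ex_series_scal_r (Cmod (v - u) ^ 2)%R M HM).
- rewrite Series_scal_r. assert (Hc := Cmod_ge_0 (v - u)).
  assert (A := Rle_abs (Series M)).
  apply Rle_trans with (K * Cmod (v - u) * Cmod (v - u))%R.
  + simpl. rewrite Rmult_1_r, <- Rmult_assoc. apply Rmult_le_compat_r; auto.
    apply Rmult_le_compat_r; auto. unfold K; lra.
  + apply Rmult_le_compat_r; auto. apply Rle_trans with (K * (eps / K))%R; [apply Rmult_le_compat_l; lra|].
    right; field; lra.
Qed.

Lemma CV_radius_bounded_ge_1 (a : nat -> R) (M : R) :
  (forall n, (Rabs (a n) <= M)%R) -> Rbar_le 1 (CV_radius a).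
Proof.
intros H. apply (CV_radius_bounded a). exists M. intros n. now rewrite pow1, Rmult_1_r.
Qed.

Lemma CV_radius_inside_1 (a : nat -> R) (M x : R) :
  (forall n, (Rabs (a n) <= M)%R) -> (Rabs x < 1)%R -> Rbar_lt (Rabs x) (CV_radius a).
Proof.
intros H Hx. eapply Rbar_lt_le_trans; [|eapply CV_radius_bounded_ge_1; eauto]. exact Hx.
Qed.

Lemma pow_le_1 (t : R) (n : nat) : (0 <= t <= 1 -> 0 <= t ^ n <= 1)%R.
Proof. intros H. split; [apply pow_le; lra|]. rewrite <- (pow1 n). apply pow_incr; lra. Qed.

(** The third derivative of the geometric series has coefficients (n+1)(n+2)(n+3) >= n^3. The cube
    is what the Lambert series needs: a factor n from the term and n^2 from the Taylor remainder of
    a power. *)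
Lemma ex_series_cube_pow (r : R) : (0 <= r < 1)%R ->
  ex_series (fun n => (INR n ^ 3 * r ^ n)%R).
Proof.
intros Hr. set (a := fun _ : nat => 1%R).
assert (E : ex_pseries (PS_derive (PS_derive (PS_derive a))) r).
{ apply ex_pseries_derive. rewrite !CV_radius_derive.
  apply CV_radius_inside_1 with (M := 1%R); [intros n; unfold a; rewrite Rabs_R1; lra|rewrite Rabs_pos_eq; lra]. }
apply ex_pseries_R in E.
apply ex_series_pos_le with (2 := E). intros k. assert (Hk := pos_INR k). assert (Hp := pow_le r k (proj1 Hr)). split.
- apply Rmult_le_pos; auto. now apply pow_le.
- unfold PS_derive, a. rewrite Rmult_1_r. apply Rmult_le_compat_r; auto. rewrite !S_INR.
  apply Rle_trans with ((INR k + 1) * (INR k + 1) * (INR k + 1))%R; [nra|].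
  rewrite <- Rmult_assoc. apply Rmult_le_compat; nra.
Qed.

Lemma ex_series_linear_pow (r : R) : (0 <= r < 1)%R -> ex_series (fun n => (INR n * r ^ n)%R).
Proof.
intros Hr. apply ex_series_pos_le with (2 := ex_series_cube_pow r Hr). intros k.
assert (Hk := pos_INR k). assert (Hp := pow_le r k (proj1 Hr)). split; [now apply Rmult_le_pos|].
apply Rmult_le_compat_r; auto. destruct k; [simpl; lra|]. 
assert (1 <= INR (S k))%R by (rewrite S_INR in *; assert (B := pos_INR k); lra). nra.
Qed.

Lemma pow_diff_bound (u v : C) (r : R) (n : nat) :
  (0 < r)%R -> (Cmod u <= r)%R -> (Cmod v <= r)%R ->
  (r * Cmod (v ^ n - u ^ n) <= INR n * r ^ n * Cmod (v - u))%R.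
Proof.
intros Hr Hu Hv. induction n as [|n IH].
- simpl. replace (1 - 1) with (RtoC 0) by ring. rewrite Cmod_0. lra.
- rewrite !Cpow_S. replace (v * v ^ n - u * u ^ n) with (v * (v ^ n - u ^ n) + (v - u) * u ^ n) by ring.
  assert (T := Cmod_triangle (v * (v ^ n - u ^ n)) ((v - u) * u ^ n)).
  rewrite !Cmod_mult, Cmod_pow in T. rewrite S_INR. simpl (r ^ S n)%R.
  assert (P : (Cmod u ^ n <= r ^ n)%R) by (apply pow_incr; split; auto; apply Cmod_ge_0).
  assert (H0 := Cmod_ge_0 (v - u)). assert (H1 := Cmod_ge_0 (v ^ n - u ^ n)). assert (H2 := Cmod_ge_0 v).
  assert (Q : (Cmod v * Cmod (v ^ n - u ^ n) <= r * Cmod (v ^ n - u ^ n))%R) by (apply Rmult_le_compat_r; auto).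
  assert (Q2 : (Cmod (v - u) * Cmod u ^ n <= Cmod (v - u) * r ^ n)%R) by (apply Rmult_le_compat_l; auto).
  apply Rle_trans with (r * (INR n * r ^ n * Cmod (v - u) + Cmod (v - u) * r ^ n))%R; [|right; ring].
  apply Rmult_le_compat_l; lra.
Qed.

(** Induction on n through v^(n+1) = v v^n. The factor r^2 on the left avoids the exponent n - 2;
    for n = 0 the coefficient [INR n] cancels the truncated [pred n]. *)
Lemma pow_taylor_bound (u v : C) (r : R) (n : nat) :
  (0 < r)%R -> (Cmod u <= r)%R -> (Cmod v <= r)%R ->
  (r ^ 2 * Cmod (v ^ n - u ^ n - INR n * u ^ pred n * (v - u)) <= INR n ^ 2 * r ^ n * Cmod (v - u) ^ 2)%R.
Proof.
intros Hr Hu Hv.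
assert (Hpred : forall n, INR n * u ^ pred n * u = INR n * u ^ n).
{ intros [|k]; [simpl; ring|]. simpl pred. rewrite Cpow_S. ring. }
assert (H0 := Cmod_ge_0 (v - u)).
induction n as [|n IH].
- simpl. replace (1 - 1 - 0 * 1 * (v - u)) with (RtoC 0) by ring. rewrite Cmod_0. lra.
- simpl pred. rewrite S_INR, RtoC_plus.
  replace (v ^ S n - u ^ S n - (INR n + 1) * u ^ n * (v - u)) with
   (v * (v ^ n - u ^ n - INR n * u ^ pred n * (v - u)) + INR n * u ^ pred n * (v - u) * (v - u)).
  2:{ rewrite !Cpow_S. specialize (Hpred n).
      transitivity (v * (v ^ n) - v * u ^ n - (INR n * u ^ pred n * u) * (v - u)); [ring|].
      rewrite Hpred. ring. }
  set (Rn := v ^ n - u ^ n - INR n * u ^ pred n * (v - u)) in *.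
  assert (T := Cmod_triangle (v * Rn) (INR n * u ^ pred n * (v - u) * (v - u))).
  rewrite !Cmod_mult, Cmod_pow, Cmod_R, Rabs_pos_eq in T by apply pos_INR.
  assert (H1 := Cmod_ge_0 Rn). assert (Hn := pos_INR n).
  assert (Q : (Cmod v * Cmod Rn <= r * Cmod Rn)%R) by (apply Rmult_le_compat_r; auto).
  assert (Q2 : (r * (INR n * Cmod u ^ pred n) <= INR n * r ^ n)%R).
  { destruct n as [|k]; [simpl; lra|]. simpl pred. simpl (r ^ S k)%R.
    assert (P : (Cmod u ^ k <= r ^ k)%R) by (apply pow_incr; split; auto; apply Cmod_ge_0).
    apply Rle_trans with (r * (INR (S k) * r ^ k))%R; [|right; ring].
    apply Rmult_le_compat_l; [lra|]. apply Rmult_le_compat_l; auto. }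
  apply Rle_trans with (r ^ 2 * (r * Cmod Rn + INR n * Cmod u ^ pred n * Cmod (v - u) * Cmod (v - u)))%R.
  { apply Rmult_le_compat_l; [apply pow2_ge_0|]. lra. }
  assert (Hrn : (0 <= r ^ n)%R) by (apply pow_le; lra).
  assert (Hcc : (0 <= Cmod (v - u) ^ 2)%R) by apply pow2_ge_0.
  simpl (r ^ S n)%R.
  apply Rle_trans with (r * (INR n ^ 2 * r ^ n * Cmod (v - u) ^ 2) + r * (INR n * r ^ n) * Cmod (v - u) ^ 2)%R.
  + apply Rle_trans with (r * (r ^ 2 * Cmod Rn) + r * (r * (INR n * Cmod u ^ pred n)) * Cmod (v - u) ^ 2)%R; [right; ring|].
    apply Rplus_le_compat.
    * apply Rmult_le_compat_l; lra.
    * apply Rmult_le_compat_r; auto. apply Rmult_le_compat_l; lra.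
  + apply Rle_trans with ((INR n ^ 2 + INR n) * (r * r ^ n) * Cmod (v - u) ^ 2)%R; [right; ring|].
    apply Rmult_le_compat_r; auto. apply Rmult_le_compat_r; [apply Rmult_le_pos; lra|]. nra.
Qed.

Definition CPS (a : nat -> R) (u : C) : C := CSeries (fun n => a n * u ^ n).

Lemma ex_series_Cmod_CPS (a : nat -> R) (M : R) (u : C) :
  (forall n, (Rabs (a n) <= M)%R) -> (Cmod u < 1)%R -> ex_series (fun n => Cmod (a n * u ^ n)).
Proof.
intros Ha Hu. assert (H0 := Cmod_ge_0 u).
apply ex_series_pos_le with (b := fun n => (M * Cmod u ^ n)%R).
- intros n. split; [apply Cmod_ge_0|]. rewrite Cmod_mult, Cmod_R, Cmod_pow.
  apply Rmult_le_compat_r; auto. now apply pow_le.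
- apply (ex_series_scal_l M (fun n => Cmod u ^ n)%R).
  apply ex_series_geom. rewrite Rabs_pos_eq; auto.
Qed.

Lemma cdiff_CPS (a : nat -> R) (M : R) (u : C) :
  (forall n, (Rabs (a n) <= M)%R) -> (Cmod u < 1)%R -> exists l, cdiff (CPS a) u l.
Proof.
intros Ha Hu. assert (H0 := Cmod_ge_0 u).
assert (HM : (0 <= M)%R) by (eapply Rle_trans; [apply (Rabs_pos (a O))|apply Ha]).
set (r := ((1 + Cmod u) / 2)%R).
assert (Hr : (0 <= r < 1)%R) by (unfold r; lra). assert (Hr2 : (0 < r ^ 2)%R) by (apply pow_lt; unfold r; lra).
eexists. apply (cdiff_CSeries (fun n v => a n * v ^ n) (fun n => a n * (INR n * u ^ pred n))
  (fun n => (M / r ^ 2 * (INR n ^ 3 * r ^ n))%R) u (r - Cmod u)).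
- unfold r; lra.
- intros v Hv. apply ex_series_Cmod_CPS with (M := M); auto.
  assert (T := Cmod_triangle (v - u) u). replace (v - u + u) with v in T by ring. lra.
- apply ex_series_pos_le with (b := fun n => (M / r * (INR n * r ^ n))%R).
  + intros n. split; [apply Cmod_ge_0|]. rewrite !Cmod_mult, !Cmod_R, Cmod_pow, (Rabs_pos_eq (INR n)) by apply pos_INR.
    replace (M / r * (INR n * r ^ n))%R with (M * (INR n * r ^ n / r))%R by (field; unfold r; lra).
    apply Rmult_le_compat; auto; try apply Rabs_pos.
    { apply Rmult_le_pos; [apply pos_INR|now apply pow_le]. }
    destruct n as [|k]; [simpl; unfold Rdiv; lra|]. simpl pred. simpl (r ^ S k)%R.
    replace (INR (S k) * (r * r ^ k) / r)%R with (INR (S k) * r ^ k)%R by (field; unfold r; lra).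
    apply Rmult_le_compat_l; [apply pos_INR|]. apply pow_incr. unfold r; lra.
  + apply (ex_series_scal_l (M / r)%R (fun n => INR n * r ^ n)%R). now apply ex_series_linear_pow.
- apply (ex_series_scal_l (M / r ^ 2)%R (fun n => INR n ^ 3 * r ^ n)%R). now apply ex_series_cube_pow.
- intros n v Hv. assert (T := Cmod_triangle (v - u) u). replace (v - u + u) with v in T by ring.
  replace (a n * v ^ n - a n * u ^ n - a n * (INR n * u ^ pred n) * (v - u)) with
   (a n * (v ^ n - u ^ n - INR n * u ^ pred n * (v - u))) by ring.
  rewrite Cmod_mult, Cmod_R.
  assert (B := pow_taylor_bound u v r n ltac:(unfold r; lra) ltac:(unfold r; lra) ltac:(lra)).
  set (X := Cmod (v ^ n - u ^ n - INR n * u ^ pred n * (v - u))) in *.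
  assert (HX : (0 <= X)%R) by apply Cmod_ge_0.
  replace (M / r ^ 2 * (INR n ^ 3 * r ^ n) * Cmod (v - u) ^ 2)%R with
   (M * ((INR n ^ 3 * r ^ n) * Cmod (v - u) ^ 2 / r ^ 2))%R by (field; unfold r; lra).
  apply Rmult_le_compat; auto; [apply Rabs_pos|].
  apply Rmult_le_reg_l with (r ^ 2)%R; auto.
  replace (r ^ 2 * (INR n ^ 3 * r ^ n * Cmod (v - u) ^ 2 / r ^ 2))%R with (INR n ^ 3 * (r ^ n * Cmod (v - u) ^ 2))%R by (field; unfold r; lra).
  eapply Rle_trans; [exact B|]. rewrite Rmult_assoc.
  apply Rmult_le_compat_r.
  + apply Rmult_le_pos; [now apply pow_le|apply pow2_ge_0].
  + destruct n as [|k]; [simpl; lra|]. assert (1 <= INR (S k))%R by (rewrite S_INR; assert (Q := pos_INR k); lra). nra.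
Qed.

Lemma Cmod_one_plus (t : C) (r : R) : (Cmod t <= r)%R -> (r < 1)%R ->
  (1 - r <= Cmod (1 + t))%R /\ 1 + t <> 0.
Proof.
intros Ht Hr. assert (T := Cmod_triangle_inv 1 (- t)). replace (1 - - t) with (1 + t) in T by ring.
rewrite Cmod_opp, Cmod_1 in T. split; [lra|]. apply Cmod_gt_0. lra.
Qed.

(** The remainder is exactly -(t' - t)^2 / ((1 + t)^2 (1 + t')), and each factor 1 + t stays at
    distance 1 - r from 0. *)
Lemma lambert_taylor_bound (t t' : C) (r : R) : (Cmod t <= r)%R -> (Cmod t' <= r)%R -> (0 <= r < 1)%R ->
  (Cmod (t' / (1 + t') - t / (1 + t) - (t' - t) / ((1 + t) * (1 + t))) <= Cmod (t' - t) ^ 2 / (1 - r) ^ 3)%R.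
Proof.
intros Ht Ht' Hr.
destruct (Cmod_one_plus t r Ht ltac:(lra)) as [B1 N1]. destruct (Cmod_one_plus t' r Ht' ltac:(lra)) as [B2 N2].
replace (t' / (1 + t') - t / (1 + t) - (t' - t) / ((1 + t) * (1 + t))) with
  (- ((t' - t) * (t' - t) / ((1 + t) * (1 + t) * (1 + t')))) by (field; auto).
rewrite Cmod_opp, Cmod_div by (repeat apply Cmult_neq_0; auto). rewrite !Cmod_mult.
unfold Rdiv. simpl (Cmod (t' - t) ^ 2)%R. rewrite Rmult_1_r.
apply Rmult_le_compat_l; [apply Rmult_le_pos; apply Cmod_ge_0|].
apply Rinv_le_contravar; [apply pow_lt; lra|]. simpl. rewrite Rmult_1_r, <- Rmult_assoc.
apply Rmult_le_compat; try lra; [nra|]. apply Rmult_le_compat; lra.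
Qed.

Definition lambert_term (k : nat) (q : C) : C :=
  INR (2 * k + 1) * (q ^ (2 * k + 1) / (1 + q ^ (2 * k + 1))).

Lemma ex_series_odd_cube_pow (r : R) : (0 <= r < 1)%R ->
  ex_series (fun k => (INR (2 * k + 1) ^ 3 * r ^ (2 * k + 1))%R).
Proof.
intros Hr.
assert (E := ex_series_cube_pow r Hr).
assert (E2 : ex_series (fun k => (27 * (r * (INR k ^ 3 * r ^ k) + r * r ^ k))%R)).
{ apply (ex_series_scal_l 27%R (fun k => r * (INR k ^ 3 * r ^ k) + r * r ^ k)%R).
  apply (ex_series_plus (K := R_AbsRing) (V := R_NormedModule) (fun k => r * (INR k ^ 3 * r ^ k))%R (fun k => r * r ^ k)%R).
  - apply (ex_series_scal_l r (fun k => INR k ^ 3 * r ^ k)%R); auto.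
  - apply (ex_series_scal_l r (fun k => r ^ k)%R). apply ex_series_geom. rewrite Rabs_pos_eq; lra. }
apply ex_series_pos_le with (2 := E2). intros k.
assert (Hk := pos_INR k). assert (Hp := pow_le r k (proj1 Hr)). assert (Hp2 := pow_le r (2 * k + 1) (proj1 Hr)). split.
- apply Rmult_le_pos; auto. apply pow_le, pos_INR.
- rewrite plus_INR, mult_INR. simpl (INR 2). simpl (INR 1).
  replace (27 * (r * (INR k ^ 3 * r ^ k) + r * r ^ k))%R with ((27 * (INR k ^ 3 + 1)) * (r * r ^ k))%R by ring.
  apply Rmult_le_compat; auto.
  + apply pow_le; lra.
  + destruct (Rle_lt_dec (INR k) 1); [|].
    * assert ((1 + 1) * INR k + 1 <= 3)%R by lra. assert (0 <= INR k ^ 3)%R by now apply pow_le.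
      assert (((1 + 1) * INR k + 1) ^ 3 <= 3 ^ 3)%R by (apply pow_incr; lra). lra.
    * assert (((1 + 1) * INR k + 1) ^ 3 <= (3 * INR k) ^ 3)%R by (apply pow_incr; lra).
      rewrite Rpow_mult_distr in *. lra.
  + replace (2 * k + 1)%nat with (k + S k)%nat by lia. rewrite pow_add. simpl (r ^ S k)%R.
    assert (r ^ k <= 1)%R by (apply pow_le_1; lra).
    assert (0 <= r * r ^ k)%R by (apply Rmult_le_pos; lra). nra.
Qed.

Lemma pow_odd_le (q : C) (r : R) (k : nat) : (Cmod q <= r)%R -> (0 <= r < 1)%R ->
  (Cmod (q ^ (2 * k + 1)) <= r)%R.
Proof.
intros Hq Hr. rewrite Cmod_pow. assert (H0 := Cmod_ge_0 q).
replace (2 * k + 1)%nat with (S (2 * k)) by lia. simpl.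
assert (A : (Cmod q ^ (k + (k + 0)) <= 1)%R).
{ apply pow_le_1; lra. }
assert (B := pow_le (Cmod q) (k + (k + 0)) H0). nra.
Qed.

Lemma ex_series_lambert (q : C) : (Cmod q < 1)%R -> ex_series (fun k => Cmod (lambert_term k q)).
Proof.
intros Hq. set (r := Cmod q). assert (Hr : (0 <= r < 1)%R) by (split; [apply Cmod_ge_0|auto]).
apply ex_series_pos_le with (b := fun k => (/ (1 - r) * (INR (2 * k + 1) ^ 3 * r ^ (2 * k + 1)))%R).
- intros k. split; [apply Cmod_ge_0|]. unfold lambert_term.
  destruct (Cmod_one_plus (q ^ (2 * k + 1)) r (pow_odd_le q r k (Rle_refl _) Hr) ltac:(lra)) as [B1 N1].
  rewrite Cmod_mult, Cmod_R, Cmod_div, Cmod_pow by auto. fold r.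
  rewrite Rabs_pos_eq by apply pos_INR.
  assert (H1 : (1 <= INR (2 * k + 1))%R) by (rewrite plus_INR; assert (A := pos_INR (2 * k)); simpl (INR 1); lra).
  assert (Hp := pow_le r (2 * k + 1) (proj1 Hr)).
  set (m := INR (2 * k + 1)) in *. set (p := (r ^ (2 * k + 1))%R) in *.
  replace (/ (1 - r) * (m ^ 3 * p))%R with (m ^ 3 * (p * / (1 - r)))%R by ring.
  apply Rmult_le_compat; try lra.
  + apply Rmult_le_pos; auto. left; apply Rinv_0_lt_compat; lra.
  + nra.
  + apply Rmult_le_compat_l; auto. apply Rinv_le_contravar; lra.
- apply (ex_series_scal_l (/ (1 - r))%R (fun k => INR (2 * k + 1) ^ 3 * r ^ (2 * k + 1))%R).
  now apply ex_series_odd_cube_pow.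
Qed.

Lemma cdiff_lambert (u : C) : (Cmod u < 1)%R ->
  exists l, cdiff (fun q => CSeries (fun k => lambert_term k q)) u l.
Proof.
intros Hu. assert (H0 := Cmod_ge_0 u).
set (r := ((1 + Cmod u) / 2)%R).
assert (Hr : (0 <= r < 1)%R) by (unfold r; lra). assert (Hr0 : (0 < r)%R) by (unfold r; lra).
assert (Hr2 : (0 < r ^ 2)%R) by (apply pow_lt; lra). assert (Hr3 : (0 < (1 - r) ^ 3)%R) by (apply pow_lt; lra).
assert (Hr4 : (0 < (1 - r) ^ 2)%R) by (apply pow_lt; lra).
set (m := fun k => INR (2 * k + 1)).
assert (Hm : forall k, (1 <= m k)%R).
{ intros k. unfold m. rewrite plus_INR; assert (A := pos_INR (2 * k)); simpl (INR 1); lra. }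
assert (HE := ex_series_odd_cube_pow r Hr).
eexists. apply (cdiff_CSeries lambert_term
  (fun k => m k * ((m k * u ^ (2 * k)) / ((1 + u ^ (2 * k + 1)) * (1 + u ^ (2 * k + 1)))))
  (fun k => ((/ (r ^ 2 * (1 - r) ^ 2) + / (r ^ 2 * (1 - r) ^ 3)) * (m k ^ 3 * r ^ (2 * k + 1)))%R) u (r - Cmod u)).
- unfold r; lra.
- intros v Hv. apply ex_series_lambert.
  assert (T := Cmod_triangle (v - u) u). replace (v - u + u) with v in T by ring. lra.
- apply ex_series_pos_le with (b := fun k => (/ (r * (1 - r) ^ 2) * (m k ^ 3 * r ^ (2 * k + 1)))%R).
  + intros k. split; [apply Cmod_ge_0|].
    destruct (Cmod_one_plus (u ^ (2 * k + 1)) r) as [B1 N1]; [apply pow_odd_le; auto; unfold r; lra|lra|].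
    rewrite Cmod_mult, Cmod_div by (apply Cmult_neq_0; auto). rewrite !Cmod_mult, Cmod_R, Cmod_pow.
    rewrite Rabs_pos_eq by (specialize (Hm k); lra). specialize (Hm k).
    replace (r ^ (2 * k + 1))%R with (r * r ^ (2 * k))%R by (rewrite Nat.add_1_r; reflexivity).
    replace (/ (r * (1 - r) ^ 2) * (m k ^ 3 * (r * r ^ (2 * k))))%R with (m k ^ 2 * (m k * r ^ (2 * k) * / (1 - r) ^ 2))%R by (simpl; field; lra).
    assert (P : (Cmod u ^ (2 * k) <= r ^ (2 * k))%R) by (apply pow_incr; unfold r; lra).
    assert (P0 := pow_le (Cmod u) (2 * k) H0).
    assert (I0 : (0 < / (Cmod (1 + u ^ (2 * k + 1)) * Cmod (1 + u ^ (2 * k + 1))))%R) by (apply Rinv_0_lt_compat; nra).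
    assert (Hmm : (m k <= m k ^ 2)%R) by (simpl; rewrite Rmult_1_r; rewrite <- (Rmult_1_r (m k)) at 1; apply Rmult_le_compat_l; lra).
    apply Rmult_le_compat; [lra| |exact Hmm|].
    * apply Rmult_le_pos; [apply Rmult_le_pos; lra|lra].
    * apply Rmult_le_compat; [apply Rmult_le_pos; lra|lra|apply Rmult_le_compat_l; lra|].
      apply Rinv_le_contravar; [lra|]. replace ((1 - r) ^ 2)%R with ((1 - r) * (1 - r))%R by ring. apply Rmult_le_compat; lra.
  + apply (ex_series_scal_l (/ (r * (1 - r) ^ 2))%R (fun k => m k ^ 3 * r ^ (2 * k + 1))%R). exact HE.
- apply (ex_series_scal_l _ (fun k => m k ^ 3 * r ^ (2 * k + 1))%R). exact HE.
- intros k v Hv. assert (T := Cmod_triangle (v - u) u). replace (v - u + u) with v in T by ring.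
  set (n := (2 * k + 1)%nat).
  assert (B := pow_taylor_bound u v r n Hr0 ltac:(unfold r; lra) ltac:(lra)).
  assert (B' := pow_diff_bound u v r n Hr0 ltac:(unfold r; lra) ltac:(lra)).
  replace (pred n) with (2 * k)%nat in B by (unfold n; lia).
  assert (Bu : (Cmod (u ^ n) <= r)%R) by (apply pow_odd_le; auto; unfold r; lra).
  assert (Bv : (Cmod (v ^ n) <= r)%R) by (apply pow_odd_le; auto; lra).
  assert (L := lambert_taylor_bound (u ^ n) (v ^ n) r Bu Bv Hr).
  destruct (Cmod_one_plus (u ^ n) r Bu ltac:(lra)) as [B1 N1].
  destruct (Cmod_one_plus (v ^ n) r Bv ltac:(lra)) as [B2 N2].
  unfold lambert_term. change (INR (2 * k + 1)) with (m k). fold n. change (INR n) with (m k) in B, B'.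
  specialize (Hm k).
  (* The remainder of the composite splits into that of t / (1 + t) at t = u^n and that of the power
     u^n itself. *)
  replace (m k * (v ^ n / (1 + v ^ n)) - m k * (u ^ n / (1 + u ^ n)) -
    m k * (m k * u ^ (2 * k) / ((1 + u ^ n) * (1 + u ^ n))) * (v - u)) with
   (m k * ((v ^ n / (1 + v ^ n) - u ^ n / (1 + u ^ n) - (v ^ n - u ^ n) / ((1 + u ^ n) * (1 + u ^ n))) +
     (v ^ n - u ^ n - m k * u ^ (2 * k) * (v - u)) / ((1 + u ^ n) * (1 + u ^ n)))) by (field; auto).
  rewrite Cmod_mult, Cmod_R, Rabs_pos_eq by lra.
  set (D := Cmod (v - u)) in *. assert (HD : (0 <= D)%R) by apply Cmod_ge_0.
  set (Y := Cmod (v ^ n - u ^ n)) in *. assert (HY : (0 <= Y)%R) by apply Cmod_ge_0.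
  set (X := Cmod (v ^ n - u ^ n - m k * u ^ (2 * k) * (v - u))) in *. assert (HX : (0 <= X)%R) by apply Cmod_ge_0.
  assert (Hrn : (0 <= r ^ n <= 1)%R).
  { apply pow_le_1; lra. }
  assert (HD2 : (0 <= D ^ 2)%R) by apply pow2_ge_0.
  assert (C1 : (Y ^ 2 / (1 - r) ^ 3 <= m k ^ 2 * r ^ n * D ^ 2 * / (r ^ 2 * (1 - r) ^ 3))%R).
  { apply Rmult_le_reg_r with (r ^ 2 * (1 - r) ^ 3)%R; [now apply Rmult_lt_0_compat|].
    replace (Y ^ 2 / (1 - r) ^ 3 * (r ^ 2 * (1 - r) ^ 3))%R with ((r * Y) ^ 2)%R by (field; lra).
    rewrite Rmult_assoc, Rinv_l, Rmult_1_r by (apply Rgt_not_eq, Rmult_lt_0_compat; auto).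
    apply Rle_trans with ((m k * r ^ n * D) ^ 2)%R; [apply pow_incr; split; auto; apply Rmult_le_pos; lra|].
    replace ((m k * r ^ n * D) ^ 2)%R with (m k ^ 2 * D ^ 2 * (r ^ n * r ^ n))%R by ring.
    replace (m k ^ 2 * r ^ n * D ^ 2)%R with (m k ^ 2 * D ^ 2 * (r ^ n))%R by ring.
    apply Rmult_le_compat_l; [apply Rmult_le_pos; auto; apply pow2_ge_0|]. nra. }
  assert (C2 : (X / (Cmod (1 + u ^ n) * Cmod (1 + u ^ n)) <= m k ^ 2 * r ^ n * D ^ 2 * / (r ^ 2 * (1 - r) ^ 2))%R).
  { apply Rle_trans with (X / (1 - r) ^ 2)%R.
    - apply Rmult_le_compat_l; auto. apply Rinv_le_contravar; auto. simpl; rewrite Rmult_1_r; apply Rmult_le_compat; lra.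
    - apply Rmult_le_reg_r with (r ^ 2 * (1 - r) ^ 2)%R; [now apply Rmult_lt_0_compat|].
      replace (X / (1 - r) ^ 2 * (r ^ 2 * (1 - r) ^ 2))%R with (r ^ 2 * X)%R by (field; lra).
      rewrite Rmult_assoc, Rinv_l, Rmult_1_r by (apply Rgt_not_eq, Rmult_lt_0_compat; auto). exact B. }
  apply Rle_trans with (m k * (m k ^ 2 * r ^ n * D ^ 2 * / (r ^ 2 * (1 - r) ^ 3) + m k ^ 2 * r ^ n * D ^ 2 * / (r ^ 2 * (1 - r) ^ 2)))%R.
  + apply Rmult_le_compat_l; [lra|]. eapply Rle_trans; [apply Cmod_triangle|]. apply Rplus_le_compat.
    * eapply Rle_trans; [exact L|exact C1].
    * rewrite Cmod_div by (apply Cmult_neq_0; auto). rewrite Cmod_mult. exact C2.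
  + right. field. lra.
Qed.

(** * The hypergeometric series and Landen's transformation *)

Local Open Scope R_scope.

Lemma Series_nonneg (a : nat -> R) : (forall k, 0 <= a k) -> ex_series a -> 0 <= Series a.
Proof.
intros Ha Hex. rewrite <- (Rmult_0_l (Series (fun _ => 0))), <- Series_scal_l.
apply Series_le; auto. intros n. rewrite Rmult_0_l. split; [lra|auto].
Qed.

Lemma Series_ge_first (a : nat -> R) : (forall k, 0 <= a k) -> ex_series a -> a O <= Series a.
Proof.
intros Ha Hex. rewrite Series_incr_1 by auto.
assert (0 <= Series (fun k => a (S k))); [|lra]. apply Series_nonneg; auto. now apply (ex_series_incr_1 a).
Qed.

Lemma exp_opp_lt_1 y : 0 < y -> 0 < exp (- y) < 1.
Proof. intros Hy. split; [apply exp_pos|]. rewrite <- exp_0. apply exp_increasing. lra. Qed.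

(** This is (1/2)_n / n!, the central binomial coefficient divided by 4^n; its square is the n-th
    coefficient of F. *)
Fixpoint beta (n : nat) : R :=
  match n with O => 1 | S m => beta m * ((INR m + / 2) / (INR m + 1)) end.

Definition acoef (n : nat) : R := beta n ^ 2.

Lemma beta_S n : (INR n + 1) * beta (S n) = (INR n + / 2) * beta n.
Proof. simpl. assert (H := pos_INR n). field. lra. Qed.

Lemma beta_bounds n : 0 < beta n <= 1.
Proof.
induction n as [|n IH]; [simpl; lra|]. assert (E := beta_S n). assert (H := pos_INR n). split; nra.
Qed.

Lemma beta_decr n : beta (S n) <= beta n.
Proof. assert (E := beta_S n). assert (H := pos_INR n). assert (B := beta_bounds n). nra. Qed.

Lemma acoef_bounds n : 0 < acoef n <= 1.
Proof. unfold acoef. assert (B := beta_bounds n). split; nra. Qed.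

Lemma acoef_S n : (INR n + 1) ^ 2 * acoef (S n) = (INR n + / 2) ^ 2 * acoef n.
Proof. unfold acoef. rewrite <- !Rpow_mult_distr, beta_S. reflexivity. Qed.

Lemma acoef_decr n : acoef (S n) <= acoef n.
Proof. apply pow_incr. split; [left; apply beta_bounds|apply beta_decr]. Qed.

Lemma Rabs_acoef n : Rabs (acoef n) <= 1.
Proof. assert (B := acoef_bounds n). rewrite Rabs_pos_eq; lra. Qed.

Definition hypF (x : R) : R := PSeries acoef x.
Definition hypF' (x : R) : R := PSeries (PS_derive acoef) x.
Definition hypD (x : R) : R := x * (1 - x) * hypF' x.

Lemma acoef_radius x : Rabs x < 1 -> Rbar_lt (Rabs x) (CV_radius acoef).
Proof. apply CV_radius_inside_1 with (1 := Rabs_acoef). Qed.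

Lemma is_derive_hypF x : Rabs x < 1 -> is_derive hypF x (hypF' x).
Proof. intros Hx. apply is_derive_PSeries. now apply acoef_radius. Qed.

(* The hypergeometric equation in self-adjoint form (x (1 - x) F')' = F / 4. *)
Lemma is_derive_hypD x : Rabs x < 1 -> is_derive hypD x (hypF x / 4).
Proof.
intros Hx.
set (c := fun n => acoef n / (4 * (INR n + 1))).
assert (Hc : forall n, Rabs (c n) <= 1).
{ intros n. unfold c. assert (B := acoef_bounds n). assert (H := pos_INR n).
  rewrite Rabs_pos_eq.
  - apply Rmult_le_reg_r with (4 * (INR n + 1)); [lra|]. unfold Rdiv. rewrite Rmult_assoc, Rinv_l; lra.
  - apply Rmult_le_pos; [lra|]. left; apply Rinv_0_lt_compat; lra. }
(* The coefficient (n+1) a_(n+1) - n a_n of (1 - t) F' equals ((n + 1/2)^2 / (n + 1) - n) a_n = a_n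
   / (4 (n + 1)). *)
assert (HD : forall t, Rabs t < 1 -> hypD t = t * PSeries c t).
{ intros t Ht. unfold hypD, hypF'. rewrite Rmult_assoc. f_equal.
  assert (E : ex_pseries (PS_derive acoef) t) by now apply ex_pseries_derive, acoef_radius.
  rewrite Rmult_minus_distr_r, Rmult_1_l, <- PSeries_incr_1, <- PSeries_minus by (auto using ex_pseries_incr_1).
  apply PSeries_ext. intros n. unfold PS_minus, PS_opp, PS_plus, PS_incr_1, PS_derive, c.
  destruct n as [|n].
  - change (INR 1 * acoef 1 + - 0 = acoef 0 / (4 * (INR 0 + 1))). unfold acoef; simpl. field.
  - change (INR (S (S n)) * acoef (S (S n)) + - (INR (S n) * acoef (S n)) = acoef (S n) / (4 * (INR (S n) + 1))).
    assert (B := acoef_S (S n)). assert (H := pos_INR (S n)). rewrite (S_INR (S n)).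
    assert (E2 : (INR (S n) + 1) * acoef (S (S n)) = (INR (S n) + / 2) ^ 2 * acoef (S n) / (INR (S n) + 1)).
    { rewrite <- B. field. lra. }
    rewrite E2. field. lra. }
apply is_derive_ext_loc with (f := fun t => PSeries (PS_incr_1 c) t).
{ assert (Hp : 0 < 1 - Rabs x) by lra. exists (mkposreal _ Hp). intros t Ht.
  rewrite PSeries_incr_1. symmetry; apply HD.
  change (Rabs (t - x) < 1 - Rabs x) in Ht. assert (T := Rabs_triang_inv t x). lra. }
assert (Hr : Rbar_lt (Rabs x) (CV_radius (PS_incr_1 c))).
{ apply CV_radius_inside_1 with (M := 1); auto. intros [|n]; simpl; [unfold zero; simpl; rewrite Rabs_R0; lra|apply Hc]. }
replace (hypF x / 4) with (PSeries (PS_derive (PS_incr_1 c)) x).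
- now apply is_derive_PSeries.
- unfold hypF, Rdiv. rewrite Rmult_comm, <- PSeries_scal. apply PSeries_ext. intros n.
  unfold PS_derive, PS_incr_1, PS_scal, c.
  change (INR (S n) * (acoef n / (4 * (INR n + 1))) = / 4 * acoef n).
  rewrite S_INR. assert (H := pos_INR n). field. lra.
Qed.

Lemma hypF_ge_1 x : 0 <= x < 1 -> 1 <= hypF x.
Proof.
intros Hx. unfold hypF, PSeries.
assert (E : ex_series (fun n => acoef n * x ^ n)).
{ apply (ex_pseries_R acoef x). apply CV_radius_inside, acoef_radius. rewrite Rabs_pos_eq; lra. }
replace 1 with (acoef 0 * x ^ 0) by (unfold acoef; simpl; ring).
apply (Series_ge_first (fun n => acoef n * x ^ n)); auto.
intros k. apply Rmult_le_pos; [left; apply acoef_bounds|apply pow_le; lra].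
Qed.

Lemma hypF_0 : hypF 0 = 1.
Proof. unfold hypF. rewrite PSeries_0. unfold acoef; simpl; ring. Qed.

Lemma derive_zero_const (f : R -> R) (a b : R) : a < b ->
  (forall t, a <= t <= b -> is_derive f t 0) -> f a = f b.
Proof. intros Hab H. apply (eq_is_derive (V := R_NormedModule) f a b); auto. Qed.

Lemma continuous_is_derive (f : R -> R) (x l : R) : is_derive f x l -> continuous f x.
Proof. intros H. apply (@ex_derive_continuous R_AbsRing R_NormedModule). now exists l. Qed.

(** Serves at the singular point 0: the derivative is computed on the open interval and the constant
    is read off at the end by continuity. *)
Lemma derive_zero_const_right (f : R -> R) (a b : R) : a < b -> continuous f a ->
  (forall t, a < t < b -> is_derive f t 0) -> forall t, a <= t < b -> f t = f a.
Proof.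
intros Hab Hc H t Ht. destruct (Req_dec t a) as [->|Hn]; auto.
apply NNPP; intros Hne.
assert (He : 0 < Rabs (f t - f a)) by (apply Rabs_pos_lt; lra).
destruct (proj1 (filterlim_locally _ _) Hc (mkposreal _ He)) as [d Hd].
set (s := Rmin (a + d / 2) ((a + t) / 2)).
assert (Hd0 := cond_pos d). assert (S1 : s <= a + d / 2) by apply Rmin_l. assert (S2 : s <= (a + t) / 2) by apply Rmin_r.
assert (S3 : a < s) by (apply Rmin_glb_lt; lra).
assert (E : f s = f t) by (apply derive_zero_const; [lra|intros u Hu; apply H; lra]).
specialize (Hd s). assert (B : ball a d s).
{ change (Rabs (s - a) < d). rewrite Rabs_pos_eq; lra. }
specialize (Hd B). change (Rabs (f s - f a) < Rabs (f t - f a)) in Hd. rewrite E in Hd. lra.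
Qed.

Definition landen (l : R) : R := 4 * l / (1 + l) ^ 2.

Lemma landen_1m l : -1 < l -> 1 - landen l = ((1 - l) / (1 + l)) ^ 2.
Proof. intros H. unfold landen. field. lra. Qed.

Lemma landen_range l : 0 < l < 1 -> 0 < landen l < 1.
Proof.
intros H. split.
- apply Rdiv_lt_0_compat; [lra|]. apply pow_lt; lra.
- assert (E := landen_1m l ltac:(lra)). assert (0 < ((1 - l) / (1 + l)) ^ 2); [|lra].
  apply pow_lt. apply Rdiv_lt_0_compat; lra.
Qed.

Lemma is_derive_landen l : -1 < l -> is_derive landen l (4 * (1 - l) / (1 + l) ^ 3).
Proof.
intros H. unfold landen. auto_derive; [|field; lra]. apply Rgt_not_eq, Rmult_lt_0_compat; nra.
Qed.

(* Both sides solve the same self-adjoint second-order equation, regular at [l = 0], so their Wronskian vanishes. *)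
Lemma hypF_landen l : 0 <= l < 1 -> hypF (landen l) = (1 + l) * hypF (l ^ 2).
Proof.
intros Hl.
(* The range extends to the left of 0 so that two-sided derivatives exist at 0, the point where both
   solutions are matched. *)
assert (Rx : forall t, - / 10 < t < 1 -> Rabs (landen t) < 1).
{ intros t Ht. destruct (Rle_lt_dec t 0) as [L|L].
  - unfold landen. apply Rabs_def1.
    + apply Rle_lt_trans with 0; [|lra]. unfold Rdiv. assert (0 < / (1 + t) ^ 2) by (apply Rinv_0_lt_compat, pow_lt; lra). nra.
    + apply Rmult_lt_reg_r with ((1 + t) ^ 2); [apply pow_lt; lra|]. unfold Rdiv. rewrite Rmult_assoc, Rinv_l by (apply Rgt_not_eq, pow_lt; lra). nra.
  - destruct (landen_range t); [lra|]. rewrite Rabs_pos_eq; lra. }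
assert (R2 : forall t, - / 10 < t < 1 -> Rabs (t ^ 2) < 1).
{ intros t Ht. rewrite Rabs_pos_eq by apply pow2_ge_0. nra. }
assert (dsq : forall t, is_derive (fun t => t ^ 2) t (2 * t)) by (intros t; auto_derive; auto; ring).
set (A := fun t => hypF (landen t)). set (B := fun t => hypD (landen t)).
set (C := fun t => hypF (t ^ 2)). set (D := fun t => hypD (t ^ 2)).
assert (dA : forall t, - / 10 < t < 1 -> is_derive A t ((4 * (1 - t) / (1 + t) ^ 3) * hypF' (landen t))).
{ intros t Ht. apply (is_derive_comp hypF landen); [apply is_derive_hypF; auto|apply is_derive_landen; lra]. }
assert (dB : forall t, - / 10 < t < 1 -> is_derive B t ((4 * (1 - t) / (1 + t) ^ 3) * (hypF (landen t) / 4))).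
{ intros t Ht. apply (is_derive_comp hypD landen); [apply is_derive_hypD; auto|apply is_derive_landen; lra]. }
assert (dC : forall t, - / 10 < t < 1 -> is_derive C t ((2 * t) * hypF' (t ^ 2))).
{ intros t Ht. apply (is_derive_comp hypF (fun t => t ^ 2)); [apply is_derive_hypF; auto|apply dsq]. }
assert (dD : forall t, - / 10 < t < 1 -> is_derive D t ((2 * t) * (hypF (t ^ 2) / 4))).
{ intros t Ht. apply (is_derive_comp hypD (fun t => t ^ 2)); [apply is_derive_hypD; auto|apply dsq]. }
(* With G(t) = (1 + t) F(t^2) this is t (1 - t) / (1 + t) times G A' - A G': the chain rule gives B
   = t (1 - t) / (1 + t) A', and the last bracket over 1 + t is the same multiple of G'. *)
set (W := fun t => (1 + t) * C t * B t - A t * (t * (1 - t) * C t + 2 * D t) / (1 + t)).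
assert (dW : forall t, - / 10 < t < 1 -> is_derive W t 0).
{ intros t Ht. specialize (dA t Ht). specialize (dB t Ht). specialize (dC t Ht). specialize (dD t Ht).
  assert (eA : ex_derive A t) by (eexists; eauto). assert (eB : ex_derive B t) by (eexists; eauto).
  assert (eC : ex_derive C t) by (eexists; eauto). assert (eD : ex_derive D t) by (eexists; eauto).
  apply is_derive_unique in dA. apply is_derive_unique in dB. apply is_derive_unique in dC. apply is_derive_unique in dD.
  unfold W. auto_derive; [repeat split; auto; lra|].
  change (Derive (fun x => A x) t) with (Derive A t). change (Derive (fun x => B x) t) with (Derive B t).
  change (Derive (fun x => C x) t) with (Derive C t). change (Derive (fun x => D x) t) with (Derive D t).
  rewrite dA, dB, dC, dD. unfold A, B, C, D, hypD. 
  set (f0 := hypF (landen t)). set (f1 := hypF' (landen t)). set (k0 := hypF (t ^ 2)). set (k1 := hypF' (t ^ 2)).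
  clearbody f0 f1 k0 k1. unfold landen. field. lra. }
assert (W0 : W 0 = 0).
{ unfold W, B, D, hypD, landen. field. }
assert (WZ : forall t, 0 < t < 1 -> W t = 0).
{ intros t Ht. rewrite <- W0. symmetry. apply derive_zero_const; [lra|]. intros u Hu. apply dW. lra. }
set (Qt := fun t => A t / ((1 + t) * C t)).
assert (C1 : forall t, -/10 < t < 1 -> 0 <= t -> 1 <= C t).
{ intros t Ht H0. apply hypF_ge_1. assert (Z := R2 t Ht). rewrite Rabs_pos_eq in Z by apply pow2_ge_0. split; auto. apply pow2_ge_0. }
assert (dQ : forall t, - / 10 < t < 1 -> 0 <= t -> ex_derive Qt t).
{ intros t Ht H0. specialize (C1 t Ht H0). unfold Qt. auto_derive. repeat split; try (eexists; eauto; fail). nra. }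
assert (Q1 : Qt l = Qt 0).
{ apply (derive_zero_const_right Qt 0 1); [lra| | |lra].
  - apply (@ex_derive_continuous R_AbsRing R_NormedModule). apply dQ; lra.
  - intros t Ht. assert (Ht' : - / 10 < t < 1) by lra. specialize (C1 t Ht' ltac:(lra)).
    specialize (dA t Ht'). specialize (dC t Ht'). specialize (WZ t Ht).
    assert (eA : ex_derive A t) by (eexists; eauto). assert (eC : ex_derive C t) by (eexists; eauto).
    apply is_derive_unique in dA. apply is_derive_unique in dC.
    unfold Qt. auto_derive; [repeat split; auto; nra|].
    change (Derive (fun x => A x) t) with (Derive A t). change (Derive (fun x => C x) t) with (Derive C t).
    rewrite dA, dC. unfold W, B, D, hypD in WZ. fold (A t) in *. unfold A, C in *.
    set (f0 := hypF (landen t)) in *. set (f1 := hypF' (landen t)) in *. set (k0 := hypF (t ^ 2)) in *. set (k1 := hypF' (t ^ 2)) in *.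
    clearbody f0 f1 k0 k1.
    (* This multiplier turns the derivative of the quotient [Qt] into [W t], which is 0. *)
    apply Rmult_eq_reg_l with (t * (1 - t) / (1 + t) * ((1 + t) * k0) ^ 2).
    2:{ apply Rgt_not_eq. apply Rmult_lt_0_compat; [apply Rdiv_lt_0_compat; nra|]. apply pow_lt. nra. }
    rewrite Rmult_0_r, <- WZ. unfold landen. field. nra. }
unfold Qt in Q1. replace (A 0) with 1 in Q1. 2:{ unfold A, landen. replace (4 * 0 / (1 + 0) ^ 2) with 0 by field. now rewrite hypF_0. }
replace (C 0) with 1 in Q1. 2:{ unfold C. replace (0 ^ 2) with 0 by ring. now rewrite hypF_0. }
specialize (C1 l ltac:(lra) ltac:(lra)).
change (A l = (1 + l) * C l). apply Rmult_eq_reg_r with (/ ((1 + l) * C l)).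
- rewrite Rinv_r by nra. change (A l / ((1 + l) * C l) = 1). rewrite Q1. field.
- apply Rinv_neq_0_compat. nra.
Qed.

(** * The nome *)

Definition ucoef : nat -> R := PS_mult acoef acoef.

(* The weights [beta k * beta (n - k)] form a Polya-urn distribution: the one at time n+1 is a sub-convex
   combination of shifts of the one at time n, so its l^2 norm cannot increase. *)
Lemma ucoef_decr n : ucoef (S n) <= ucoef n.
Proof.
set (P := fun n k => beta k * beta (n - k)).
assert (EU : forall n, ucoef n = sum_f_R0 (fun k => P n k ^ 2) n).
{ intros m. unfold ucoef, PS_mult. apply sum_eq. intros i _. unfold P, acoef. ring. }
rewrite !EU.
set (f := fun k => (INR n + 1) * P (S n) k ^ 2).
set (g := fun k => (INR k + / 2) * P n k ^ 2).
set (h := fun k => (INR n - INR k + / 2) * P n k ^ 2).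
assert (Hn := pos_INR n).
assert (L : forall k, (k <= n)%nat -> INR (n - k) = INR n - INR k) by (intros; now apply minus_INR).
assert (R1 : forall k, (k <= n)%nat -> (INR n - INR k + 1) * P (S n) k = (INR n - INR k + / 2) * P n k).
{ intros k Hk. unfold P. replace (S n - k)%nat with (S (n - k)) by lia.
  assert (E := beta_S (n - k)). rewrite L in E by auto.
  transitivity (beta k * ((INR n - INR k + 1) * beta (S (n - k)))); [ring|]. rewrite E. ring. }
assert (R2 : forall k, (k <= n)%nat -> (INR k + 1) * P (S n) (S k) = (INR k + / 2) * P n k).
{ intros k Hk. unfold P. replace (S n - S k)%nat with (n - k)%nat by lia.
  assert (E := beta_S k).
  transitivity (((INR k + 1) * beta (S k)) * beta (n - k)); [ring|]. rewrite E. ring. }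
assert (F0 : f O <= h O).
{ unfold f, h. specialize (R1 O ltac:(lia)). simpl (INR 0) in *. 
  set (X := P (S n) O) in *. set (Y := P n O) in *. 
  apply Rmult_le_reg_l with (INR n + 1); [lra|].
  replace ((INR n + 1) * ((INR n + 1) * X ^ 2)) with (((INR n - 0 + 1) * X) ^ 2) by ring. rewrite R1.
  assert (0 <= Y ^ 2) by apply pow2_ge_0. replace ((INR n - 0 + / 2) * Y) with ((INR n + / 2) * Y) by ring. 
  rewrite Rpow_mult_distr. rewrite Rminus_0_r. rewrite <- Rmult_assoc. apply Rmult_le_compat_r; nra. }
assert (F1 : forall k, (S k <= n)%nat -> f (S k) <= g k + h (S k)).
{ intros k Hk. unfold f, g, h. assert (Q1 := R1 (S k) Hk). assert (Q2 := R2 k ltac:(lia)).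
  assert (HK := le_INR _ _ Hk). rewrite S_INR in *. assert (Hk0 := pos_INR k).
  set (X := P (S n) (S k)) in *. set (A := P n k) in *. set (B := P n (S k)) in *.
  set (s := INR k + / 2) in *. set (t := INR n - (INR k + 1) + / 2) in *.
  (* Sum of the two urn recurrences, [R2] at k and [R1] at k + 1. The weights have s + t = n, so
     Cauchy-Schwarz loses at most the factor n <= n + 1. *)
  assert (EX : (INR n + 1) * X = s * A + t * B) by (unfold s, t in *; lra).
  apply Rmult_le_reg_l with (INR n + 1); [lra|].
  replace ((INR n + 1) * ((INR n + 1) * X ^ 2)) with (((INR n + 1) * X) ^ 2) by ring. rewrite EX.
  assert (Hs : 0 <= s) by (unfold s; lra). assert (Ht : 0 <= t) by (unfold t; lra).
  assert (Est : s + t = INR n) by (unfold s, t; lra).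
  apply Rle_trans with ((s + t) * (s * A ^ 2 + t * B ^ 2)).
  - assert (0 <= s * t * (A - B) ^ 2) by (apply Rmult_le_pos; [now apply Rmult_le_pos|apply pow2_ge_0]). nra.
  - apply Rmult_le_compat_r; [|lra]. apply Rplus_le_le_0_compat; apply Rmult_le_pos; auto; apply pow2_ge_0. }
assert (F2 : f (S n) <= g n).
{ unfold f, g. specialize (R2 n ltac:(lia)).
  set (X := P (S n) (S n)) in *. set (Y := P n n) in *. 
  apply Rmult_le_reg_l with (INR n + 1); [lra|].
  replace ((INR n + 1) * ((INR n + 1) * X ^ 2)) with (((INR n + 1) * X) ^ 2) by ring. rewrite R2.
  assert (0 <= Y ^ 2) by apply pow2_ge_0. 
  rewrite Rpow_mult_distr. rewrite <- Rmult_assoc. apply Rmult_le_compat_r; nra. }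
(* Entries 0..m of [f] use [h] up to m but [g] only up to m - 1, hence [g m] on the left; [F2] then
   spends it on the last entry of [f]. *)
assert (S1 : forall m, (m <= n)%nat -> sum_f_R0 f m + g m <= sum_f_R0 h m + sum_f_R0 g m).
{ intros m. induction m as [|m IH]; intros Hm; [simpl; lra|].
  specialize (IH ltac:(lia)). specialize (F1 m Hm). rewrite !tech5. lra. }
specialize (S1 n (le_n n)).
assert (S2 : sum_f_R0 h n + sum_f_R0 g n = (INR n + 1) * sum_f_R0 (fun k => P n k ^ 2) n).
{ rewrite <- plus_sum, scal_sum. apply sum_eq. intros i _. unfold h, g. field. }
assert (S3 : sum_f_R0 f (S n) = (INR n + 1) * sum_f_R0 (fun k => P (S n) k ^ 2) (S n)).
{ rewrite scal_sum. apply sum_eq. intros i _. unfold f. ring. }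
rewrite tech5 in S3.
apply Rmult_le_reg_l with (INR n + 1); lra.
Qed.

Lemma ucoef_0 : ucoef 0 = 1.
Proof. unfold ucoef, PS_mult, acoef; simpl. ring. Qed.

Lemma ucoef_pos n : 0 < ucoef n.
Proof.
unfold ucoef, PS_mult. assert (A : forall k, 0 < acoef k) by (intros; apply acoef_bounds).
generalize n at 1. intros m. induction n as [|n IH]; simpl; [|apply Rplus_lt_0_compat; auto]; apply Rmult_lt_0_compat; auto.
Qed.

Lemma ucoef_le_1 n : ucoef n <= 1.
Proof. induction n as [|n IH]; [rewrite ucoef_0; lra|]. assert (A := ucoef_decr n). lra. Qed.

Definition dcoef (k : nat) : R := ucoef k - ucoef (S k).

Lemma dcoef_bounds k : 0 <= dcoef k <= 1.
Proof.
unfold dcoef. assert (A := ucoef_decr k). assert (B := ucoef_le_1 k). assert (C := ucoef_pos (S k)). lra.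
Qed.

Lemma sum_dcoef n : sum_f_R0 dcoef n = 1 - ucoef (S n).
Proof.
induction n as [|n IH]; [unfold sum_f_R0, dcoef; rewrite ucoef_0; ring|]. rewrite tech5, IH. unfold dcoef. ring.
Qed.

(** Course-of-values recursion made structural: row n holds the correct entries up to index n, and
    later entries are placeholders. The recursion e_(n+1) = sum of d_k e_(n-k) is E = 1 + x D E. *)
Fixpoint etable (n : nat) : nat -> R :=
  match n with
  | O => fun _ => 1
  | S p => fun m => if le_dec m p then etable p m
                    else sum_f_R0 (fun k => dcoef k * etable p (p - k)) p
  end.

(* Coefficients of 1 / ((1 - x) F(x)^2). *)
Definition ecoef (n : nat) : R := etable n n.

Lemma etable_ecoef n m : (m <= n)%nat -> etable n m = ecoef m.
Proof.
induction n as [|n IH]; intros Hm.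
- now replace m with O by lia.
- destruct (Nat.eq_dec m (S n)) as [->|Hne]; [reflexivity|].
  simpl. destruct (le_dec m n); [now apply IH|lia].
Qed.

Lemma ecoef_S n : ecoef (S n) = PS_mult dcoef ecoef n.
Proof.
unfold ecoef at 1. simpl. destruct (le_dec (S n) n); [lia|].
unfold PS_mult. apply sum_eq. intros i Hi. now rewrite etable_ecoef by lia.
Qed.

(** The sum of the [dcoef] telescopes to less than 1, so each new coefficient is a sub-convex
    combination of the earlier ones. *)
Lemma ecoef_bounds n : 0 <= ecoef n <= 1.
Proof.
induction n as [n IH] using (well_founded_induction lt_wf).
destruct n as [|n]; [unfold ecoef; simpl; lra|].
rewrite ecoef_S. unfold PS_mult. split.
- apply cond_pos_sum. intros k. apply Rmult_le_pos; [apply dcoef_bounds|apply IH; lia].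
- apply Rle_trans with (sum_f_R0 dcoef n).
  + apply sum_Rle. intros k _. rewrite <- (Rmult_1_r (dcoef k)) at 2.
    apply Rmult_le_compat_l; [apply dcoef_bounds|apply IH; lia].
  + rewrite sum_dcoef. assert (A := ucoef_pos (S n)). lra.
Qed.

Definition lcoef (n : nat) : R := match n with O => 0 | S m => ecoef n / INR n end.

Lemma lcoef_bounds n : 0 <= lcoef n <= 1.
Proof.
destruct n as [|n]; [simpl; lra|]. unfold lcoef. assert (B := ecoef_bounds (S n)).
assert (H : 1 <= INR (S n)) by (rewrite S_INR; assert (A := pos_INR n); lra). split.
- apply Rmult_le_pos; [lra|]. left; apply Rinv_0_lt_compat; lra.
- apply Rmult_le_reg_r with (INR (S n)); [lra|]. unfold Rdiv. rewrite Rmult_assoc, Rinv_l; lra.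
Qed.

Lemma Rabs_lcoef n : Rabs (lcoef n) <= 1.
Proof. assert (B := lcoef_bounds n). rewrite Rabs_pos_eq; lra. Qed.

Definition nomeL (x : R) : R := PSeries lcoef x.
Definition nomeL' (x : R) : R := PSeries (PS_derive lcoef) x.

Lemma is_derive_nomeL x : Rabs x < 1 -> is_derive nomeL x (nomeL' x).
Proof. intros Hx. apply is_derive_PSeries. now apply CV_radius_inside_1 with (1 := Rabs_lcoef). Qed.

Lemma nomeL_0 : nomeL 0 = 0.
Proof. unfold nomeL. now rewrite PSeries_0. Qed.

Lemma nomeL'_eq x : Rabs x < 1 -> (1 + x * nomeL' x) * ((1 - x) * hypF x ^ 2) = 1.
Proof.
intros Hx.
assert (Ad : forall n, Rabs (dcoef n) <= 1) by (intros n; assert (B := dcoef_bounds n); rewrite Rabs_pos_eq; lra).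
assert (Ae : forall n, Rabs (ecoef n) <= 1) by (intros n; assert (B := ecoef_bounds n); rewrite Rabs_pos_eq; lra).
assert (Au : forall n, Rabs (ucoef n) <= 1).
{ intros n; assert (B := ucoef_le_1 n); assert (B2 := ucoef_pos n); rewrite Rabs_pos_eq; lra. }
assert (Rd := CV_radius_inside_1 _ _ x Ad Hx). assert (Re := CV_radius_inside_1 _ _ x Ae Hx).
assert (Ru := CV_radius_inside_1 _ _ x Au Hx).
(* The recursion as an identity of functions. Together with (1 - x) F^2 = 1 - x D it makes E the
   inverse of (1 - x) F^2. *)
assert (EE : PSeries ecoef x = 1 + x * (PSeries dcoef x * PSeries ecoef x)).
{ rewrite <- PSeries_mult by auto. rewrite <- PSeries_incr_1.
  rewrite (PSeries_ext ecoef (PS_plus (fun n => match n with O => 1 | _ => 0 end) (PS_incr_1 (PS_mult dcoef ecoef)))).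
  - assert (P0 : PSeries (fun n => match n with O => 1 | _ => 0 end) x = 1).
    { rewrite PSeries_decr_1 by (apply CV_radius_inside, CV_radius_inside_1 with (M := 1); auto;
        intros [|n]; [rewrite Rabs_R1|rewrite Rabs_R0]; lra).
      rewrite (PSeries_ext _ (fun _ => 0)) by (intros n; reflexivity). rewrite PSeries_const_0. ring. }
    rewrite PSeries_plus.
    + apply f_equal2; [exact P0|reflexivity].
    + apply CV_radius_inside, CV_radius_inside_1 with (M := 1); auto.
      intros [|n]; [rewrite Rabs_R1|rewrite Rabs_R0]; lra.
    + apply ex_pseries_incr_1, ex_pseries_mult; auto.
  - intros [|n]; unfold PS_plus, PS_incr_1.
    + change (ecoef 0 = 1 + 0). unfold ecoef; simpl; ring.
    + rewrite ecoef_S. change (PS_mult dcoef ecoef n = 0 + PS_mult dcoef ecoef n). ring. }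
assert (EF : hypF x ^ 2 = PSeries ucoef x).
{ unfold hypF, ucoef. rewrite PSeries_mult by now apply acoef_radius. ring. }
assert (Eu : PSeries ucoef x = 1 + x * PSeries (fun n => ucoef (S n)) x).
{ rewrite (PSeries_decr_1 ucoef) by now apply CV_radius_inside. rewrite ucoef_0. reflexivity. }
assert (Ed : PSeries dcoef x = PSeries ucoef x - PSeries (fun n => ucoef (S n)) x).
{ rewrite <- PSeries_minus.
  - reflexivity.
  - now apply CV_radius_inside.
  - apply CV_radius_inside, CV_radius_inside_1 with (M := 1); auto. }
assert (El : 1 + x * nomeL' x = PSeries ecoef x).
{ rewrite (PSeries_decr_1 ecoef) by now apply CV_radius_inside.
  replace (ecoef 0) with 1 by reflexivity. f_equal. f_equal. unfold nomeL'. apply PSeries_ext. intros n.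
  unfold PS_derive, lcoef, PS_decr_1. assert (INR (S n) <> 0) by (apply not_0_INR; lia). field; auto. }
rewrite El, EF.
set (E := PSeries ecoef x) in *. set (D := PSeries dcoef x) in *. set (U := PSeries ucoef x) in *.
set (U' := PSeries (fun n => ucoef (S n)) x) in *.
replace ((1 - x) * U) with (1 - x * D) by (rewrite Ed; lra).
replace (E * (1 - x * D)) with (E - x * (D * E)) by ring. lra.
Qed.

(* Y = - ln Q, where Q(x) = (x / 16) exp (L x) is the nome. *)
Definition nomeY (x : R) : R := ln 16 - ln x - nomeL x.

Lemma is_derive_nomeY x : 0 < x < 1 -> is_derive nomeY x (- / (x * (1 - x) * hypF x ^ 2)).
Proof.
intros Hx. assert (Ha : Rabs x < 1) by (rewrite Rabs_pos_eq; lra).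
assert (D := is_derive_nomeL x Ha). assert (E := nomeL'_eq x Ha). assert (F1 := hypF_ge_1 x ltac:(lra)).
assert (eL : ex_derive nomeL x) by (eexists; eauto). apply is_derive_unique in D.
unfold nomeY. auto_derive; [repeat split; auto; lra|].
change (Derive (fun x => nomeL x) x) with (Derive nomeL x). rewrite D.
assert (N : (1 - x) * hypF x ^ 2 <> 0) by (apply Rgt_not_eq, Rmult_lt_0_compat; [lra|apply pow_lt; lra]).
apply Rmult_eq_reg_r with (x * ((1 - x) * hypF x ^ 2)); [|apply Rmult_integral_contrapositive_currified; auto; lra].
transitivity (- ((1 + x * nomeL' x) * ((1 - x) * hypF x ^ 2))); [field; lra|]. rewrite E. field. repeat split; lra.
Qed.

(** This fixes the constant 16 in the nome: [landen l] behaves like 4 l at 0, and the constants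
    balance exactly when ln 16 = 2 ln 4. *)
Lemma nomeY_landen l : 0 < l < 1 -> nomeY (l ^ 2) = 2 * nomeY (landen l).
Proof.
intros Hl.
set (A := fun t => nomeL (t ^ 2)). set (B := fun t => nomeL (landen t)).
assert (Ra : forall t, 0 <= t < 1 -> Rabs (t ^ 2) < 1) by (intros t Ht; rewrite Rabs_pos_eq by apply pow2_ge_0; nra).
assert (Rb : forall t, 0 <= t < 1 -> Rabs (landen t) < 1).
{ intros t Ht. destruct (Req_dec t 0) as [->|]; [|destruct (landen_range t); [lra|rewrite Rabs_pos_eq; lra]].
  unfold landen. replace (4 * 0 / (1 + 0) ^ 2) with 0 by field. rewrite Rabs_R0; lra. }
assert (dA : forall t, 0 <= t < 1 -> is_derive A t (2 * t * nomeL' (t ^ 2))).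
{ intros t Ht. apply (is_derive_comp nomeL (fun t => t ^ 2)); [apply is_derive_nomeL; auto|]. auto_derive; auto; ring. }
assert (dB : forall t, 0 <= t < 1 -> is_derive B t (4 * (1 - t) / (1 + t) ^ 3 * nomeL' (landen t))).
{ intros t Ht. apply (is_derive_comp nomeL landen); [apply is_derive_nomeL; auto|apply is_derive_landen; lra]. }
(* For t > 0 this is Y(t^2) - 2 Y(landen t) with the singular terms ln t cancelled; it remains
   defined at t = 0, where it vanishes. *)
set (V := fun t => 2 * B t - A t - 4 * ln (1 + t)).
assert (dV : forall t, 0 <= t < 1 -> is_derive V t
   (2 * (4 * (1 - t) / (1 + t) ^ 3 * nomeL' (landen t)) - 2 * t * nomeL' (t ^ 2) - 4 * / (1 + t))).
{ intros t Ht. specialize (dA t Ht). specialize (dB t Ht).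
  assert (eA : ex_derive A t) by (eexists; eauto). assert (eB : ex_derive B t) by (eexists; eauto).
  apply is_derive_unique in dA. apply is_derive_unique in dB.
  unfold V. auto_derive; [repeat split; auto; lra|].
  change (Derive (fun x => A x) t) with (Derive A t). change (Derive (fun x => B x) t) with (Derive B t).
  rewrite dA, dB. field. lra. }
assert (V0 : V l = V 0).
{ apply (derive_zero_const_right V 0 1); [lra|eapply continuous_is_derive, dV; lra| |lra].
  intros t Ht. assert (D := dV t ltac:(lra)).
  match type of D with is_derive _ _ ?e => replace 0 with e; auto end.
  assert (E1 := nomeL'_eq (t ^ 2) (Ra t ltac:(lra))). assert (E2 := nomeL'_eq (landen t) (Rb t ltac:(lra))).
  rewrite hypF_landen, landen_1m in E2 by lra. assert (F1 := hypF_ge_1 (t ^ 2) ltac:(nra)).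
  set (f := hypF (t ^ 2)) in *. set (p := nomeL' (landen t)) in *. set (q := nomeL' (t ^ 2)) in *.
  assert (Ht2 : 0 < 1 - t ^ 2) by nra.
  assert (Eq : t ^ 2 * q = / ((1 - t ^ 2) * f ^ 2) - 1).
  { apply Rmult_eq_reg_r with ((1 - t ^ 2) * f ^ 2); [|apply Rgt_not_eq, Rmult_lt_0_compat; [lra|apply pow_lt; lra]].
    transitivity ((1 + t ^ 2 * q) * ((1 - t ^ 2) * f ^ 2) - (1 - t ^ 2) * f ^ 2); [ring|]. rewrite E1.
    field. split; lra. }
  assert (Ep : landen t * p = / ((1 - t) ^ 2 * f ^ 2) - 1).
  { apply Rmult_eq_reg_r with ((1 - t) ^ 2 * f ^ 2); [|apply Rgt_not_eq, Rmult_lt_0_compat; apply pow_lt; lra].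
    transitivity ((1 + landen t * p) * (((1 - t) / (1 + t)) ^ 2 * ((1 + t) * f) ^ 2) - (1 - t) ^ 2 * f ^ 2); [field; lra|].
    rewrite E2. field. split; lra. }
  apply Rmult_eq_reg_l with t; [|lra].
  transitivity (2 * ((1 - t) / (1 + t)) * (landen t * p) - 2 * (t ^ 2 * q) - 4 * t / (1 + t)); [unfold landen; field; lra|].
  rewrite Ep, Eq. field. repeat split; lra. }
unfold V, A, B in V0. replace (landen 0) with 0 in V0 by (unfold landen; field).
replace (0 ^ 2) with 0 in V0 by ring. rewrite nomeL_0, Rplus_0_r, ln_1 in V0.
unfold nomeY. replace (ln (landen l)) with (ln 4 + ln l - 2 * ln (1 + l)).
- replace (ln (l ^ 2)) with (2 * ln l) by (rewrite ln_pow by lra; simpl; ring).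
  replace (ln 16) with (2 * ln 4) by (replace 16 with (4 ^ 2) by ring; rewrite ln_pow by lra; simpl; ring). lra.
- unfold landen, Rdiv. assert (0 < (1 + l) ^ 2) by (apply pow_lt; lra).
  rewrite ln_mult, ln_mult, ln_Rinv, ln_pow; simpl; try lra. apply Rinv_0_lt_compat; simpl in *; lra.
Qed.

(** * Wallis' product and the logarithmic growth of F at 1 *)

Definition wallis (n : nat) : R := RInt (fun t => sin t ^ n) 0 (PI / 2).

Lemma continuous_sin_pow n t : continuous (fun t => sin t ^ n) t.
Proof.
apply (@ex_derive_continuous R_AbsRing R_NormedModule). auto_derive; auto.
Qed.

Lemma ex_RInt_sin_pow n a b : ex_RInt (fun t => sin t ^ n) a b.
Proof. apply (@ex_RInt_continuous R_CompleteNormedModule). intros z _. apply continuous_sin_pow. Qed.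

Lemma wallis_0 : wallis 0 = PI / 2.
Proof. unfold wallis. simpl. rewrite RInt_const. unfold scal; simpl. unfold mult; simpl. ring. Qed.

Lemma wallis_1 : wallis 1 = 1.
Proof.
unfold wallis. apply is_RInt_unique.
replace 1 with (minus (- cos (PI / 2)) (- cos 0)).
- apply (is_RInt_derive (V := R_CompleteNormedModule) (fun t => - cos t)).
  + intros t _. auto_derive; auto; ring.
  + intros t _. apply continuous_sin_pow.
- rewrite cos_PI2, cos_0. unfold minus, plus, opp; simpl. ring.
Qed.

(** Integration by parts, phrased as the derivative of cos t sin^(n+1) t, whose boundary values
    vanish. *)
Lemma wallis_SS n : (INR n + 2) * wallis (S (S n)) = (INR n + 1) * wallis n.
Proof.
assert (H : is_RInt (fun t => (INR n + 1) * sin t ^ n - (INR n + 2) * sin t ^ S (S n)) 0 (PI / 2)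
   (minus (cos (PI / 2) * sin (PI / 2) ^ S n) (cos 0 * sin 0 ^ S n))).
{ apply (is_RInt_derive (V := R_CompleteNormedModule) (fun t => cos t * sin t ^ S n)).
  - intros t _. auto_derive; auto. change (match n with 0%nat => 1 | S _ => INR n + 1 end) with (INR (S n)). rewrite S_INR.
    assert (E := sin2_cos2 t). unfold Rsqr in E.
    transitivity (- sin t * (sin t * sin t ^ n) + (INR n + 1) * sin t ^ n * (cos t * cos t)); [ring|].
    replace (cos t * cos t) with (1 - sin t * sin t) by lra. simpl. ring.
  - intros t _. apply (@ex_derive_continuous R_AbsRing R_NormedModule). auto_derive; auto. }
apply (is_RInt_unique (V := R_CompleteNormedModule)) in H. rewrite cos_PI2, sin_0 in H.
assert (E : RInt (fun t => (INR n + 1) * sin t ^ n - (INR n + 2) * sin t ^ S (S n)) 0 (PI / 2) =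
   (INR n + 1) * wallis n - (INR n + 2) * wallis (S (S n))).
{ assert (X := ex_RInt_sin_pow n 0 (PI / 2)). assert (Y := ex_RInt_sin_pow (S (S n)) 0 (PI / 2)).
  apply is_RInt_unique.
  apply (is_RInt_minus (V := R_NormedModule) (fun t => (INR n + 1) * sin t ^ n) (fun t => (INR n + 2) * sin t ^ S (S n)));
  apply (is_RInt_scal (V := R_NormedModule)); now apply (RInt_correct (V := R_CompleteNormedModule)). }
rewrite E in H. unfold minus, plus, opp in H; simpl in H.
change (fun t : R => sin t * (sin t * sin t ^ n)) with (fun t : R => sin t ^ S (S n)) in H. lra.
Qed.

Lemma wallis_decr n : wallis (S n) <= wallis n.
Proof.
assert (HPI := PI_RGT_0). apply RInt_le; [lra|apply ex_RInt_sin_pow|apply ex_RInt_sin_pow|].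
intros t Ht. assert (S0 : 0 <= sin t) by (apply sin_ge_0; lra). assert (S1 := SIN_bound t).
simpl. assert (P := pow_le _ n S0). nra.
Qed.

Lemma wallis_even n : wallis (2 * n) = PI / 2 * beta n.
Proof.
induction n as [|n IH]; [simpl (2 * 0)%nat; rewrite wallis_0; simpl; ring|].
replace (2 * S n)%nat with (S (S (2 * n))) by lia.
assert (E := wallis_SS (2 * n)). rewrite IH, mult_INR in E. simpl (INR 2) in E.
assert (B := beta_S n). assert (H := pos_INR n).
apply Rmult_eq_reg_l with ((1 + 1) * INR n + 2); [|lra]. rewrite E.
transitivity (PI * ((INR n + / 2) * beta n)); [field|]. rewrite <- B. field.
Qed.

Lemma wallis_odd n : (2 * INR n + 1) * beta n * wallis (2 * n + 1) = 1.
Proof.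
induction n as [|n IH]; [simpl (2 * 0 + 1)%nat; rewrite wallis_1; simpl; ring|].
replace (2 * S n + 1)%nat with (S (S (2 * n + 1))) by lia.
assert (E := wallis_SS (2 * n + 1)). rewrite plus_INR, mult_INR in E. simpl (INR 2) in E. simpl (INR 1) in E.
assert (B := beta_S n). rewrite S_INR.
transitivity (beta (S n) * (((1 + 1) * INR n + 1 + 2) * wallis (S (S (2 * n + 1))))); [ring|]. rewrite E.
transitivity (2 * ((INR n + 1) * beta (S n)) * wallis (2 * n + 1)); [ring|]. rewrite B.
rewrite <- IH. field.
Qed.

(** The inequality W_(2n+1) <= W_(2n), multiplied by (2n + 1) beta_n. *)
Lemma acoef_lower n : 1 <= (2 * INR n + 1) * (PI / 2) * acoef n.
Proof.
assert (D := wallis_decr (2 * n)). replace (S (2 * n)) with (2 * n + 1)%nat in D by lia.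
rewrite wallis_even in D. assert (O := wallis_odd n). assert (B := beta_bounds n). assert (H := pos_INR n).
unfold acoef. rewrite <- O at 1. replace ((2 * INR n + 1) * (PI / 2) * beta n ^ 2) with ((2 * INR n + 1) * beta n * (PI / 2 * beta n)) by ring.
apply Rmult_le_compat_l; auto. apply Rmult_le_pos; lra.
Qed.

(** From W_(2n+2) <= W_(2n+1) one gets (2n + 1)^2 (pi/2) a_n <= 2n + 2, and 2n (2n + 2) <= (2n +
    1)^2. *)
Lemma acoef_upper n : 2 * INR n * (PI / 2) * acoef n <= 1.
Proof.
assert (D := wallis_decr (2 * n + 1)). replace (S (2 * n + 1)) with (2 * S n)%nat in D by lia.
rewrite wallis_even in D. assert (O := wallis_odd n). assert (B := beta_bounds n). assert (H := pos_INR n).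
assert (E := beta_S n). assert (HPI := PI_RGT_0).
assert (U : (2 * INR n + 1) ^ 2 * (PI / 2) * acoef n <= 2 * INR n + 2).
{ unfold acoef. apply Rle_trans with ((2 * INR n + 2) * ((2 * INR n + 1) * beta n * wallis (2 * n + 1))); [|rewrite O; lra].
  apply Rle_trans with ((2 * INR n + 2) * ((2 * INR n + 1) * beta n * (PI / 2 * beta (S n)))).
  - right. transitivity ((2 * INR n + 1) * PI * beta n * ((INR n + 1) * beta (S n))); [|field]. rewrite E. field.
  - apply Rmult_le_compat_l; [lra|]. apply Rmult_le_compat_l; auto. apply Rmult_le_pos; lra. }
assert (A := acoef_bounds n).
apply Rmult_le_reg_l with (2 * INR n + 2); [lra|].
apply Rle_trans with ((2 * INR n + 1) ^ 2 * (PI / 2) * acoef n); [|lra].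
replace ((2 * INR n + 2) * (2 * INR n * (PI / 2) * acoef n)) with ((2 * INR n + 2) * (2 * INR n) * (PI / 2 * acoef n)) by ring.
rewrite (Rmult_assoc _ (PI / 2)). apply Rmult_le_compat_r; [apply Rmult_le_pos; lra|]. lra.
Qed.

Definition logcoef (n : nat) : R := match n with O => 0 | S _ => / INR n end.

Lemma logcoef_bounds n : 0 <= logcoef n <= 1.
Proof.
destruct n as [|n]; [simpl; lra|]. unfold logcoef.
assert (H : 1 <= INR (S n)) by (rewrite S_INR; assert (A := pos_INR n); lra). split.
- left; apply Rinv_0_lt_compat; lra.
- rewrite <- Rinv_1. apply Rinv_le_contravar; lra.
Qed.

Lemma PSeries_logcoef x : 0 <= x < 1 -> PSeries logcoef x = - ln (1 - x).
Proof.
intros Hx.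
assert (Hb : forall n, Rabs (logcoef n) <= 1) by (intros n; assert (B := logcoef_bounds n); rewrite Rabs_pos_eq; lra).
assert (D : forall t, 0 <= t < 1 -> is_derive (fun t => PSeries logcoef t + ln (1 - t)) t 0).
{ intros t Ht. assert (Ha : Rabs t < 1) by (rewrite Rabs_pos_eq; lra).
  assert (D1 := is_derive_PSeries logcoef t (CV_radius_inside_1 _ _ t Hb Ha)).
  assert (E : PSeries (PS_derive logcoef) t = / (1 - t)).
  { unfold PSeries. rewrite (Series_ext _ (fun n => t ^ n)); [now apply Series_geom|].
    intros n. unfold PS_derive, logcoef. rewrite Rinv_r by (apply not_0_INR; lia). ring. }
  assert (e1 : ex_derive (PSeries logcoef) t) by (eexists; eauto). apply is_derive_unique in D1.
  auto_derive; [repeat split; auto; lra|].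
  change (Derive (fun x => PSeries logcoef x) t) with (Derive (PSeries logcoef) t). rewrite D1, E. field. lra. }
assert (C : PSeries logcoef x + ln (1 - x) = PSeries logcoef 0 + ln (1 - 0)).
{ apply (derive_zero_const_right (fun t => PSeries logcoef t + ln (1 - t)) 0 1); [lra| | |lra].
  - eapply continuous_is_derive, D; lra.
  - intros t Ht. apply D; lra. }
rewrite PSeries_0, Rminus_0_r, ln_1 in C. simpl in C. lra.
Qed.

(** Termwise comparison of pi a_n with 1/n. In the lower bound the index is shifted, pi a_n x^n >=
    x^(n+1) / (n + 1); in the upper one the term pi a_0 stands apart. The width pi is harmless,
    since only the leading growth matters later. *)
Lemma hypF_log_bounds x : 0 <= x < 1 -> - ln (1 - x) <= PI * hypF x <= PI - ln (1 - x).
Proof.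
intros Hx. assert (HPI := PI_RGT_0). assert (Ha : Rabs x < 1) by (rewrite Rabs_pos_eq; lra).
rewrite <- (PSeries_logcoef x Hx) at 1.
replace (PI - ln (1 - x)) with (PI + PSeries logcoef x) by (rewrite (PSeries_logcoef x Hx); ring).
assert (Hb : forall n, Rabs (logcoef n) <= 1) by (intros n; assert (B := logcoef_bounds n); rewrite Rabs_pos_eq; lra).
assert (EL : ex_series (fun n => logcoef n * x ^ n)).
{ apply (ex_pseries_R logcoef x). now apply CV_radius_inside, CV_radius_inside_1 with (M := 1). }
assert (EA : ex_series (fun n => PI * (acoef n * x ^ n))).
{ apply (ex_series_scal_l PI (fun n => acoef n * x ^ n)). apply (ex_pseries_R acoef x). apply CV_radius_inside. now apply acoef_radius. }
unfold hypF, PSeries. rewrite <- Series_scal_l.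
assert (Hc : forall n, 2 * INR n * (PI / 2) * acoef n = INR n * (PI * acoef n)) by (intros; field).
rewrite (Series_incr_1 (fun n => logcoef n * x ^ n)) by auto.
assert (EL1 := proj1 (ex_series_incr_1 _) EL). assert (EA1 := proj1 (ex_series_incr_1 _) EA).
simpl (logcoef 0 * x ^ 0). rewrite Rmult_0_l, Rplus_0_l.
split.
- apply Series_le; auto. intros n. assert (B := logcoef_bounds (S n)).
  assert (P := pow_le x n (proj1 Hx)). assert (P' := pow_le x (S n) (proj1 Hx)). assert (Hn := pos_INR n).
  split; [apply Rmult_le_pos; lra|].
  apply Rle_trans with (logcoef (S n) * x ^ n); [apply Rmult_le_compat_l; [lra|]; simpl; nra|].
  rewrite <- Rmult_assoc. apply Rmult_le_compat_r; auto. unfold logcoef. rewrite S_INR.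
  assert (L := acoef_lower n). assert (A := acoef_bounds n).
  apply Rmult_le_reg_l with (INR n + 1); [lra|]. rewrite Rinv_r by lra.
  assert (0 < PI * acoef n) by (apply Rmult_lt_0_compat; lra). lra.
- rewrite (Series_incr_1 (fun n => PI * (acoef n * x ^ n))) by auto.
  replace (PI * (acoef 0 * x ^ 0)) with PI by (unfold acoef; simpl; ring).
  apply Rplus_le_compat_l. apply Series_le; auto. intros n.
  assert (A := acoef_bounds (S n)). assert (P := pow_le x (S n) (proj1 Hx)). split; [apply Rmult_le_pos; [lra|apply Rmult_le_pos; lra]|].
  rewrite <- Rmult_assoc. apply Rmult_le_compat_r; auto. unfold logcoef.
  assert (U := acoef_upper (S n)). rewrite Hc in U. assert (0 < INR (S n)) by (apply lt_0_INR; lia).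
  apply Rmult_le_reg_l with (INR (S n)); auto. rewrite Rinv_r; lra.
Qed.

Definition ratioY (x : R) : R := PI * hypF (1 - x) / hypF x.

(** Landen's transformation is used twice, at l and at m = (1 - l) / (1 + l). Passing to complements
    exchanges the arguments, 1 - landen l = m^2 and 1 - l^2 = landen m, and the 2 is (1 + l)(1 +
    m). *)
Lemma ratioY_landen l : 0 < l < 1 -> ratioY (l ^ 2) = 2 * ratioY (landen l).
Proof.
intros Hl. set (m := (1 - l) / (1 + l)).
assert (Hm : 0 < m < 1).
{ unfold m. split; [apply Rdiv_lt_0_compat; lra|]. apply Rmult_lt_reg_r with (1 + l); [lra|].
  unfold Rdiv. rewrite Rmult_assoc, Rinv_l; lra. }
assert (E1 := hypF_landen l ltac:(lra)). assert (E2 := hypF_landen m ltac:(lra)).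
replace (landen m) with (1 - l ^ 2) in E2 by (unfold landen, m; field; lra).
assert (F1 := hypF_ge_1 (l ^ 2) ltac:(nra)).
unfold ratioY. rewrite landen_1m by lra. fold m. rewrite E1, E2. unfold m. field. lra.
Qed.

(** F(x) and F(1 - x) solve the same equation, so x (1 - x) times their Wronskian is constant. Its
    value is left open here and determined by the growth at 1. *)
Lemma ratioY_deriv : exists kappa, forall x, 0 < x < 1 -> is_derive ratioY x (- kappa / (x * (1 - x) * hypF x ^ 2)).
Proof.
set (W := fun x => hypF x * hypD (1 - x) + hypD x * hypF (1 - x)).
assert (d1 : forall x, 0 < x < 1 -> is_derive (fun x => hypF (1 - x)) x (- hypF' (1 - x))).
{ intros x Hx. replace (- hypF' (1 - x)) with (-1 * hypF' (1 - x)) by ring.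
  apply (is_derive_comp hypF (fun x => 1 - x)); [apply is_derive_hypF; rewrite Rabs_pos_eq; lra|auto_derive; auto; ring]. }
assert (d2 : forall x, 0 < x < 1 -> is_derive (fun x => hypD (1 - x)) x (- (hypF (1 - x) / 4))).
{ intros x Hx. replace (- (hypF (1 - x) / 4)) with (-1 * (hypF (1 - x) / 4)) by ring.
  apply (is_derive_comp hypD (fun x => 1 - x)); [apply is_derive_hypD; rewrite Rabs_pos_eq; lra|auto_derive; auto; ring]. }
assert (dW : forall x, 0 < x < 1 -> is_derive W x 0).
{ intros x Hx. assert (Ha : Rabs x < 1) by (rewrite Rabs_pos_eq; lra).
  assert (D1 := is_derive_hypF x Ha). assert (D2 := is_derive_hypD x Ha). assert (D3 := d1 x Hx). assert (D4 := d2 x Hx).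
  replace 0 with ((hypF' x * hypD (1 - x) + hypF x * (- (hypF (1 - x) / 4))) + (hypF x / 4 * hypF (1 - x) + hypD x * (- hypF' (1 - x)))).
  2:{ unfold hypD. field. }
  apply (is_derive_plus (V := R_NormedModule) (fun x => hypF x * hypD (1 - x)) (fun x => hypD x * hypF (1 - x))).
  - apply (is_derive_mult (K := R_AbsRing) hypF (fun x => hypD (1 - x))); auto; intros; apply Rmult_comm.
  - apply (is_derive_mult (K := R_AbsRing) hypD (fun x => hypF (1 - x))); auto; intros; apply Rmult_comm. }
assert (HW : forall x, 0 < x < 1 -> W x = W (/ 2)).
{ intros x Hx. destruct (Rtotal_order x (/ 2)) as [L|[->|L]]; auto.
  - apply derive_zero_const; auto. intros t Ht. apply dW. lra.
  - symmetry. apply derive_zero_const; auto. intros t Ht. apply dW. lra. }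
exists (PI * W (/ 2)). intros x Hx. rewrite <- (HW x Hx).
assert (F1 := hypF_ge_1 x ltac:(lra)).
assert (Ha : Rabs x < 1) by (rewrite Rabs_pos_eq; lra).
assert (D1 := is_derive_hypF x Ha). assert (D3 := d1 x Hx).
set (A := fun x => hypF (1 - x)). change (is_derive A x (- hypF' (1 - x))) in D3.
assert (e1 : ex_derive hypF x) by (eexists; eauto). assert (e2 : ex_derive A x) by (eexists; eauto).
apply is_derive_unique in D1. apply is_derive_unique in D3.
unfold ratioY. change (is_derive (fun x => PI * A x / hypF x) x (- (PI * W x) / (x * (1 - x) * hypF x ^ 2))).
auto_derive; [repeat split; auto; lra|].
change (Derive (fun x => A x) x) with (Derive A x). change (Derive (fun x => hypF x) x) with (Derive hypF x).
rewrite D1, D3. unfold W, A, hypD. field. lra.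
Qed.

(* The Wronskian gives y = kappa Y + c; Landen's doubling forces c = 0, and Wallis' product kappa = 1. *)
Lemma nomeY_eq_ratioY x : 0 < x < 1 -> nomeY x = ratioY x.
Proof.
destruct ratioY_deriv as [kappa Hk].
assert (HC : forall x, 0 < x < 1 -> ratioY x - kappa * nomeY x = ratioY (/ 2) - kappa * nomeY (/ 2)).
{ assert (D : forall x, 0 < x < 1 -> is_derive (fun x => ratioY x - kappa * nomeY x) x 0).
  { intros t Ht. assert (F1 := hypF_ge_1 t ltac:(lra)).
    replace 0 with (- kappa / (t * (1 - t) * hypF t ^ 2) - kappa * (- / (t * (1 - t) * hypF t ^ 2))).
    2:{ field. repeat split; lra. }
    apply (is_derive_minus (V := R_NormedModule)); [now apply Hk|].
    apply (is_derive_scal nomeY). now apply is_derive_nomeY. }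
  intros t Ht. destruct (Rtotal_order t (/ 2)) as [L|[->|L]]; auto.
  - apply (derive_zero_const (fun x => ratioY x - kappa * nomeY x)); auto. intros s Hs. apply D. lra.
  - symmetry. apply (derive_zero_const (fun x => ratioY x - kappa * nomeY x)); auto. intros s Hs. apply D. lra. }
assert (C0 : ratioY (/ 2) - kappa * nomeY (/ 2) = 0).
(* Evaluated at l^2 and at landen l for l = 1/2, the constant equals its own double. *)
{ assert (E1 := HC (/ 2 ^ 2) ltac:(lra)). assert (R := landen_range (/ 2) ltac:(lra)). assert (E2 := HC (landen (/ 2)) R).
  assert (A := ratioY_landen (/ 2) ltac:(lra)). assert (B := nomeY_landen (/ 2) ltac:(lra)).
  replace (/ 2 ^ 2) with ((/ 2) ^ 2) in E1 by field. rewrite A, B in E1. lra. }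
assert (HY : forall x, 0 < x < 1 -> ratioY x = kappa * nomeY x) by (intros t Ht; specialize (HC t Ht); lra).
assert (K1 : kappa = 1).
(* Along this sequence ln x_n = -(n + 1) exactly, so dividing by n + 1 normalises the logarithm. *)
{ set (xn := fun n => exp (- INR (S n))).
  assert (Hxn : forall n, 0 < xn n < 1).
  { intros n. split; [apply exp_pos|]. rewrite <- exp_0. apply exp_increasing.
    assert (0 < INR (S n)) by (apply lt_0_INR; lia). lra. }
  assert (Linv : is_lim_seq (fun n => / INR (S n)) 0).
  { apply (is_lim_seq_inv (fun n => INR (S n)) p_infty).
    - apply (is_lim_seq_incr_1 INR). apply is_lim_seq_INR.
    - discriminate. }
  assert (Lx : is_lim_seq xn 0).
  { apply (is_lim_seq_ext (fun n => (exp (-1)) ^ S n)).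
    - intros n. unfold xn. rewrite <- (exp_ln (exp (-1) ^ S n)) by (apply pow_lt, exp_pos).
      f_equal. rewrite ln_pow by apply exp_pos. rewrite ln_exp. ring.
    - apply (is_lim_seq_incr_1 (fun n => exp (-1) ^ n)). apply is_lim_seq_geom.
      rewrite Rabs_pos_eq by (left; apply exp_pos). rewrite <- exp_0. apply exp_increasing; lra. }
  assert (LF : is_lim_seq (fun n => hypF (xn n)) 1).
  { rewrite <- hypF_0. apply (is_lim_seq_continuous hypF xn 0); auto.
    apply continuity_pt_filterlim. apply (continuous_is_derive hypF 0 (hypF' 0)). apply is_derive_hypF. rewrite Rabs_R0; lra. }
  assert (LLm : is_lim_seq (fun n => nomeL (xn n)) 0).
  { rewrite <- nomeL_0. apply (is_lim_seq_continuous nomeL xn 0); auto.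
    apply continuity_pt_filterlim. apply (continuous_is_derive nomeL 0 (nomeL' 0)). apply is_derive_nomeL. rewrite Rabs_R0; lra. }
  (* This is kappa F(x_n) Y(x_n) / (n + 1) = pi F(1 - x_n) / (n + 1). The first form tends to kappa;
     by [hypF_log_bounds] the second lies between 1 and 1 + pi / (n + 1). *)
  set (G := fun n => kappa * hypF (xn n) * (1 + (ln 16 - nomeL (xn n)) * / INR (S n))).
  assert (LG : is_lim_seq G kappa).
  { unfold G. replace (Finite kappa) with (Finite (kappa * 1 * (1 + (ln 16 - 0) * 0))) by (f_equal; ring).
    apply is_lim_seq_mult'; [apply is_lim_seq_mult'; [apply is_lim_seq_const|exact LF]|].
    apply is_lim_seq_plus'; [apply is_lim_seq_const|]. apply is_lim_seq_mult'; [|exact Linv].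
    apply is_lim_seq_minus'; [apply is_lim_seq_const|exact LLm]. }
  assert (LG1 : is_lim_seq G 1).
  { apply is_lim_seq_le_le with (u := fun _ => 1) (w := fun n => 1 + PI * / INR (S n)).
    - intros n. specialize (Hxn n). assert (B := hypF_log_bounds (1 - xn n) ltac:(lra)).
      replace (1 - (1 - xn n)) with (xn n) in B by ring.
      assert (E := HY (xn n) Hxn). assert (F1 := hypF_ge_1 (xn n) ltac:(lra)).
      assert (EP : PI * hypF (1 - xn n) = kappa * hypF (xn n) * nomeY (xn n)).
      { rewrite Rmult_assoc, (Rmult_comm (hypF _)), <- Rmult_assoc, <- E. unfold ratioY. field. lra. }
      rewrite EP in B. unfold nomeY in B. replace (ln (xn n)) with (- INR (S n)) in B by (unfold xn; now rewrite ln_exp).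
      assert (HS : 0 < INR (S n)) by (apply lt_0_INR; lia).
      assert (EG : G n * INR (S n) = kappa * hypF (xn n) * (ln 16 - - INR (S n) - nomeL (xn n))) by (unfold G; field; lra).
      rewrite <- EG in B.
      split; (apply Rmult_le_reg_r with (INR (S n)); [auto|]).
      + lra.
      + rewrite Rmult_plus_distr_r, Rmult_assoc, Rinv_l; lra.
    - apply is_lim_seq_const.
    - replace (Finite 1) with (Finite (1 + PI * 0)) by (f_equal; ring).
      apply is_lim_seq_plus'; [apply is_lim_seq_const|]. apply is_lim_seq_mult'; [apply is_lim_seq_const|exact Linv]. }
  apply is_lim_seq_unique in LG. apply is_lim_seq_unique in LG1. rewrite LG in LG1. now injection LG1. }
intros Hx. rewrite HY, K1; auto; ring.
Qed.

(** Read off from the quotient form; the bound |Q| < 1 in the disc, hence convergence of the Lambert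
    series, rests on it. *)
Lemma nomeY_pos x : 0 < x < 1 -> 0 < nomeY x.
Proof.
intros Hx. rewrite nomeY_eq_ratioY by auto. assert (F1 := hypF_ge_1 x ltac:(lra)). assert (F2 := hypF_ge_1 (1 - x) ltac:(lra)).
assert (HPI := PI_RGT_0). unfold ratioY. apply Rdiv_lt_0_compat; [apply Rmult_lt_0_compat|]; lra.
Qed.

Lemma nomeY_decr x t : 0 < x -> x < t -> t < 1 -> nomeY t < nomeY x.
Proof.
intros Hx Hxt Ht.
destruct (MVT_gen nomeY x t (fun x => - / (x * (1 - x) * hypF x ^ 2))) as [c [Hc E]].
- intros s Hs. rewrite Rmin_left, Rmax_right in Hs by lra. apply is_derive_nomeY. lra.
- intros s Hs. rewrite Rmin_left, Rmax_right in Hs by lra. apply continuity_pt_filterlim.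
  eapply continuous_is_derive, is_derive_nomeY. lra.
- rewrite Rmin_left, Rmax_right in Hc by lra. assert (F1 := hypF_ge_1 c ltac:(lra)).
  assert (0 < / (c * (1 - c) * hypF c ^ 2)).
  { apply Rinv_0_lt_compat. repeat apply Rmult_lt_0_compat; try lra. }
  nra.
Qed.

(** * Theta functions *)

(** A sum over -M..M of an even sequence, folded onto the natural numbers. *)
Fixpoint hsum (f : nat -> R) (M : nat) : R :=
  match M with O => f O | S m => hsum f m + 2 * f (S m) end.

(** Here c' comes from multiplying the symmetric Laurent series of c by al + be (z + 1/z). The sum
    is its value at z = 1, truncated at M, and the last term is the truncation defect. *)
Lemma hsum_recurrence (c c' : nat -> R) (al be : R) (M : nat) :
  c' O = al * c O + 2 * be * c 1%nat ->
  (forall k, (k < M)%nat -> c' (S k) = al * c (S k) + be * (c k + c (S (S k)))) ->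
  hsum c' M = (al + 2 * be) * hsum c M + 2 * be * (c (S M) - c M).
Proof.
intros H0. induction M as [|M IH]; intros H; simpl.
- rewrite H0. ring.
- rewrite IH by (intros; apply H; lia). rewrite H by lia. ring.
Qed.

(** The q-Pochhammer symbol (t; t)_m. *)
Fixpoint qpoch (t : R) (m : nat) : R :=
  match m with O => 1 | S k => qpoch t k * (1 - t ^ S k) end.

Lemma pow_lt_1 t n : 0 <= t < 1 -> t ^ S n < 1.
Proof.
intros H. assert (P := pow_le_1 t n ltac:(lra)).
simpl. nra.
Qed.

Lemma qpoch_bounds t m : 0 <= t < 1 -> 0 < qpoch t m <= 1.
Proof.
intros H. induction m as [|m IH]; [simpl; lra|].
assert (P1 := pow_lt_1 t m H). assert (P2 := pow_le t (S m) (proj1 H)).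
change (0 < qpoch t m * (1 - t ^ S m) <= 1). split; [apply Rmult_lt_0_compat; lra|]. nra.
Qed.

(** A product of factors 1 - t^j is at least 1 minus the sum of the t^j. The induction carries the
    finite geometric sum, which is enlarged to the full one at the end. *)
Lemma qpoch_ratio t m s : 0 <= t < 1 ->
  qpoch t m * (1 - t ^ S m / (1 - t)) <= qpoch t (m + s) <= qpoch t m.
Proof.
intros H.
assert (A : qpoch t m * (1 - t ^ S m * (1 - t ^ s) / (1 - t)) <= qpoch t (m + s) <= qpoch t m).
{ induction s as [|s IH].
  - rewrite Nat.add_0_r. simpl (t ^ 0). split; [right; field|]; lra.
  - rewrite Nat.add_succ_r.
    change (qpoch t (S (m + s))) with (qpoch t (m + s) * (1 - t ^ S (m + s))).
    assert (P1 := pow_lt_1 t (m + s) H). assert (P2 := pow_le t (S (m + s)) (proj1 H)).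
    assert (B := qpoch_bounds t m H). assert (B2 := qpoch_bounds t (m + s) H).
    split; [|nra].
    apply Rle_trans with (qpoch t (m + s) - qpoch t m * t ^ S (m + s)); [|nra].
    apply Rle_trans with (qpoch t m * (1 - t ^ S m * (1 - t ^ s) / (1 - t)) - qpoch t m * t ^ S (m + s)); [|lra].
    right. replace (S (m + s)) with (S m + s)%nat by lia. rewrite pow_add. simpl (t ^ S s). field. lra. }
split; [|apply A]. eapply Rle_trans; [|apply A]. assert (B := qpoch_bounds t m H).
apply Rmult_le_compat_l; [lra|]. unfold Rdiv.
assert (P := pow_le t s (proj1 H)). assert (P2 := pow_le t (S m) (proj1 H)).
assert (0 < / (1 - t)) by (apply Rinv_0_lt_compat; lra).
assert (t ^ S m * (1 - t ^ s) * / (1 - t) <= t ^ S m * / (1 - t)); [|lra].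
apply Rmult_le_compat_r; [lra|]. nra.
Qed.

(* q-binomial coefficient [2n choose n+k] in base q^2, times q^(k^2). *)
Definition jtp_coef (q : R) (n k : nat) : R :=
  if le_dec k n then qpoch (q ^ 2) (2 * n) / (qpoch (q ^ 2) (n + k) * qpoch (q ^ 2) (n - k)) * q ^ (k * k)
  else 0.

Fixpoint odd_prod (q : R) (n : nat) : R :=
  match n with O => 1 | S m => odd_prod q m * (1 + q ^ (2 * m + 1)) end.

Lemma sqr_lt_1 q : Rabs q < 1 -> 0 <= q ^ 2 < 1.
Proof.
intros H. split; [apply pow2_ge_0|]. rewrite <- (pow2_abs q). assert (A := Rabs_pos q). nra.
Qed.

(** Coefficient of z^(k+1) when the product of the (1 + z q^(2j+1)) (1 + q^(2j+1) / z) acquires the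
    factor j = n, which expands to 1 + q^(4n+2) + q^(2n+1) (z + 1/z). *)
Lemma jtp_coef_rec_S q n k : Rabs q < 1 -> (k < S n)%nat ->
  jtp_coef q (S n) (S k) = (1 + q ^ (4 * n + 2)) * jtp_coef q n (S k) +
    q ^ (2 * n + 1) * (jtp_coef q n k + jtp_coef q n (S (S k))).
Proof.
intros Hq Hk. assert (Ht := sqr_lt_1 q Hq). 
assert (Q : forall m, qpoch (q ^ 2) m <> 0) by (intros m; assert (B := qpoch_bounds (q ^ 2) m Ht); lra).
assert (P : forall m, 1 - (q ^ 2) ^ S m <> 0) by (intros m; assert (B := pow_lt_1 (q ^ 2) m Ht); lra).
(* At the edge k = n only the neighbour [jtp_coef q n k] is nonzero; otherwise n = k + 1 + b and
   everything reduces to the same three q-Pochhammer symbols. *)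
destruct (Nat.eq_dec k n) as [->|Hne].
- unfold jtp_coef. destruct (le_dec (S n) (S n)) as [_|]; [|lia]. destruct (le_dec (S n) n); [lia|].
  destruct (le_dec n n) as [_|]; [|lia]. destruct (le_dec (S (S n)) n); [lia|].
  replace (2 * S n)%nat with (S n + S n)%nat by lia. replace (2 * n)%nat with (n + n)%nat by lia. rewrite !Nat.sub_diag.
  simpl (qpoch (q ^ 2) 0). 
  replace (q ^ (S n * S n)) with (q ^ (n + n + 1) * q ^ (n * n)) by (rewrite <- pow_add; f_equal; lia).
  field. split; apply Q.
- assert (HS : exists b, n = (S k + b)%nat) by (exists (n - S k)%nat; lia). destruct HS as [b ->].
  set (n := (S k + b)%nat). set (t := q ^ 2) in *.
  assert (E1 : q ^ (4 * n + 2) = (t ^ S (n + k)) * t ^ S b).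
  { unfold t. rewrite <- pow_add, <- pow_mult. f_equal. unfold n; lia. }
  assert (E2 : q ^ (2 * n + 1) * q ^ (k * k) = q ^ (S k * S k) * t ^ S b).
  { unfold t. rewrite <- pow_mult, <- !pow_add. f_equal. unfold n; lia. }
  assert (E3 : q ^ (2 * n + 1) * q ^ (S (S k) * S (S k)) = q ^ (S k * S k) * t ^ S (S (n + k))).
  { unfold t. rewrite <- pow_mult, <- !pow_add. f_equal. unfold n; lia. }
  assert (C1 : jtp_coef q (S n) (S k) = qpoch t (2 * n) * (1 - t ^ S (2 * n)) * (1 - t ^ S (S (2 * n))) /
    ((qpoch t (n + k) * (1 - t ^ S (n + k)) * (1 - t ^ S (S (n + k)))) * (qpoch t b * (1 - t ^ S b))) * q ^ (S k * S k)).
  { unfold jtp_coef. destruct (le_dec (S k) (S n)) as [_|]; [|unfold n in *; lia]. fold t.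
    replace (2 * S n)%nat with (S (S (2 * n))) by lia. replace (S n + S k)%nat with (S (S (n + k))) by lia.
    replace (S n - S k)%nat with (S b) by (unfold n; lia). reflexivity. }
  assert (C2 : jtp_coef q n (S k) = qpoch t (2 * n) / ((qpoch t (n + k) * (1 - t ^ S (n + k))) * qpoch t b) * q ^ (S k * S k)).
  { unfold jtp_coef. destruct (le_dec (S k) n) as [_|]; [|unfold n in *; lia]. fold t.
    replace (n + S k)%nat with (S (n + k)) by lia. replace (n - S k)%nat with b by (unfold n; lia). reflexivity. }
  assert (C3 : jtp_coef q n k = qpoch t (2 * n) / (qpoch t (n + k) * (qpoch t b * (1 - t ^ S b))) * q ^ (k * k)).
  { unfold jtp_coef. destruct (le_dec k n) as [_|]; [|unfold n in *; lia]. fold t.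
    replace (n - k)%nat with (S b) by (unfold n; lia). reflexivity. }
  (* The factor 1 - t^b makes this formula cover b = 0 too, where the index exceeds n and the
     coefficient is 0 by default. *)
  assert (C4 : jtp_coef q n (S (S k)) = qpoch t (2 * n) * (1 - t ^ b) / ((qpoch t (n + k) * (1 - t ^ S (n + k)) * (1 - t ^ S (S (n + k)))) * qpoch t b) * q ^ (S (S k) * S (S k))).
  { unfold jtp_coef. destruct (le_dec (S (S k)) n) as [L|L]; fold t.
    - destruct b as [|b]; [unfold n in *; lia|].
      replace (n + S (S k))%nat with (S (S (n + k))) by lia. replace (n - S (S k))%nat with b by (unfold n; lia).
      change (qpoch t (S b)) with (qpoch t b * (1 - t ^ S b)). change (qpoch t (S (S (n + k)))) with (qpoch t (n + k) * (1 - t ^ S (n + k)) * (1 - t ^ S (S (n + k)))).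
      field. repeat split; auto.
    - assert (b = 0)%nat by (unfold n in *; lia). subst b. simpl (t ^ 0). unfold Rdiv. ring. }
  rewrite C1, C2, C3, C4, E1.
  transitivity ((1 + t ^ S (n + k) * t ^ S b) * (qpoch t (2 * n) / (qpoch t (n + k) * (1 - t ^ S (n + k)) * qpoch t b) * q ^ (S k * S k)) +
    (qpoch t (2 * n) / (qpoch t (n + k) * (qpoch t b * (1 - t ^ S b))) * (q ^ (2 * n + 1) * q ^ (k * k)) +
     qpoch t (2 * n) * (1 - t ^ b) / (qpoch t (n + k) * (1 - t ^ S (n + k)) * (1 - t ^ S (S (n + k))) * qpoch t b) *
      (q ^ (2 * n + 1) * q ^ (S (S k) * S (S k))))); [|ring].
  rewrite E2, E3.
  replace (t ^ S (2 * n)) with (t ^ S (n + k) * t ^ S b) by (rewrite <- pow_add; f_equal; unfold n; lia).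
  replace (t ^ S (S (2 * n))) with (t * (t ^ S (n + k) * t ^ S b)) by (rewrite <- pow_add; rewrite tech_pow_Rmult; f_equal; unfold n; lia).
  assert (P1 := P (n + k)%nat). assert (P2 := P (S (n + k))). assert (P3 := P b).
  replace (t ^ S (S (n + k))) with (t * t ^ S (n + k)) in * by reflexivity.
  replace (t ^ S b) with (t * t ^ b) in * by reflexivity.
  set (u := t ^ S (n + k)) in *. set (v := t ^ b) in *.
  assert (Q1 := Q (2 * n)%nat). assert (Q2 := Q (n + k)%nat). assert (Q3 := Q b).
  set (x := qpoch t (2 * n)) in *. set (y := qpoch t (n + k)) in *. set (z := qpoch t b) in *.
  clearbody u v x y z t.
  field. repeat split; auto.
Qed.

Lemma jtp_coef_rec_0 q n : Rabs q < 1 ->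
  jtp_coef q (S n) 0 = (1 + q ^ (4 * n + 2)) * jtp_coef q n 0 + 2 * q ^ (2 * n + 1) * jtp_coef q n 1.
Proof.
intros Hq. assert (Ht := sqr_lt_1 q Hq). 
assert (Q : forall m, qpoch (q ^ 2) m <> 0) by (intros m; assert (B := qpoch_bounds (q ^ 2) m Ht); lra).
assert (P : forall m, 1 - (q ^ 2) ^ S m <> 0) by (intros m; assert (B := pow_lt_1 (q ^ 2) m Ht); lra).
set (t := q ^ 2) in *.
assert (E1 : q ^ (4 * n + 2) = t ^ n * t ^ S n).
{ unfold t. rewrite <- pow_add, <- pow_mult. f_equal. lia. }
assert (C1 : jtp_coef q (S n) 0 = qpoch t (2 * n) * (1 - t ^ S (2 * n)) * (1 - t ^ S (S (2 * n))) /
    ((qpoch t n * (1 - t ^ S n)) * (qpoch t n * (1 - t ^ S n)))).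
{ unfold jtp_coef. destruct (le_dec 0 (S n)) as [_|]; [|lia]. fold t.
  replace (2 * S n)%nat with (S (S (2 * n))) by lia. rewrite Nat.add_0_r, Nat.sub_0_r. simpl (q ^ (0 * 0)). rewrite Rmult_1_r. reflexivity. }
assert (C2 : jtp_coef q n 0 = qpoch t (2 * n) / (qpoch t n * qpoch t n)).
{ unfold jtp_coef. destruct (le_dec 0 n) as [_|]; [|lia]. fold t.
  rewrite Nat.add_0_r, Nat.sub_0_r. simpl (q ^ (0 * 0)). now rewrite Rmult_1_r. }
assert (C3 : q ^ (2 * n + 1) * jtp_coef q n 1 = qpoch t (2 * n) * (1 - t ^ n) / (qpoch t n * (1 - t ^ S n) * qpoch t n) * t ^ S n).
{ unfold jtp_coef. destruct (le_dec 1 n) as [L|L]; fold t.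
  - destruct n as [|n]; [lia|]. replace (S n + 1)%nat with (S (S n)) by lia. replace (S n - 1)%nat with n by lia.
    replace (q ^ (1 * 1)) with q by (simpl; ring).
    replace (q ^ (2 * S n + 1)) with (q * t ^ S n) by (unfold t; rewrite <- pow_mult, tech_pow_Rmult; f_equal; lia).
    replace (t ^ S (S n)) with (t ^ S n * q * q) by (simpl; unfold t; ring).
    change (qpoch t (S (S n))) with (qpoch t n * (1 - t ^ S n) * (1 - t ^ S (S n))).
    change (qpoch t (S n)) with (qpoch t n * (1 - t ^ S n)).
    assert (P2 := P (S n)). replace (t ^ S (S n)) with (t ^ S n * q * q) in * by (simpl; unfold t; ring). field. repeat split; auto.
  - assert (n = 0)%nat by lia. subst n. simpl (t ^ 0). unfold Rdiv. ring. }
rewrite C1, C2, E1.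
transitivity ((1 + t ^ n * t ^ S n) * (qpoch t (2 * n) / (qpoch t n * qpoch t n)) + 2 * (q ^ (2 * n + 1) * jtp_coef q n 1)); [|ring].
rewrite C3.
replace (t ^ S (2 * n)) with (t ^ n * t ^ S n) by (rewrite <- pow_add; f_equal; lia).
replace (t ^ S (S (2 * n))) with (t * (t ^ n * t ^ S n)) by (rewrite <- pow_add; rewrite tech_pow_Rmult; f_equal; lia).
assert (P1 := P n). replace (t ^ S n) with (t * t ^ n) in * by reflexivity.
assert (Q1 := Q n).
set (v := t ^ n) in *. set (x := qpoch t (2 * n)) in *. set (y := qpoch t n) in *. clearbody x y v t.
field. repeat split; auto.
Qed.

Lemma finite_triple_product q n : Rabs q < 1 -> hsum (jtp_coef q n) n = odd_prod q n ^ 2.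
Proof.
intros Hq. induction n as [|n IH].
- simpl. unfold jtp_coef. simpl. field.
- assert (Z : forall k, (n < k)%nat -> jtp_coef q n k = 0) by (intros k Hk; unfold jtp_coef; destruct (le_dec k n); [lia|auto]).
  rewrite (hsum_recurrence (jtp_coef q n) _ (1 + q ^ (4 * n + 2)) (q ^ (2 * n + 1))).
  + rewrite !Z by lia. simpl hsum. rewrite Z, IH by lia. simpl odd_prod.
    replace (q ^ (4 * n + 2)) with (q ^ (2 * n + 1) * q ^ (2 * n + 1)) by (rewrite <- pow_add; f_equal; lia).
    replace (n + (n + 0) + 1)%nat with (2 * n + 1)%nat by lia. ring.
  + now apply jtp_coef_rec_0.
  + intros k Hk. now apply jtp_coef_rec_S.
Qed.

(** The two ratios [g1] and [g2] differ from 1 by at most q^(2(n-k+1)) / (1 - q^2), a poor estimate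
    for k near n. There the factor q^(k^2) compensates, since k^2 + 2(n - k + 1) >= 2n; the error is
    uniform in k. *)
Lemma jtp_coef_bound q n k : Rabs q < 1 -> (k <= n)%nat ->
  Rabs (q ^ (k * k) - qpoch (q ^ 2) n * jtp_coef q n k) <= 2 / (1 - q ^ 2) * (q ^ 2) ^ n.
Proof.
intros Hq Hk. assert (Ht := sqr_lt_1 q Hq).
unfold jtp_coef. destruct (le_dec k n) as [_|]; [|lia]. set (t := q ^ 2) in *.
assert (A := qpoch_ratio t (n + k) (n - k) Ht). replace (n + k + (n - k))%nat with (2 * n)%nat in A by lia.
assert (B := qpoch_ratio t (n - k) k Ht). replace (n - k + k)%nat with n in B by lia.
assert (Q1 := qpoch_bounds t (n + k) Ht). assert (Q2 := qpoch_bounds t (n - k) Ht).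
assert (Q3 := qpoch_bounds t (2 * n) Ht). assert (Q4 := qpoch_bounds t n Ht).
set (g1 := qpoch t (2 * n) / qpoch t (n + k)). set (g2 := qpoch t n / qpoch t (n - k)).
replace (q ^ (k * k) - qpoch t n * (qpoch t (2 * n) / (qpoch t (n + k) * qpoch t (n - k)) * q ^ (k * k))) with
  (q ^ (k * k) * (1 - g1 * g2)) by (unfold g1, g2; field; lra).
set (e := t ^ S (n - k) / (1 - t)).
assert (He : 0 <= e).
{ apply Rmult_le_pos; [apply pow_le; lra|]. left; apply Rinv_0_lt_compat; lra. }
assert (G1 : 1 - e <= g1 <= 1).
{ split.
  - apply Rle_trans with (1 - t ^ S (n + k) / (1 - t)).
    + apply Rplus_le_compat_l, Ropp_le_contravar. apply Rmult_le_compat_r; [left; apply Rinv_0_lt_compat; lra|].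
      replace (S (n + k)) with (S (n - k) + (2 * k))%nat by lia. rewrite pow_add.
      assert (P : t ^ (2 * k) <= 1) by (apply pow_le_1; lra).
      assert (P2 := pow_le t (S (n - k)) (proj1 Ht)). nra.
    + apply Rmult_le_reg_r with (qpoch t (n + k)); [lra|]. unfold g1, Rdiv. rewrite (Rmult_assoc (qpoch t (2 * n))), Rinv_l by lra. unfold Rdiv in A. lra.
  - apply Rmult_le_reg_r with (qpoch t (n + k)); [lra|]. unfold g1, Rdiv. rewrite Rmult_assoc, Rinv_l; lra. }
assert (G2 : 1 - e <= g2 <= 1).
{ split; (apply Rmult_le_reg_r with (qpoch t (n - k)); [lra|]; unfold g2; unfold Rdiv at 1; rewrite (Rmult_assoc (qpoch t n)), Rinv_l by lra).
  - unfold e. lra.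
  - lra. }
assert (P1 : 0 < g1) by (apply Rdiv_lt_0_compat; lra). assert (P2 : 0 < g2) by (apply Rdiv_lt_0_compat; lra).
rewrite Rabs_mult, (Rabs_pos_eq (1 - g1 * g2)) by nra.
apply Rle_trans with (Rabs (q ^ (k * k)) * (2 * e)).
- apply Rmult_le_compat_l; [apply Rabs_pos|]. nra.
- unfold e. replace (2 / (1 - t) * t ^ n) with (2 * (t ^ n / (1 - t))) by (field; lra).
  replace (Rabs (q ^ (k * k)) * (2 * (t ^ S (n - k) / (1 - t)))) with (2 * ((Rabs (q ^ (k * k)) * t ^ S (n - k)) / (1 - t))) by (field; lra).
  apply Rmult_le_compat_l; [lra|]. apply Rmult_le_compat_r; [left; apply Rinv_0_lt_compat; lra|].
  rewrite <- RPow_abs. unfold t. rewrite <- (pow2_abs q), <- !pow_mult, <- pow_add.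
  assert (E : exists j, (k * k + 2 * S (n - k) = 2 * n + j)%nat).
  { exists (k * k + 2 * S (n - k) - 2 * n)%nat. nia. }
  destruct E as [j ->]. rewrite pow_add.
  assert (P : Rabs q ^ j <= 1) by (apply pow_le_1; split; [apply Rabs_pos|lra]).
  assert (P3 := pow_le (Rabs q) (2 * n) (Rabs_pos q)). nra.
Qed.

Definition theta (q : R) : R := 1 + 2 * Series (fun n => q ^ (S n * S n)).

Lemma ex_series_theta q : Rabs q < 1 -> ex_series (fun n => q ^ (S n * S n)).
Proof.
intros Hq. apply (@ex_series_le R_AbsRing R_CompleteNormedModule) with (b := fun n => Rabs q ^ n).
- intros n. change (Rabs (q ^ (S n * S n)) <= Rabs q ^ n). rewrite <- RPow_abs.
  replace (S n * S n)%nat with (n + (n * n + n + 1))%nat by lia. rewrite pow_add.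
  assert (P : Rabs q ^ (n * n + n + 1) <= 1) by (apply pow_le_1; split; [apply Rabs_pos|lra]).
  assert (P3 := pow_le (Rabs q) n (Rabs_pos q)). nra.
- apply ex_series_geom. rewrite Rabs_Rabsolu; auto.
Qed.

Lemma sum_n_S_R (a : nat -> R) n : sum_n a (S n) = sum_n a n + a (S n).
Proof. rewrite sum_Sn. reflexivity. Qed.

Lemma hsum_theta_S q M : hsum (fun k => q ^ (k * k)) (S M) = 1 + 2 * sum_n (fun n => q ^ (S n * S n)) M.
Proof.
induction M as [|M IH].
- rewrite sum_O. simpl. ring.
- change (hsum (fun k => q ^ (k * k)) (S (S M))) with (hsum (fun k => q ^ (k * k)) (S M) + 2 * q ^ (S (S M) * S (S M))).
  rewrite IH, sum_n_S_R. ring.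
Qed.

Lemma is_lim_hsum_theta q : Rabs q < 1 -> is_lim_seq (hsum (fun k => q ^ (k * k))) (theta q).
Proof.
intros Hq. apply is_lim_seq_incr_1.
apply is_lim_seq_ext with (u := fun M => 1 + 2 * sum_n (fun n => q ^ (S n * S n)) M).
- intros n. now rewrite hsum_theta_S.
- apply is_lim_seq_plus'; [apply is_lim_seq_const|]. apply is_lim_seq_mult'; [apply is_lim_seq_const|].
  apply Series_correct. now apply ex_series_theta.
Qed.

Lemma is_lim_triple_product q : Rabs q < 1 ->
  is_lim_seq (fun n => qpoch (q ^ 2) n * odd_prod q n ^ 2) (theta q).
Proof.
intros Hq. assert (Ht := sqr_lt_1 q Hq). set (t := q ^ 2) in *.
set (K := 2 / (1 - t)).
assert (HK : 0 <= K) by (apply Rmult_le_pos; [lra|left; apply Rinv_0_lt_compat; lra]).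
(* With M = n, 2n + 1 entries are each off by at most K t^n, and the total still tends to 0. *)
assert (D : forall n M, (M <= n)%nat -> Rabs (hsum (fun k => q ^ (k * k)) M - qpoch t n * hsum (jtp_coef q n) M) <= (2 * INR M + 1) * (K * t ^ n)).
{ intros n M. induction M as [|M IH]; intros HM.
  - simpl hsum. simpl INR. assert (J := jtp_coef_bound q n 0 Hq HM). fold t K in J.
    replace ((2 * 0 + 1) * (K * t ^ n)) with (K * t ^ n) by ring. exact J.
  - assert (J := jtp_coef_bound q n (S M) Hq HM). fold t K in J. specialize (IH ltac:(lia)).
    change (hsum (fun k => q ^ (k * k)) (S M)) with (hsum (fun k => q ^ (k * k)) M + 2 * q ^ (S M * S M)).
    change (hsum (jtp_coef q n) (S M)) with (hsum (jtp_coef q n) M + 2 * jtp_coef q n (S M)).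
    rewrite S_INR.
    replace (hsum (fun k => q ^ (k * k)) M + 2 * q ^ (S M * S M) - qpoch t n * (hsum (jtp_coef q n) M + 2 * jtp_coef q n (S M))) with
     ((hsum (fun k => q ^ (k * k)) M - qpoch t n * hsum (jtp_coef q n) M) + 2 * (q ^ (S M * S M) - qpoch t n * jtp_coef q n (S M))) by ring.
    eapply Rle_trans; [apply Rabs_triang|]. rewrite (Rabs_mult 2), (Rabs_pos_eq 2) by lra. lra. }
assert (L0 : is_lim_seq (fun n => (2 * INR n + 1) * (K * t ^ n)) 0).
{ apply is_lim_seq_ext with (u := fun n => 2 * K * (INR n * t ^ n) + K * t ^ n); [intros n; ring|].
  replace (Finite 0) with (Finite (2 * K * 0 + K * 0)) by (f_equal; ring).
  apply is_lim_seq_plus'; (apply is_lim_seq_mult'; [apply is_lim_seq_const|]).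
  - apply ex_series_lim_0. now apply ex_series_linear_pow.
  - apply is_lim_seq_geom. rewrite Rabs_pos_eq; lra. }
assert (LH := is_lim_hsum_theta q Hq).
apply is_lim_seq_ext with (u := fun n => hsum (fun k => q ^ (k * k)) n - (hsum (fun k => q ^ (k * k)) n - qpoch t n * hsum (jtp_coef q n) n)).
- intros n. rewrite finite_triple_product by auto. ring.
- replace (Finite (theta q)) with (Finite (theta q - 0)) by (f_equal; ring).
  apply is_lim_seq_minus'; auto.
  apply is_lim_seq_abs_0. apply is_lim_seq_le_le with (u := fun _ => 0) (w := fun n => (2 * INR n + 1) * (K * t ^ n)); auto.
  + intros n. split; [apply Rabs_pos|]. now apply D.
  + apply is_lim_seq_const.
Qed.

Lemma pow_opp_odd (q : R) k : (- q) ^ (2 * k + 1) = - q ^ (2 * k + 1).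
Proof. rewrite !pow_add, !pow_mult. replace ((- q) ^ 2) with (q ^ 2) by ring. ring. Qed.

Definition logChi (q : R) : R := Series (fun k => ln (1 + q ^ (2 * k + 1))).

Lemma Rabs_pow_odd_le q k : Rabs q < 1 -> Rabs (q ^ (2 * k + 1)) <= Rabs q * Rabs q ^ k.
Proof.
intros Hq. rewrite <- RPow_abs. replace (2 * k + 1)%nat with (S k + k)%nat by lia. rewrite pow_add. simpl (Rabs q ^ S k).
assert (P : Rabs q ^ k <= 1) by (apply pow_le_1; split; [apply Rabs_pos|lra]).
assert (P3 := pow_le (Rabs q) k (Rabs_pos q)). assert (A := Rabs_pos q). rewrite <- (Rmult_1_r (Rabs q * Rabs q ^ k)) at 2. apply Rmult_le_compat_l; auto. now apply Rmult_le_pos.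
Qed.

Lemma Rabs_ln_1_plus s r : Rabs s <= r -> r < 1 -> Rabs (ln (1 + s)) <= Rabs s / (1 - r).
Proof.
intros Hs Hr. assert (B := Rabs_le_between s r). apply B in Hs as Hs'.
assert (E1 := exp_ineq1_le (ln (1 + s))). rewrite exp_ln in E1 by lra.
assert (E2 := exp_ineq1_le (- ln (1 + s))). rewrite exp_Ropp, exp_ln in E2 by lra.
assert (A := Rabs_pos s). 
assert (I : / (1 + s) - 1 = - s / (1 + s)) by (field; lra).
assert (J : - s / (1 + s) <= Rabs s / (1 - r)).
{ apply Rle_trans with (Rabs s / (1 + s)).
  - apply Rmult_le_compat_r; [left; apply Rinv_0_lt_compat; lra|]. rewrite <- Rabs_Ropp. apply Rle_abs.
  - apply Rmult_le_compat_l; auto. apply Rinv_le_contravar; lra. }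
assert (J2 : Rabs s <= Rabs s / (1 - r)).
{ rewrite <- (Rmult_1_r (Rabs s)) at 1. apply Rmult_le_compat_l; auto. rewrite <- Rinv_1. apply Rinv_le_contravar; lra. }
assert (A2 := Rle_abs s). apply Rabs_le. lra.
Qed.

Lemma logChi_term_bound q k : Rabs q < 1 -> Rabs (ln (1 + q ^ (2 * k + 1))) <= Rabs q / (1 - Rabs q) * Rabs q ^ k.
Proof.
intros Hq. assert (B := Rabs_pow_odd_le q k Hq). assert (A := Rabs_pos q).
assert (P : Rabs q ^ k <= 1) by (apply pow_le_1; lra).
eapply Rle_trans; [apply (Rabs_ln_1_plus _ (Rabs q)); [nra|auto]|].
replace (Rabs q / (1 - Rabs q) * Rabs q ^ k) with (Rabs q * Rabs q ^ k / (1 - Rabs q)) by (field; lra).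
apply Rmult_le_compat_r; auto. left; apply Rinv_0_lt_compat; lra.
Qed.

Lemma ex_series_logChi q : Rabs q < 1 -> ex_series (fun k => ln (1 + q ^ (2 * k + 1))).
Proof.
intros Hq. apply (@ex_series_le R_AbsRing R_CompleteNormedModule) with (b := fun k => Rabs q / (1 - Rabs q) * Rabs q ^ k).
- intros n. now apply logChi_term_bound.
- apply (ex_series_scal_l _ (fun k => Rabs q ^ k)). apply ex_series_geom. rewrite Rabs_Rabsolu; auto.
Qed.

Lemma logChi_bound q : Rabs q < 1 -> Rabs (logChi q) <= Rabs q / (1 - Rabs q) ^ 2.
Proof.
intros Hq.
assert (E : ex_series (fun k => Rabs q / (1 - Rabs q) * Rabs q ^ k)).
{ apply (ex_series_scal_l _ (fun k => Rabs q ^ k)). apply ex_series_geom. rewrite Rabs_Rabsolu; auto. }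
assert (E2 : ex_series (fun k => Rabs (ln (1 + q ^ (2 * k + 1))))).
{ apply ex_series_pos_le with (2 := E). intros k. split; [apply Rabs_pos|now apply logChi_term_bound]. }
eapply Rle_trans; [apply Series_Rabs; exact E2|].
eapply Rle_trans; [apply Series_le; [|exact E]|].
- intros k. split; [apply Rabs_pos|now apply logChi_term_bound].
- rewrite Series_scal_l, Series_geom by (rewrite Rabs_Rabsolu; auto). right. field. lra.
Qed.

Lemma one_plus_odd_pow_pos q k : Rabs q < 1 -> 0 < 1 + q ^ (2 * k + 1).
Proof.
intros Hq. assert (B := Rabs_pow_odd_le q k Hq).
assert (P : Rabs q ^ k <= 1) by (apply pow_le_1; split; [apply Rabs_pos|lra]).
assert (A := Rabs_pos q). assert (C : Rabs (q ^ (2 * k + 1)) < 1) by nra. apply Rabs_def2 in C. lra.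
Qed.

Lemma is_lim_odd_prod q : Rabs q < 1 -> is_lim_seq (odd_prod q) (exp (logChi q)).
Proof.
intros Hq. apply is_lim_seq_incr_1.
apply is_lim_seq_ext with (u := fun n => exp (sum_n (fun k => ln (1 + q ^ (2 * k + 1))) n)).
- intros n. induction n as [|n IH].
  + rewrite sum_O, exp_ln by now apply one_plus_odd_pow_pos. simpl; ring.
  + rewrite sum_n_S_R, exp_plus, IH, exp_ln by now apply one_plus_odd_pow_pos. reflexivity.
- apply is_lim_seq_continuous.
  + apply derivable_continuous_pt, derivable_pt_exp.
  + apply Series_correct. now apply ex_series_logChi.
Qed.

(** The triple product factor (q^2; q^2)_n depends only on q^2. It is common to q and -q, so its
    limit [e] cancels without being evaluated. *)
Lemma theta_ratio q : 0 < q < 1 ->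
  0 < theta q /\ theta (- q) = theta q * exp (2 * (logChi (- q) - logChi q)).
Proof.
intros Hq. assert (Ha : Rabs q < 1) by (rewrite Rabs_pos_eq; lra).
assert (Hb : Rabs (- q) < 1) by (rewrite Rabs_Ropp; auto).
assert (Ht := sqr_lt_1 q Ha).
assert (E : exists e : R, is_lim_seq (qpoch (q ^ 2)) e).
{ destruct (ex_finite_lim_seq_decr (qpoch (q ^ 2)) 0) as [e He].
  - intros n. assert (B := qpoch_ratio (q ^ 2) n 1 Ht). rewrite Nat.add_1_r in B. apply B.
  - intros n. left; apply qpoch_bounds; auto.
  - now exists e. }
destruct E as [e He].
assert (V : forall p, Rabs p < 1 -> p ^ 2 = q ^ 2 -> theta p = e * exp (2 * logChi p)).
{ intros p Hp E. assert (L := is_lim_triple_product p Hp). rewrite E in L.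
  assert (L2 : is_lim_seq (fun n => qpoch (q ^ 2) n * odd_prod p n ^ 2) (e * (exp (logChi p) * (exp (logChi p) * 1)))).
  { apply is_lim_seq_mult'; auto. apply is_lim_seq_mult'; [now apply is_lim_odd_prod|].
    apply is_lim_seq_mult'; [now apply is_lim_odd_prod|apply is_lim_seq_const]. }
  apply is_lim_seq_unique in L. apply is_lim_seq_unique in L2. rewrite L in L2. injection L2 as ->.
  replace (2 * logChi p) with (logChi p + logChi p) by ring. rewrite exp_plus. ring. }
assert (Hpos : 0 < theta q).
{ unfold theta. assert (0 <= Series (fun n => q ^ (S n * S n))); [|lra].
  apply Series_nonneg; [|now apply ex_series_theta]. intros n. apply pow_le; lra. }
split; auto.
rewrite (V (- q)), (V q) by (auto; ring). rewrite Rmult_assoc, <- exp_plus. f_equal. f_equal. ring.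
Qed.

(** Termwise, 1 - q^(2m) = (1 + q^m)(1 - q^m) with m odd. The argument on the left is -(q^2). *)
Lemma logChi_sqr q : 0 < q < 1 -> logChi (- q ^ 2) = logChi q + logChi (- q).
Proof.
intros Hq. assert (Ha : Rabs q < 1) by (rewrite Rabs_pos_eq; lra).
assert (Hb : Rabs (- q) < 1) by (rewrite Rabs_Ropp; auto).
unfold logChi. rewrite <- Series_plus by (apply ex_series_logChi; auto).
apply Series_ext. intros k. rewrite <- ln_mult by (apply one_plus_odd_pow_pos; auto). f_equal.
rewrite !pow_opp_odd, <- pow_mult. replace (2 * (2 * k + 1))%nat with ((2 * k + 1) + (2 * k + 1))%nat by lia. rewrite pow_add. ring.
Qed.

(** * Finite lattice sums and the theta identities *)

Fixpoint lsum {A : Type} (f : A -> R) (l : list A) : R :=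
  match l with nil => 0 | x :: r => f x + lsum f r end.

Lemma lsum_app {A} (f : A -> R) l1 l2 : lsum f (l1 ++ l2) = lsum f l1 + lsum f l2.
Proof. induction l1 as [|x l IH]; simpl; [ring|rewrite IH; ring]. Qed.

Lemma lsum_map {A B} (g : B -> R) (f : A -> B) l : lsum g (map f l) = lsum (fun x => g (f x)) l.
Proof. induction l as [|x l IH]; simpl; [|rewrite IH]; reflexivity. Qed.

Lemma lsum_ext {A} (f g : A -> R) l : (forall x, In x l -> f x = g x) -> lsum f l = lsum g l.
Proof.
intros H. induction l as [|x l IH]; simpl; auto. rewrite IH, H; auto; [now left|]. intros y Hy. apply H. now right.
Qed.

Lemma lsum_scal {A} c (f : A -> R) l : lsum (fun x => c * f x) l = c * lsum f l.
Proof. induction l as [|x l IH]; simpl; [|rewrite IH]; ring. Qed.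

Lemma lsum_plus {A} (f g : A -> R) l : lsum (fun x => f x + g x) l = lsum f l + lsum g l.
Proof. induction l as [|x l IH]; simpl; [|rewrite IH]; ring. Qed.

Lemma lsum_prod {A B} (f : A -> R) (g : B -> R) l1 l2 :
  lsum (fun p => f (fst p) * g (snd p)) (list_prod l1 l2) = lsum f l1 * lsum g l2.
Proof.
induction l1 as [|x l IH]; simpl; [ring|].
rewrite lsum_app, lsum_map, IH. simpl. rewrite lsum_scal. ring.
Qed.

Lemma lsum_filter {A} (p : A -> bool) (f : A -> R) l :
  lsum f (filter p l) = lsum (fun x => if p x then f x else 0) l.
Proof. induction l as [|x l IH]; simpl; auto. destruct (p x); simpl; rewrite IH; ring. Qed.

Lemma lsum_le_injection {A B} (phi : A -> B) (g : B -> R) l1 : forall l2,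
  NoDup l1 -> (forall x, In x l1 -> In (phi x) l2) ->
  (forall x y, In x l1 -> In y l1 -> phi x = phi y -> x = y) -> (forall b, 0 <= g b) ->
  lsum (fun x => g (phi x)) l1 <= lsum g l2.
Proof.
induction l1 as [|x l IH]; intros l2 ND Hin Hinj Hg; simpl.
- induction l2 as [|b l2 IH2]; simpl; [lra|]. assert (H := Hg b). apply Rle_trans with (lsum g l2); [|lra].
  apply IH2. intros y [].
- destruct (in_split _ _ (Hin x (or_introl eq_refl))) as [a [b E]]. rewrite E, lsum_app. simpl.
  inversion ND as [|x' l' Hx ND']; subst x' l'.
  assert (L : lsum (fun x => g (phi x)) l <= lsum g (a ++ b)).
  { apply IH; auto.
    - intros y Hy. assert (Hy2 := Hin y (or_intror Hy)). rewrite E in Hy2.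
      apply in_app_or in Hy2. apply in_or_app. destruct Hy2 as [?|[Hy2|?]]; auto.
      exfalso. apply Hx. rewrite (Hinj x y); auto; [now left|now right].
    - intros y z Hy Hz. apply Hinj; now right. }
  rewrite lsum_app in L. lra.
Qed.

Lemma NoDup_prod {A B} (l1 : list A) (l2 : list B) : NoDup l1 -> NoDup l2 -> NoDup (list_prod l1 l2).
Proof.
intros H1 H2. induction H1 as [|x l Hx H1 IH]; simpl; [constructor|].
apply NoDup_app; auto.
- apply FinFun.Injective_map_NoDup; auto. intros a b E. now injection E.
- intros [a b] Ha Hb. apply in_map_iff in Ha. destruct Ha as [c [E _]]. injection E as <- <-.
  apply in_prod_iff in Hb. now apply Hx.
Qed.

Fixpoint zrange (N : nat) : list Z :=
  match N with
  | O => 0%Z :: nil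
  | S M => Z.of_nat (S M) :: (- Z.of_nat (S M))%Z :: zrange M
  end.

Lemma In_zrange N m : In m (zrange N) <-> (Z.abs m <= Z.of_nat N)%Z.
Proof.
induction N as [|N IH].
- simpl. split; [intros [<-|[]]; simpl; lia|]. intros H. left. lia.
- change (In m (zrange (S N))) with (Z.of_nat (S N) = m \/ (- Z.of_nat (S N))%Z = m \/ In m (zrange N)).
  rewrite IH. lia.
Qed.

Lemma NoDup_zrange N : NoDup (zrange N).
Proof.
induction N as [|N IH]; simpl zrange; [constructor; [intros []|constructor]|].
constructor; [|constructor; auto].
- intros [H|H]; [lia|]. apply In_zrange in H. lia.
- intros H. apply In_zrange in H. lia.
Qed.

Lemma lsum_zrange q N : lsum (fun m => q ^ Z.to_nat (m * m)) (zrange N) = hsum (fun k => q ^ (k * k)) N.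
Proof.
assert (E : forall k, Z.to_nat (Z.of_nat k * Z.of_nat k) = (k * k)%nat) by (intros; rewrite <- Nat2Z.inj_mul; apply Nat2Z.id).
induction N as [|N IH]; [simpl; ring|].
change (lsum (fun m => q ^ Z.to_nat (m * m)) (zrange (S N))) with
 (q ^ Z.to_nat (Z.of_nat (S N) * Z.of_nat (S N)) + (q ^ Z.to_nat (- Z.of_nat (S N) * - Z.of_nat (S N)) +
   lsum (fun m => q ^ Z.to_nat (m * m)) (zrange N))).
rewrite IH. replace (- Z.of_nat (S N) * - Z.of_nat (S N))%Z with (Z.of_nat (S N) * Z.of_nat (S N))%Z by ring.
rewrite E. change (hsum (fun k => q ^ (k * k)) (S N)) with (hsum (fun k => q ^ (k * k)) N + 2 * q ^ (S N * S N)). ring.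
Qed.

Lemma pow_to_nat_add q (a b : Z) : (0 <= a)%Z -> (0 <= b)%Z -> q ^ Z.to_nat a * q ^ Z.to_nat b = q ^ Z.to_nat (a + b).
Proof. intros Ha Hb. now rewrite Z2Nat.inj_add, pow_add. Qed.

Lemma pow_opp_to_nat q (a : Z) : (0 <= a)%Z -> (- q) ^ Z.to_nat a = (if Z.even a then 1 else -1) * q ^ Z.to_nat a.
Proof.
intros Ha. destruct (Z.even a) eqn:E.
- apply Z.even_spec in E. destruct E as [b ->]. rewrite Z2Nat.inj_mul, !pow_mult by lia. change (Z.to_nat 2) with 2%nat.
  replace ((- q) ^ 2) with (q ^ 2) by ring. ring.
- assert (O : Z.odd a = true) by (rewrite <- Z.negb_even, E; reflexivity). apply Z.odd_spec in O. destruct O as [b ->].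
  rewrite Z2Nat.inj_add, Z2Nat.inj_mul, !pow_add, !pow_mult by lia. change (Z.to_nat 2) with 2%nat. change (Z.to_nat 1) with 1%nat.
  replace ((- q) ^ 2) with (q ^ 2) by ring. ring.
Qed.

(* Rotating the lattice by 45 degrees: (s, t) |-> (s + t, s - t) maps Z^2 onto the pairs of equal parity.
   Boxes are not preserved, so the finite sums are only sandwiched. *)
Lemma theta_sqr_add q : 0 < q < 1 -> theta q ^ 2 + theta (- q) ^ 2 = 2 * theta (q ^ 2) ^ 2.
Proof.
intros Hq.
set (box := fun N => list_prod (zrange N) (zrange N)).
set (ev := fun p : Z * Z => Z.even (fst p * fst p + snd p * snd p)).
set (G := fun p : Z * Z => q ^ Z.to_nat (fst p * fst p + snd p * snd p)).
set (phi := fun p : Z * Z => ((fst p + snd p)%Z, (fst p - snd p)%Z)).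
(* Inverse of [phi] on pairs of equal parity, where both divisions are exact. *)
set (psi := fun p : Z * Z => (((fst p + snd p) / 2)%Z, ((fst p - snd p) / 2)%Z)).
set (th := fun q N => hsum (fun k => q ^ (k * k)) N).
set (Ev := fun N => lsum G (filter ev (box N))).
set (D := fun N => lsum (fun p => G (phi p)) (box N)).
assert (HG : forall p, 0 <= G p) by (intros; apply pow_le; lra).
assert (Inb : forall N p, In p (box N) <-> (Z.abs (fst p) <= Z.of_nat N)%Z /\ (Z.abs (snd p) <= Z.of_nat N)%Z).
{ intros N [a b]. unfold box. rewrite in_prod_iff, !In_zrange. reflexivity. }
assert (NDb : forall N, NoDup (box N)) by (intros; apply NoDup_prod; apply NoDup_zrange).
assert (Hev : forall p, ev p = true -> phi (psi p) = p).
{ intros [m n] H. unfold ev in H. simpl fst in H. simpl snd in H. apply Z.even_spec in H. destruct H as [c Hc].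
  assert (E : exists d, (m + n = 2 * d)%Z).
  (* Since m^2 + n^2 and (m + n)^2 have the same parity, evenness of the sum of squares means that m
     and n have equal parity. *)
  { destruct (Z.Even_or_Odd (m + n)) as [E|[d E]]; [exact E|]. exfalso.
    assert (X : ((m + n) * (m + n) = 2 * (c + m * n))%Z) by (rewrite Z.mul_add_distr_l, !Z.mul_add_distr_r; lia).
    rewrite E in X. lia. }
  destruct E as [d E]. unfold phi, psi. simpl fst. simpl snd.
  rewrite E. replace (m - n)%Z with (2 * (d - n))%Z by lia.
  rewrite !(Z.mul_comm 2), !Z.div_mul by lia. f_equal; lia. }
assert (E1 : forall N, th q N ^ 2 + th (- q) N ^ 2 = 2 * Ev N).
{ intros N. unfold th, Ev. rewrite <- !lsum_zrange. simpl (_ ^ 2). rewrite !Rmult_1_r, <- !lsum_prod, <- lsum_plus.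
  rewrite lsum_filter, <- lsum_scal. apply lsum_ext. intros [m n] _. unfold ev, G. simpl fst. simpl snd.
  rewrite !pow_to_nat_add by nia. rewrite pow_opp_to_nat by nia. destruct (Z.even (m * m + n * n)); ring. }
assert (E2 : forall N, th (q ^ 2) N ^ 2 = D N).
{ intros N. unfold th, D. rewrite <- !lsum_zrange. 
  replace (lsum (fun m => (q ^ 2) ^ Z.to_nat (m * m)) (zrange N) ^ 2) with
    (lsum (fun m => (q ^ 2) ^ Z.to_nat (m * m)) (zrange N) * lsum (fun m => (q ^ 2) ^ Z.to_nat (m * m)) (zrange N)) by ring.
  rewrite <- lsum_prod.
  apply lsum_ext. intros [s t] _. unfold G, phi. simpl fst. simpl snd.
  rewrite pow_to_nat_add by nia. rewrite <- pow_mult. f_equal.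
  replace ((s + t) * (s + t) + (s - t) * (s - t))%Z with (2 * (s * s + t * t))%Z by ring.
  rewrite Z2Nat.inj_mul by nia. reflexivity. }
assert (I1 : forall N, D N <= Ev (2 * N)%nat).
{ intros N. apply lsum_le_injection; auto.
  - intros [s t] H. apply Inb in H. simpl fst in H. simpl snd in H. apply filter_In. split.
    + apply Inb. unfold phi. simpl fst. simpl snd. lia.
    + unfold ev, phi. simpl fst. simpl snd. apply Z.even_spec. exists (s * s + t * t)%Z. ring.
  - intros [s t] [s' t'] _ _ E. unfold phi in E. simpl in E. injection E as A B. f_equal; lia. }
assert (I2 : forall N, Ev N <= D N).
{ intros N. unfold Ev, D. rewrite (lsum_ext G (fun p => G (phi (psi p)))).
  - apply (lsum_le_injection psi (fun p => G (phi p))); auto.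
    + now apply NoDup_filter.
    + intros [m n] H. apply filter_In in H. destruct H as [H _]. apply Inb in H. apply Inb. unfold psi. simpl fst in *. simpl snd in *.
      assert (A := Z.mod_pos_bound (m + n) 2 ltac:(lia)). assert (B := Z.div_mod (m + n) 2 ltac:(lia)).
      assert (A' := Z.mod_pos_bound (m - n) 2 ltac:(lia)). assert (B' := Z.div_mod (m - n) 2 ltac:(lia)). lia.
    + intros x y Hx Hy E. apply filter_In in Hx. apply filter_In in Hy.
      rewrite <- (Hev x), <- (Hev y) by tauto. now rewrite E.
  - intros p Hp. apply filter_In in Hp. now rewrite Hev. }
assert (Ha : Rabs q < 1) by (rewrite Rabs_pos_eq; lra). assert (Hb : Rabs (- q) < 1) by now rewrite Rabs_Ropp.
assert (Hc : Rabs (q ^ 2) < 1) by (rewrite Rabs_pos_eq by apply pow2_ge_0; nra).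
assert (Lsq : forall p, Rabs p < 1 -> is_lim_seq (fun N => th p N ^ 2) (theta p ^ 2)).
{ intros p Hp. simpl (_ ^ 2). assert (L := is_lim_hsum_theta p Hp).
  apply is_lim_seq_mult'; [exact L|]. apply is_lim_seq_mult'; [exact L|apply is_lim_seq_const]. }
assert (LE : is_lim_seq (fun N => th q N ^ 2 + th (- q) N ^ 2) (theta q ^ 2 + theta (- q) ^ 2)).
{ apply is_lim_seq_plus'; auto. }
assert (LD : is_lim_seq (fun N => 2 * th (q ^ 2) N ^ 2) (2 * theta (q ^ 2) ^ 2)).
{ apply is_lim_seq_mult'; [apply is_lim_seq_const|auto]. }
apply Rle_antisym.
- apply (is_lim_seq_le _ _ (Finite _) (Finite _)) with (2 := LE) (3 := LD). intros N. rewrite E1, E2. specialize (I2 N). lra.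
(* The rotation sends the box of size N into the box of size 2N, so this direction compares with the
   subsequence of even sizes. *)
- assert (LE2 : is_lim_seq (fun N => th q (2 * N)%nat ^ 2 + th (- q) (2 * N)%nat ^ 2) (theta q ^ 2 + theta (- q) ^ 2)).
  { apply (is_lim_seq_subseq (fun N => th q N ^ 2 + th (- q) N ^ 2) _ (fun N => (2 * N)%nat)); auto.
    apply eventually_subseq. intros n. lia. }
  apply (is_lim_seq_le _ _ (Finite _) (Finite _)) with (2 := LD) (3 := LE2). intros N. rewrite E1, E2. specialize (I1 N). lra.
Qed.

(** Odd squares cancel, and the even index 2j contributes q^(4 j^2). *)
Lemma theta_add q : 0 < q < 1 -> theta q + theta (- q) = 2 * theta (q ^ 4).
Proof.
intros Hq.
assert (Ha : Rabs q < 1) by (rewrite Rabs_pos_eq; lra). assert (Hb : Rabs (- q) < 1) by now rewrite Rabs_Ropp.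
assert (Hc : Rabs (q ^ 4) < 1).
{ assert (P := pow_lt_1 q 3 ltac:(lra)). rewrite Rabs_pos_eq; auto. apply pow_le; lra. }
assert (E : forall N, hsum (fun k => q ^ (k * k)) (2 * N) + hsum (fun k => (- q) ^ (k * k)) (2 * N) = 2 * hsum (fun k => (q ^ 4) ^ (k * k)) N).
{ intros N. induction N as [|N IH]; [simpl; ring|].
  replace (2 * S N)%nat with (S (S (2 * N))) by lia.
  change (hsum (fun k => q ^ (k * k)) (S (S (2 * N)))) with (hsum (fun k => q ^ (k * k)) (2 * N) + 2 * q ^ (S (2 * N) * S (2 * N)) + 2 * q ^ (S (S (2 * N)) * S (S (2 * N)))).
  change (hsum (fun k => (- q) ^ (k * k)) (S (S (2 * N)))) with (hsum (fun k => (- q) ^ (k * k)) (2 * N) + 2 * (- q) ^ (S (2 * N) * S (2 * N)) + 2 * (- q) ^ (S (S (2 * N)) * S (S (2 * N)))).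
  change (hsum (fun k => (q ^ 4) ^ (k * k)) (S N)) with (hsum (fun k => (q ^ 4) ^ (k * k)) N + 2 * (q ^ 4) ^ (S N * S N)).
  assert (A : (- q) ^ (S (2 * N) * S (2 * N)) = - q ^ (S (2 * N) * S (2 * N))).
  { replace (S (2 * N) * S (2 * N))%nat with (1 + 2 * (2 * N * N + 2 * N))%nat by lia. rewrite !pow_add, !pow_mult.
    replace ((- q) ^ 2) with (q ^ 2) by ring. ring. }
  assert (B : forall p : R, p ^ (S (S (2 * N)) * S (S (2 * N))) = (p ^ 4) ^ (S N * S N)).
  { intros p. rewrite <- pow_mult. f_equal. lia. }
  rewrite A, !B. replace ((- q) ^ 4) with (q ^ 4) by ring. lra. }
assert (Sub : forall u l, is_lim_seq u l -> is_lim_seq (fun N => u (2 * N)%nat) l).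
{ intros u l Hu. apply (is_lim_seq_subseq u _ (fun N => (2 * N)%nat)); auto. apply eventually_subseq. intros n. lia. }
assert (L1 : is_lim_seq (fun N => hsum (fun k => q ^ (k * k)) (2 * N) + hsum (fun k => (- q) ^ (k * k)) (2 * N)) (theta q + theta (- q))).
{ apply is_lim_seq_plus'; (apply (Sub (hsum _))); now apply is_lim_hsum_theta. }
assert (L2 : is_lim_seq (fun N => 2 * hsum (fun k => (q ^ 4) ^ (k * k)) N) (2 * theta (q ^ 4))).
{ apply is_lim_seq_mult'; [apply is_lim_seq_const|]. now apply is_lim_hsum_theta. }
apply is_lim_seq_unique in L2. apply (is_lim_seq_ext _ _ _ E) in L1. apply is_lim_seq_unique in L1.
rewrite L1 in L2. now injection L2.
Qed.

(** * The modulus as a function of the nome *)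

(* The complementary modulus k' = (theta(-q) / theta(q))^2, through its product expansion. *)
Definition comod (q : R) : R := exp (4 * (logChi (- q) - logChi q)).
Definition modX (q : R) : R := 1 - comod q ^ 2.

Lemma comod_pos q : 0 < comod q. Proof. apply exp_pos. Qed.

(** Landen's rule for k': theta(q^4) and theta(q^2) are eliminated from the theta identities at q
    and q^2, leaving only the ratios theta(-q) / theta(q) and theta(-q^2) / theta(q^2). *)
Lemma comod_sqr q : 0 < q < 1 -> comod (q ^ 2) ^ 2 = 4 * comod q / (1 + comod q) ^ 2.
Proof.
intros Hq. assert (Hq2 : 0 < q ^ 2 < 1) by nra.
assert (V : forall p, 0 < p < 1 -> 0 < theta p /\ exists r, 0 < r /\ theta (- p) = theta p * r /\ comod p = r ^ 2).
{ intros p Hp. destruct (theta_ratio p Hp) as [A B]. split; auto. exists (exp (2 * (logChi (- p) - logChi p))).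
  split; [apply exp_pos|]. split; auto. unfold comod. simpl. rewrite Rmult_1_r, <- exp_plus. f_equal. ring. }
destruct (V q Hq) as [A0 [r [R0 [A1 A2]]]]. destruct (V (q ^ 2) Hq2) as [B0 [s [S0 [B1 B2]]]].
assert (E1 := theta_sqr_add q Hq). assert (E2 := theta_sqr_add (q ^ 2) Hq2). assert (E3 := theta_add q Hq).
replace ((q ^ 2) ^ 2) with (q ^ 4) in E2 by ring.
rewrite A2, B2. rewrite A1 in E1, E3. rewrite B1 in E2.
set (a := theta q) in *. set (b := theta (q ^ 2)) in *. set (c := theta (q ^ 4)) in *.
(* r^2 = k' at q, s^2 = k' at q^2 *)
assert (F1 : b ^ 2 = a ^ 2 * (1 + r ^ 2) / 2) by lra.
assert (F2 : b ^ 2 * s ^ 2 = a ^ 2 * r).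
{ assert (c ^ 2 = (a * (1 + r) / 2) ^ 2) by (replace (a * (1 + r) / 2) with c by lra; ring). lra. }
assert (F3 : s ^ 2 = 2 * r / (1 + r ^ 2)).
{ apply Rmult_eq_reg_l with (b ^ 2); [|apply pow_nonzero; lra]. rewrite F2, F1. field. nra. }
rewrite F3. field. nra.
Qed.

(** Below, the k-th term of the difference is at least q^(2k+1), so the first one alone gives q.
    Above, the two estimates of [logChi_bound] are added. *)
Lemma logChi_gap q : 0 < q < 1 -> q <= logChi q - logChi (- q) <= 2 * q / (1 - q) ^ 2.
Proof.
intros Hq. assert (Ha : Rabs q < 1) by (rewrite Rabs_pos_eq; lra).
assert (Hb : Rabs (- q) < 1) by (rewrite Rabs_Ropp; auto).
assert (B1 := logChi_bound q Ha). assert (B2 := logChi_bound (- q) Hb). rewrite Rabs_Ropp in B2. rewrite (Rabs_pos_eq q) in B1, B2 by lra.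
apply Rabs_le_between in B1. apply Rabs_le_between in B2. unfold Rdiv in *.
split; [|lra].
unfold logChi. rewrite <- Series_minus by (apply ex_series_logChi; auto).
assert (T : forall k, q ^ (2 * k + 1) <= ln (1 + q ^ (2 * k + 1)) - ln (1 + (- q) ^ (2 * k + 1))).
{ intros k. rewrite pow_opp_odd. assert (P := pow_lt q (2 * k + 1) ltac:(lra)).
  assert (P1 := one_plus_odd_pow_pos (- q) k Hb). rewrite pow_opp_odd in P1. set (s := q ^ (2 * k + 1)) in *.
  assert (L1 : 0 <= ln (1 + s)) by (rewrite <- ln_1; apply ln_le; lra).
  assert (L2 := exp_ineq1_le (ln (1 + - s))). rewrite exp_ln in L2 by lra. lra. }
eapply Rle_trans; [|apply Series_ge_first].
- eapply Rle_trans; [|apply (T O)]. simpl. lra.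
- intros k. eapply Rle_trans; [|apply T]. apply pow_le; lra.
- apply (ex_series_minus (V := R_NormedModule) (fun k => ln (1 + q ^ (2 * k + 1))) (fun k => ln (1 + (- q) ^ (2 * k + 1)))); apply ex_series_logChi; auto.
Qed.

Lemma comod_lt_1 q : 0 < q < 1 -> comod q < 1.
Proof. intros Hq. assert (G := logChi_gap q Hq). rewrite <- exp_0. apply exp_increasing. lra. Qed.

Lemma ln_1m_modX q : ln (1 - modX q) = 8 * (logChi (- q) - logChi q).
Proof.
unfold modX. replace (1 - (1 - comod q ^ 2)) with (comod q ^ 2) by ring.
rewrite ln_pow by apply comod_pos. unfold comod. rewrite ln_exp. simpl. ring.
Qed.

Lemma modX_range q : 0 < q < 1 -> 0 < modX q < 1.
Proof. intros Hq. assert (A := comod_pos q). assert (B := comod_lt_1 q Hq). unfold modX. nra. Qed.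

Lemma modX_landen q : 0 < q < 1 ->
  let l := (1 - comod q) / (1 + comod q) in 0 < l < 1 /\ modX (q ^ 2) = l ^ 2 /\ modX q = landen l.
Proof.
intros Hq l. assert (A := comod_pos q). assert (B := comod_lt_1 q Hq). unfold l. split; [|split].
- split; [apply Rdiv_lt_0_compat; lra|]. apply Rmult_lt_reg_r with (1 + comod q); [lra|].
  unfold Rdiv. rewrite Rmult_assoc, Rinv_l; lra.
- unfold modX. rewrite comod_sqr by auto. field. lra.
- unfold modX, landen. field. lra.
Qed.

(** Two-sided control of X(q) / q near 0, sufficient for the doubling argument. The range is chosen
    so that 64 q <= 1/2, where [nomeL_bound] applies. *)
Lemma modX_bounds q : 0 < q <= / 128 -> q <= modX q <= 64 * q.
Proof.
intros Hq. assert (G := logChi_gap q ltac:(lra)). set (mu := logChi q - logChi (- q)) in *.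
assert (E : modX q = 1 - exp (- (8 * mu))).
{ unfold modX, comod. simpl. rewrite Rmult_1_r, <- exp_plus. f_equal. f_equal. unfold mu. ring. }
assert (I1 := exp_ineq1_le (- (8 * mu))). assert (I2 := exp_ineq1_le (8 * mu)).
assert (Hmu : mu <= 8 * q).
{ eapply Rle_trans; [apply G|]. apply Rmult_le_reg_r with ((1 - q) ^ 2); [apply pow_lt; lra|].
  unfold Rdiv. rewrite Rmult_assoc, Rinv_l by (apply pow_nonzero; lra). nra. }
split; [|lra].
assert (I3 : exp (- (8 * mu)) <= / (1 + 8 * mu)).
{ rewrite exp_Ropp. apply Rinv_le_contravar; lra. }
assert (I4 : / (1 + 8 * mu) <= / (1 + 8 * q)) by (apply Rinv_le_contravar; lra).
assert (I5 : / (1 + 8 * q) = 1 - 8 * q / (1 + 8 * q)) by (field; lra).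
assert (I6 : q <= 8 * q / (1 + 8 * q)); [|lra].
apply Rmult_le_reg_r with (1 + 8 * q); [lra|]. unfold Rdiv. rewrite Rmult_assoc, Rinv_l by lra. nra.
Qed.

(** The values 2^n f(q) = f(q^(2^n)) are eventually bounded by c, because q^(2^n) drops below q0;
    hence f(q) = 0. *)
Lemma doubling_zero (f : R -> R) (c q0 : R) : 0 < q0 ->
  (forall q, 0 < q < 1 -> f (q ^ 2) = 2 * f q) ->
  (forall q, 0 < q <= q0 -> Rabs (f q) <= c) ->
  forall q, 0 < q < 1 -> f q = 0.
Proof.
intros Hq0 Hd Hb q Hq.
assert (It : forall n, 0 < q ^ (2 ^ n) < 1 /\ f (q ^ (2 ^ n)) = 2 ^ n * f q).
{ intros n. induction n as [|n [IH1 IH2]].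
  - simpl. rewrite Rmult_1_r. split; [lra|ring].
  - replace (q ^ (2 ^ S n)) with ((q ^ (2 ^ n)) ^ 2) by (rewrite <- pow_mult; f_equal; simpl; lia).
    rewrite Hd, IH2 by auto. split; [nra|simpl; ring]. }
destruct (pow_lt_1_zero q) with (y := q0) as [N HN]; [rewrite Rabs_pos_eq; lra|auto|].
assert (Big : forall n, (N <= n)%nat -> 2 ^ n * Rabs (f q) <= c).
{ intros n Hn. destruct (It n) as [I1 I2]. rewrite <- (Rabs_pos_eq (2 ^ n)) by (apply pow_le; lra).
  rewrite <- Rabs_mult, <- I2. apply Hb. split; [apply I1|].
  assert (Hlt : (n <= 2 ^ n)%nat) by (apply Nat.lt_le_incl, Nat.pow_gt_lin_r; lia).
  specialize (HN (2 ^ n)%nat ltac:(lia)). rewrite Rabs_pos_eq in HN; lra. }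
apply NNPP; intros Hne. assert (Hp : 0 < Rabs (f q)) by now apply Rabs_pos_lt.
destruct (Pow_x_infinity 2 ltac:(rewrite Rabs_pos_eq; lra) (Rabs c / Rabs (f q) + 1)) as [M HM].
specialize (HM (N + M)%nat ltac:(lia)). specialize (Big (N + M)%nat ltac:(lia)).
rewrite Rabs_pos_eq in HM by (apply pow_le; lra).
assert (X : (Rabs c / Rabs (f q) + 1) * Rabs (f q) <= 2 ^ (N + M) * Rabs (f q)) by (apply Rmult_le_compat_r; lra).
replace ((Rabs c / Rabs (f q) + 1) * Rabs (f q)) with (Rabs c + Rabs (f q)) in X by (field; lra).
assert (Y := Rle_abs c). lra.
Qed.

Lemma ln_ratio_bound q t : 0 < q -> q <= t <= 64 * q -> Rabs (ln t - ln q) <= ln 64.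
Proof.
intros Hq Ht. assert (A : ln q <= ln t) by (apply ln_le; lra).
assert (B : ln t <= ln (64 * q)) by (apply ln_le; lra). rewrite ln_mult in B by lra. apply Rabs_le. lra.
Qed.

Lemma nomeL_bound x : 0 <= x <= / 2 -> Rabs (nomeL x) <= 2.
Proof.
intros Hx. unfold nomeL, PSeries.
assert (E : ex_series (fun n => x ^ n)) by (apply ex_series_geom; rewrite Rabs_pos_eq; lra).
assert (T : forall n, 0 <= Rabs (lcoef n * x ^ n) <= x ^ n).
{ intros n. split; [apply Rabs_pos|]. assert (P := pow_le x n (proj1 Hx)). rewrite Rabs_mult, (Rabs_pos_eq (x ^ n)) by auto.
  assert (B := Rabs_lcoef n). nra. }
eapply Rle_trans; [apply Series_Rabs, ex_series_pos_le with (2 := E); auto|].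
eapply Rle_trans; [apply Series_le; [exact T|exact E]|].
rewrite Series_geom by (rewrite Rabs_pos_eq; lra). 
replace 2 with (/ / 2) by (now rewrite Rinv_inv). apply Rinv_le_contravar; lra.
Qed.

Lemma nomeY_modX q : 0 < q < 1 -> nomeY (modX q) = - ln q.
Proof.
intros Hq. cut (nomeY (modX q) + ln q = 0); [lra|]. revert q Hq.
apply (doubling_zero (fun q => nomeY (modX q) + ln q) (ln 16 + ln 64 + 2) (/ 128)); [lra| |].
- intros q Hq. destruct (modX_landen q Hq) as [Hl [E1 E2]]. rewrite E1, E2, nomeY_landen by auto.
  rewrite ln_pow by lra. simpl. ring.
- intros q Hq. assert (B := modX_bounds q Hq). assert (L := nomeL_bound (modX q) ltac:(lra)).
  assert (R := ln_ratio_bound q (modX q) ltac:(lra) B). apply Rabs_le_between in L. apply Rabs_le_between in R.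
  assert (P : 0 <= ln 16) by (rewrite <- ln_1; apply ln_le; lra). unfold nomeY. apply Rabs_le. lra.
Qed.

Lemma modX_product q : 0 < q < 1 -> ln (modX q) + ln (1 - modX q) = ln 16 + ln q - 24 * logChi q.
Proof.
intros Hq.
(* The relation is first proved with chi(-q), because [logChi_sqr] describes the value at -(q^2).
   Adding three times ln(1 - X) = 8 (logChi(-q) - logChi q) converts it to chi(q). *)
assert (Z : 2 * ln (1 - modX q) - ln (modX q) + ln 16 + ln q - 24 * logChi (- q) = 0).
{ revert q Hq.
  apply (doubling_zero (fun q => 2 * ln (1 - modX q) - ln (modX q) + ln 16 + ln q - 24 * logChi (- q)) (2 * ln 2 + ln 64 + ln 16 + 48) (/ 128)); [lra| |].
  - intros q Hq. destruct (modX_landen q Hq) as [Hl [E1 E2]]. rewrite logChi_sqr by auto.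
    assert (A := comod_pos q). assert (B := comod_lt_1 q Hq). rewrite (ln_1m_modX q).
    assert (F1 : ln (1 - modX (q ^ 2)) = ln 4 + ln (comod q) - 2 * ln (1 + comod q)).
    { unfold modX. rewrite comod_sqr by auto. replace (1 - (1 - 4 * comod q / (1 + comod q) ^ 2)) with (4 * comod q * / (1 + comod q) ^ 2) by (field; lra).
      assert (0 < (1 + comod q) ^ 2) by (apply pow_lt; lra).
      rewrite ln_mult, ln_mult, ln_Rinv, ln_pow by (try apply Rinv_0_lt_compat; lra). simpl. ring. }
    assert (F2 : ln (modX (q ^ 2)) = 2 * (ln (1 - comod q) - ln (1 + comod q))).
    { rewrite E1. rewrite ln_pow by lra. unfold Rdiv. rewrite ln_mult, ln_Rinv by (try apply Rinv_0_lt_compat; lra). simpl; ring. }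
    assert (F3 : ln (modX q) = ln (1 - comod q) + ln (1 + comod q)).
    { unfold modX. replace (1 - comod q ^ 2) with ((1 - comod q) * (1 + comod q)) by ring. apply ln_mult; lra. }
    assert (F4 : ln (comod q) = 4 * (logChi (- q) - logChi q)) by (unfold comod; apply ln_exp).
    assert (F5 : ln 16 = 2 * ln 4) by (replace 16 with (4 ^ 2) by ring; rewrite ln_pow by lra; simpl; ring).
    rewrite F1, F2, F3, F4. rewrite ln_pow by lra. rewrite F5. simpl. ring.
  - intros q Hq. assert (B := modX_bounds q Hq). assert (R := ln_ratio_bound q (modX q) ltac:(lra) B).
    assert (Ha : Rabs (- q) < 1) by (rewrite Rabs_Ropp, Rabs_pos_eq; lra). assert (L := logChi_bound (- q) Ha).
    rewrite Rabs_Ropp, (Rabs_pos_eq q) in L by lra.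
    assert (L2 : q / (1 - q) ^ 2 <= 2).
    { apply Rmult_le_reg_r with ((1 - q) ^ 2); [apply pow_lt; lra|]. unfold Rdiv. rewrite Rmult_assoc, Rinv_l by (apply pow_nonzero; lra). nra. }
    assert (M1 : ln (1 - modX q) <= 0) by (rewrite <- ln_1; apply ln_le; lra).
    assert (M2 : - ln 2 <= ln (1 - modX q)) by (rewrite <- ln_Rinv by lra; apply ln_le; lra).
    assert (P : 0 <= ln 16) by (rewrite <- ln_1; apply ln_le; lra).
    assert (P' : 0 <= ln 2) by (rewrite <- ln_1; apply ln_le; lra).
    apply Rabs_le_between in R. assert (L3 : Rabs (logChi (- q)) <= 2) by lra. apply Rabs_le_between in L3.
    apply Rabs_le. lra. }
assert (E := ln_1m_modX q). lra.
Qed.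

(** By [nomeY_modX] both x and X(Q(x)) have the same Y, and Y is strictly decreasing. So X inverts Q
    from the other side as well. *)
Lemma modX_exp_nomeY x : 0 < x < 1 -> modX (exp (- nomeY x)) = x.
Proof.
intros Hx. assert (P := nomeY_pos x Hx). set (q := exp (- nomeY x)).
assert (Hq : 0 < q < 1) by now apply exp_opp_lt_1.
assert (E := nomeY_modX q Hq). unfold q in E at 2. rewrite ln_exp in E. assert (R := modX_range q Hq).
destruct (Rtotal_order (modX q) x) as [L|[L|L]]; auto; exfalso.
- assert (D := nomeY_decr (modX q) x ltac:(lra) L ltac:(lra)). lra.
- assert (D := nomeY_decr x (modX q) ltac:(lra) L ltac:(lra)). lra.
Qed.

(** * The Lambert series as a logarithmic derivative *)

Lemma is_derive_Series_quadratic (f : nat -> R -> R) (l M : nat -> R) (u d : R) :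
  0 < d ->
  (forall v, Rabs (v - u) < d -> ex_series (fun k => f k v)) -> ex_series l -> ex_series M ->
  (forall k v, Rabs (v - u) < d -> Rabs (f k v - f k u - l k * (v - u)) <= M k * (v - u) ^ 2) ->
  is_derive (fun v => Series (fun k => f k v)) u (Series l).
Proof.
intros Hd Hf Hl HM Hrem. apply is_derive_Reals. intros eps He.
set (K := Rabs (Series M) + 1). assert (HK : 0 < K) by (unfold K; assert (A := Rabs_pos (Series M)); lra).
assert (Hdel : 0 < Rmin d (eps / K)) by (apply Rmin_pos; auto; now apply Rdiv_lt_0_compat).
exists (mkposreal _ Hdel). intros h Hh Hhd. simpl in Hhd.
assert (B1 := Rmin_l d (eps / K)). assert (B2 := Rmin_r d (eps / K)).
assert (Hv : Rabs (u + h - u) < d) by (replace (u + h - u) with h by ring; lra).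
assert (Hu : Rabs (u - u) < d) by (replace (u - u) with 0 by ring; rewrite Rabs_R0; lra).
assert (E1 := Hf _ Hv). assert (E2 := Hf _ Hu).
assert (E3 : ex_series (fun k => M k * h ^ 2)) by now apply ex_series_scal_r.
assert (E4 : ex_series (fun k => l k * h)) by now apply ex_series_scal_r.
assert (E5 : ex_series (fun k => f k (u + h) - f k u)) by now apply (ex_series_minus (V := R_NormedModule) (fun k => f k (u + h)) (fun k => f k u)).
assert (R : Rabs (Series (fun k => f k (u + h)) - Series (fun k => f k u) - Series l * h) <= Series M * h ^ 2).
{ rewrite <- Series_scal_r, <- Series_scal_r, <- Series_minus, <- Series_minus by auto.
  assert (T : forall k, 0 <= Rabs (f k (u + h) - f k u - l k * h) <= M k * h ^ 2).
  { intros k. split; [apply Rabs_pos|]. assert (X := Hrem k (u + h) Hv). replace (u + h - u) with h in X by ring. exact X. }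
  eapply Rle_trans; [apply Series_Rabs, ex_series_pos_le with (2 := E3); auto|]. apply Series_le; auto. }
set (A := Series (fun k => f k (u + h)) - Series (fun k => f k u) - Series l * h) in *.
replace ((Series (fun k => f k (u + h)) - Series (fun k => f k u)) / h - Series l) with (A * / h) by (unfold A; field; auto).
assert (Hp : 0 < Rabs h) by now apply Rabs_pos_lt.
rewrite Rabs_mult, Rabs_inv.
apply Rle_lt_trans with (K * Rabs h).
- apply Rmult_le_reg_r with (Rabs h); auto. rewrite Rmult_assoc, Rinv_l, Rmult_1_r by lra.
  eapply Rle_trans; [exact R|]. rewrite <- pow2_abs. simpl. rewrite Rmult_1_r, <- Rmult_assoc.
  apply Rmult_le_compat_r; [lra|]. apply Rmult_le_compat_r; [lra|]. assert (X := Rle_abs (Series M)). unfold K. lra.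
- apply Rlt_le_trans with (K * (eps / K)); [apply Rmult_lt_compat_l; lra|]. right; field; lra.
Qed.

(** From e^t >= 1 + t at t = ln(1 + w) and its negative: w - w^2 / (1 + w) <= ln(1 + w) <= w. *)
Lemma ln_taylor_bound w : - / 2 <= w -> Rabs (ln (1 + w) - w) <= 2 * w ^ 2.
Proof.
intros Hw. assert (E1 := exp_ineq1_le (ln (1 + w))). rewrite exp_ln in E1 by lra.
assert (E2 := exp_ineq1_le (- ln (1 + w))). rewrite exp_Ropp, exp_ln in E2 by lra.
assert (I : w - w ^ 2 / (1 + w) = 1 - / (1 + w)) by (field; lra).
assert (J : w ^ 2 / (1 + w) <= 2 * w ^ 2).
{ unfold Rdiv. rewrite Rmult_comm. apply Rmult_le_compat_r; [apply pow2_ge_0|].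
  replace 2 with (/ / 2) by (now rewrite Rinv_inv). apply Rinv_le_contravar; lra. }
apply Rabs_le. assert (P := pow2_ge_0 w). lra.
Qed.

Definition lambert (q : R) : R :=
  Series (fun k => INR (2 * k + 1) * (q ^ (2 * k + 1) / (1 + q ^ (2 * k + 1)))).

Lemma is_derive_logChi q : 0 < q < 1 -> is_derive logChi q (lambert q / q).
Proof.
intros Hq. set (r := (1 + q) / 2). assert (Hr : 0 <= r < 1) by (unfold r; lra). assert (Hrq : q < r) by (unfold r; lra).
set (m := fun k => INR (2 * k + 1)).
assert (Hm : forall k, 1 <= m k).
{ intros k. unfold m. rewrite plus_INR. assert (A := pos_INR (2 * k)). simpl (INR 1). lra. }
assert (EM := ex_series_odd_cube_pow r Hr).
assert (Hterm : forall k, q ^ (2 * k + 1) = q ^ (2 * k) * q) by (intros; rewrite pow_add; ring).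
assert (Pq : forall k, 0 <= q ^ (2 * k)) by (intros; apply pow_le; lra).
replace (lambert q / q) with (Series (fun k => m k * q ^ (2 * k) / (1 + q ^ (2 * k + 1)))).
2:{ unfold lambert, Rdiv. rewrite <- Series_scal_r. apply Series_ext. intros k. fold (m k).
    assert (0 <= q ^ (2 * k) * q) by (apply Rmult_le_pos; [auto|lra]). rewrite Hterm. field. lra. }
apply (is_derive_Series_quadratic (fun k v => ln (1 + v ^ (2 * k + 1))) (fun k => m k * q ^ (2 * k) / (1 + q ^ (2 * k + 1)))
  (fun k => 3 / r ^ 2 * (m k ^ 3 * r ^ (2 * k + 1))) q (Rmin q (r - q))).
- apply Rmin_pos; lra.
- intros v Hv. assert (B1 := Rmin_l q (r - q)). assert (B2 := Rmin_r q (r - q)).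
  apply ex_series_logChi. apply Rabs_def2 in Hv. rewrite Rabs_pos_eq; lra.
- apply ex_series_pos_le with (b := fun k => / r * (m k ^ 3 * r ^ (2 * k + 1))).
  + intros k. specialize (Hm k). specialize (Pq k). assert (P2 : 0 <= q ^ (2 * k + 1)) by (apply pow_le; lra).
    assert (P3 : q ^ (2 * k) <= r ^ (2 * k)) by (apply pow_incr; lra).
    assert (P4 : 0 < / (1 + q ^ (2 * k + 1)) <= 1).
    { split; [apply Rinv_0_lt_compat; lra|]. rewrite <- Rinv_1. apply Rinv_le_contravar; lra. }
    split; [apply Rmult_le_pos; [apply Rmult_le_pos; lra|lra]|].
    replace (/ r * (m k ^ 3 * r ^ (2 * k + 1))) with (m k ^ 3 * r ^ (2 * k)) by (rewrite pow_add; simpl; field; lra).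
    apply Rle_trans with (m k * q ^ (2 * k)).
    * rewrite <- (Rmult_1_r (m k * q ^ (2 * k))) at 2. apply Rmult_le_compat_l; [apply Rmult_le_pos; lra|lra].
    * apply Rmult_le_compat; try lra. simpl. rewrite Rmult_1_r. rewrite <- (Rmult_1_r (m k)) at 1.
      apply Rmult_le_compat_l; nra.
  + exact (ex_series_scal_l (/ r) _ EM).
- exact (ex_series_scal_l (3 / r ^ 2) _ EM).
- intros k v Hv. assert (B1 := Rmin_l q (r - q)). assert (B2 := Rmin_r q (r - q)).
  assert (Hv' := Rabs_def2 _ _ Hv).
  assert (Cq : Cmod (RtoC q) = q) by (rewrite Cmod_R, Rabs_pos_eq; lra).
  assert (Cv : Cmod (RtoC v) = v) by (rewrite Cmod_R, Rabs_pos_eq; lra).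
  set (n := (2 * k + 1)%nat).
  assert (T1 := pow_taylor_bound (RtoC q) (RtoC v) r n ltac:(lra) ltac:(lra) ltac:(lra)).
  assert (T2 := pow_diff_bound (RtoC q) (RtoC v) r n ltac:(lra) ltac:(lra) ltac:(lra)).
  replace (pred n) with (2 * k)%nat in T1 by (unfold n; lia).
  rewrite <- !RtoC_pow, <- !RtoC_minus, <- !RtoC_mult, <- RtoC_minus, !Cmod_R in T1.
  rewrite <- !RtoC_pow, <- !RtoC_minus, !Cmod_R in T2.
  change (INR n) with (m k) in *. specialize (Hm k).
  set (t := q ^ n) in *. set (t' := v ^ n) in *.
  assert (Ht : 0 <= t <= 1) by (apply pow_le_1; lra).
  assert (Ht' : 0 <= t' <= 1) by (apply pow_le_1; lra).
  (* Since 1 + t' = (1 + t)(1 + w), the difference of logarithms is ln(1 + w); t and t' lie in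
     [0, 1], which gives w >= -1/2. *)
  set (w := (t' - t) / (1 + t)).
  assert (Hw : - / 2 <= w).
  { apply Rmult_le_reg_r with (1 + t); [lra|]. unfold w, Rdiv. rewrite Rmult_assoc, Rinv_l by lra. lra. }
  assert (L := ln_taylor_bound w Hw).
  assert (El : ln (1 + t') - ln (1 + t) = ln (1 + w)).
  { replace (1 + w) with ((1 + t') * / (1 + t)) by (unfold w; field; lra).
    rewrite ln_mult, ln_Rinv by (try apply Rinv_0_lt_compat; lra). ring. }
  set (X := t' - t - m k * q ^ (2 * k) * (v - q)) in *.
  replace (ln (1 + t') - ln (1 + t) - m k * q ^ (2 * k) / (1 + t) * (v - q)) with ((ln (1 + w) - w) + X * / (1 + t)).
  2:{ rewrite El. unfold X, w. field. lra. }
  assert (I1 : 0 < / (1 + t) <= 1).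
  { split; [apply Rinv_0_lt_compat; lra|]. rewrite <- Rinv_1. apply Rinv_le_contravar; lra. }
  eapply Rle_trans; [apply Rabs_triang|]. rewrite Rabs_mult, (Rabs_pos_eq (/ (1 + t))) by lra.
  set (D2 := (v - q) ^ 2) in *. assert (HD2 : 0 <= D2) by apply pow2_ge_0.
  rewrite pow2_abs in T1. fold D2 in T1.
  assert (Hr2 : 0 < r ^ 2) by (apply pow_lt; lra).
  assert (Hrn : 0 <= r ^ n <= 1) by (apply pow_le_1; lra).
  assert (Hm2 : 0 <= m k ^ 2 <= m k ^ 3) by (simpl; nra).
  assert (W : w ^ 2 <= m k ^ 2 * r ^ n * D2 / r ^ 2).
  { apply Rle_trans with ((t' - t) ^ 2).
    - unfold w, Rdiv. rewrite Rpow_mult_distr. rewrite <- (Rmult_1_r ((t' - t) ^ 2)) at 2.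
      apply Rmult_le_compat_l; [apply pow2_ge_0|]. nra.
    - apply Rmult_le_reg_l with (r ^ 2); auto.
      replace (r ^ 2 * (m k ^ 2 * r ^ n * D2 / r ^ 2)) with (m k ^ 2 * D2 * r ^ n) by (field; lra).
      replace (r ^ 2 * (t' - t) ^ 2) with ((r * Rabs (t' - t)) ^ 2) by (rewrite Rpow_mult_distr, pow2_abs; ring).
      apply Rle_trans with ((m k * r ^ n * Rabs (v - q)) ^ 2).
      + apply pow_incr. split; auto. apply Rmult_le_pos; [lra|apply Rabs_pos].
      + rewrite !Rpow_mult_distr, pow2_abs. fold D2. replace (m k ^ 2 * (r ^ n) ^ 2 * D2) with (m k ^ 2 * D2 * (r ^ n) ^ 2) by ring.
        apply Rmult_le_compat_l; [apply Rmult_le_pos; lra|]. simpl. nra. }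
  assert (XB : Rabs X <= m k ^ 2 * r ^ n * D2 / r ^ 2).
  { apply Rmult_le_reg_l with (r ^ 2); auto. eapply Rle_trans; [exact T1|]. right; field; lra. }
  apply Rle_trans with (2 * (m k ^ 2 * r ^ n * D2 / r ^ 2) + m k ^ 2 * r ^ n * D2 / r ^ 2).
  + apply Rplus_le_compat; [lra|]. eapply Rle_trans; [|exact XB]. rewrite <- (Rmult_1_r (Rabs X)) at 2.
    apply Rmult_le_compat_l; [apply Rabs_pos|lra].
  + apply Rle_trans with (3 / r ^ 2 * (m k ^ 2 * r ^ n) * D2); [right; field; lra|].
    apply Rmult_le_compat_r; auto. apply Rmult_le_compat_l; [left; apply Rdiv_lt_0_compat; lra|].
    apply Rmult_le_compat_r; lra.
Qed.

Lemma lambert_nomeY x : 0 < x < 1 -> 1 - 24 * lambert (exp (- nomeY x)) = (1 - 2 * x) * hypF x ^ 2.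
Proof.
intros Hx.
set (f := fun t => ln t + ln (1 - t) - ln 16 + nomeY t + 24 * logChi (exp (- nomeY t))).
assert (Z : forall t, 0 < t < 1 -> f t = 0).
{ intros t Ht. assert (P := nomeY_pos t Ht). set (q := exp (- nomeY t)).
  assert (Hq : 0 < q < 1) by now apply exp_opp_lt_1.
  assert (E := modX_product q Hq). unfold q in E at 1 2. rewrite modX_exp_nomeY in E by auto.
  unfold q in E at 1. rewrite ln_exp in E. unfold f. fold q. lra. }
assert (P := nomeY_pos x Hx). set (q := exp (- nomeY x)).
assert (Hq : 0 < q < 1) by now apply exp_opp_lt_1.
assert (F1 := hypF_ge_1 x ltac:(lra)).
assert (DY := is_derive_nomeY x Hx). assert (DL := is_derive_logChi q Hq).
assert (DE : is_derive (fun t => exp (- nomeY t)) x (/ (x * (1 - x) * hypF x ^ 2) * q)).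
{ assert (e1 : ex_derive nomeY x) by (eexists; eauto). assert (U := is_derive_unique _ _ _ DY).
  auto_derive; auto. change (Derive (fun x => nomeY x) x) with (Derive nomeY x). rewrite U. fold q. ring. }
assert (DC : is_derive (fun t => logChi (exp (- nomeY t))) x (/ (x * (1 - x) * hypF x ^ 2) * q * (lambert q / q))).
{ apply (is_derive_comp logChi (fun t => exp (- nomeY t))); auto. }
set (G := fun t => logChi (exp (- nomeY t))).
change (is_derive G x (/ (x * (1 - x) * hypF x ^ 2) * q * (lambert q / q))) in DC.
assert (DF0 : is_derive f x (/ x - / (1 - x) + - / (x * (1 - x) * hypF x ^ 2) + 24 * (/ (x * (1 - x) * hypF x ^ 2) * q * (lambert q / q)))).
{ assert (e1 : ex_derive nomeY x) by (eexists; eauto). assert (e2 : ex_derive G x) by (eexists; eauto).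
  apply is_derive_unique in DY. apply is_derive_unique in DC.
  change f with (fun t => ln t + ln (1 - t) - ln 16 + nomeY t + 24 * G t).
  auto_derive; [repeat split; auto; lra|].
  change (Derive (fun x => nomeY x) x) with (Derive nomeY x). change (Derive (fun x => G x) x) with (Derive G x).
  rewrite DY, DC. field. repeat split; lra. }
assert (D0 : is_derive f x 0).
{ apply is_derive_ext_loc with (f := fun _ => 0); [|apply @is_derive_const].
  assert (Hd : 0 < Rmin x (1 - x)) by (apply Rmin_pos; lra).
  exists (mkposreal _ Hd). intros t Ht. change (Rabs (t - x) < Rmin x (1 - x)) in Ht.
  assert (B1 := Rmin_l x (1 - x)). assert (B2 := Rmin_r x (1 - x)). apply Rabs_def2 in Ht. symmetry; apply Z. lra. }
apply is_derive_unique in D0. apply is_derive_unique in DF0. rewrite D0 in DF0.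
assert (N : x * (1 - x) * hypF x ^ 2 <> 0) by (apply Rgt_not_eq; repeat apply Rmult_lt_0_compat; lra).
(* The logarithmic derivative of the product relation along q = Q(x), multiplied by x (1 - x)
   F(x)^2, is the difference of the two sides of the claim. *)
assert (E : (1 - 2 * x) * hypF x ^ 2 - (1 - 24 * lambert q) =
  (x * (1 - x) * hypF x ^ 2) * (/ x - / (1 - x) + - / (x * (1 - x) * hypF x ^ 2) + 24 * (/ (x * (1 - x) * hypF x ^ 2) * q * (lambert q / q)))).
{ field. repeat split; lra. }
rewrite <- DF0 in E. lra.
Qed.

(** * The identity in the disc *)

Local Open Scope C_scope.

Lemma CSeries_ext (a b : nat -> C) : (forall k, a k = b k) -> CSeries a = CSeries b.
Proof. intros H. unfold CSeries. f_equal; apply Series_ext; intros k; now rewrite H. Qed.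

Lemma CSeries_RtoC (a : nat -> R) : CSeries (fun k => RtoC (a k)) = RtoC (Series a).
Proof.
unfold CSeries, RtoC; simpl. f_equal. rewrite (Series_ext _ (fun n => 0 * 0)%R) by (intros; ring).
rewrite Series_scal_l. ring.
Qed.

Lemma CPS_RtoC (a : nat -> R) (x : R) : CPS a (RtoC x) = RtoC (PSeries a x).
Proof.
unfold CPS, PSeries. rewrite <- CSeries_RtoC. apply CSeries_ext. intros k. now rewrite <- RtoC_pow, <- RtoC_mult.
Qed.

Lemma poch_half n : poch (1 / 2) n = RtoC (beta n * INR (fact n)).
Proof.
induction n as [|n IH]; [simpl; f_equal; ring|].
change (poch (1 / 2) (S n)) with (poch (1 / 2) n * (1 / 2 + INR n)). rewrite IH.
replace (1 / 2 + INR n) with (RtoC (INR n + / 2)).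
- rewrite <- RtoC_mult. f_equal. change (fact (S n)) with (S n * fact n)%nat. rewrite mult_INR, S_INR.
  transitivity ((INR n + / 2) * beta n * INR (fact n))%R; [ring|]. rewrite <- beta_S. ring.
- rewrite RtoC_plus, RtoC_inv by lra. field.
Qed.

Lemma poch_one n : poch 1 n = RtoC (INR (fact n)).
Proof.
induction n as [|n IH]; [reflexivity|].
change (poch 1 (S n)) with (poch 1 n * (1 + INR n)). rewrite IH.
change (fact (S n)) with (S n * fact n)%nat. rewrite mult_INR, S_INR, RtoC_mult, RtoC_plus. ring.
Qed.

Lemma gauss_2F1_CPS u : gauss_2F1 (1 / 2) (1 / 2) 1 u = CPS acoef u.
Proof.
change (CSeries (gauss_term (1 / 2) (1 / 2) 1 u) = CPS acoef u). apply CSeries_ext. intros n.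
unfold gauss_term. rewrite poch_half, poch_one. f_equal.
assert (F : INR (fact n) <> 0%R) by apply INR_fact_neq_0.
rewrite <- !RtoC_mult, <- RtoC_div by (apply Rmult_integral_contrapositive_currified; auto). f_equal. unfold acoef. field. auto.
Qed.

(* Summation by parts: (1 - u) F(u) = 1 - sum (a_n - a_(n+1)) u^(n+1), and the a_n decrease from 1. *)
Lemma CPS_acoef_neq_0 u : (Cmod u < 1)%R -> CPS acoef u <> 0.
Proof.
intros Hu E. assert (H0 := Cmod_ge_0 u).
assert (HS : is_series (fun n => acoef n * u ^ n) (CPS acoef u)).
{ apply is_series_CSeries, (ex_series_Cmod_CPS _ 1%R); auto. apply Rabs_acoef. }
set (s := fun n => sum_n (fun n => acoef n * u ^ n) n).
assert (P : forall n, (Cmod u ^ S n <= Cmod u)%R).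
{ intros n. simpl. assert (Q : (Cmod u ^ n <= 1)%R) by (apply pow_le_1; lra). nra. }
assert (B : forall n, (Cmod ((1 - u) * s n - 1 + acoef n * u ^ S n) <= Cmod u * (1 - acoef n))%R).
{ intros n. induction n as [|n IH].
  - unfold s. rewrite sum_O. replace (acoef 0) with 1%R by (unfold acoef; simpl; ring).
    replace ((1 - u) * (1%R * u ^ 0) - 1 + 1%R * u ^ 1) with (RtoC 0) by (simpl; ring). rewrite Cmod_0. lra.
  - replace ((1 - u) * s (S n) - 1 + acoef (S n) * u ^ S (S n)) with
     (((1 - u) * s n - 1 + acoef n * u ^ S n) + RtoC (acoef (S n) - acoef n) * u ^ S n).
    + eapply Rle_trans; [apply Cmod_triangle|]. rewrite Cmod_mult, Cmod_R, Cmod_pow.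
      assert (D := acoef_decr n). rewrite Rabs_minus_sym, Rabs_pos_eq by lra. specialize (P n). nra.
    + unfold s. rewrite sum_Sn. rewrite RtoC_minus. change (plus ?a ?b) with (a + b). rewrite !Cpow_S.
      unfold plus; simpl. ring. }
(* The error |u| (1 - a_n) and the boundary term a_n |u| add up to |u|; the lower bound 1 - |u| is
   therefore uniform in n and survives in the limit. *)
assert (B2 : forall n, (1 - Cmod u <= Cmod (1 - u) * Cmod (s n))%R).
{ intros n. rewrite <- Cmod_mult. specialize (B n). assert (A := acoef_bounds n).
  assert (T := Cmod_triangle_inv 1 ((1 - (1 - u) * s n - acoef n * u ^ S n) + acoef n * u ^ S n)).
  replace (1 - (1 - (1 - u) * s n - acoef n * u ^ S n + acoef n * u ^ S n)) with ((1 - u) * s n) in T by ring.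
  assert (T2 := Cmod_triangle (1 - (1 - u) * s n - acoef n * u ^ S n) (acoef n * u ^ S n)).
  replace (1 - (1 - u) * s n - acoef n * u ^ S n) with (- ((1 - u) * s n - 1 + acoef n * u ^ S n)) in * by ring.
  rewrite Cmod_opp in T2. rewrite (Cmod_mult (acoef n)), Cmod_R, Cmod_pow, Rabs_pos_eq in T2 by lra.
  rewrite Cmod_1 in T. specialize (P n). nra. }
assert (L : is_lim_seq (fun n => Cmod (s n)) 0).
{ rewrite <- Cmod_0, <- E. apply filterlim_comp with (G := locally (CPS acoef u : C_NormedModule)); [exact HS|].
  apply (filterlim_norm (V := C_NormedModule) (CPS acoef u)). }
assert (L2 : is_lim_seq (fun n => (Cmod (1 - u) * Cmod (s n))%R) 0).
{ replace (Finite 0) with (Finite (Cmod (1 - u) * 0)) by (f_equal; ring). apply is_lim_seq_mult'; [apply is_lim_seq_const|exact L]. }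
assert (X := is_lim_seq_le _ _ (Finite _) (Finite _) B2 (is_lim_seq_const _) L2). simpl in X. lra.
Qed.

Definition nome (u : C) : C := u / 16 * Cexp (CPS lcoef u).

Lemma sixteen_neq_0 : RtoC 16 <> 0.
Proof. intros E. apply RtoC_inj in E. lra. Qed.

Lemma nome_RtoC x : (0 < x < 1)%R -> nome (RtoC x) = RtoC (exp (- nomeY x)).
Proof.
intros Hx. unfold nome. rewrite CPS_RtoC, Cexp_RtoC, <- RtoC_div, <- RtoC_mult by lra. f_equal.
unfold nomeY. replace (- (ln 16 - ln x - nomeL x))%R with (- ln 16 + ln x + nomeL x)%R by ring.
rewrite !exp_plus, exp_Ropp, !exp_ln by lra. unfold nomeL. field.
Qed.

(* The coefficients of L are nonnegative, so |Q(u)| <= Q(|u|). *)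
Lemma Cmod_nome_lt_1 u : (0 < Cmod u < 1)%R -> (Cmod (nome u) < 1)%R.
Proof.
intros Hu.
assert (B : (Cmod (CPS lcoef u) <= nomeL (Cmod u))%R).
{ unfold nomeL, PSeries. apply Cmod_CSeries.
  - intros k. rewrite Cmod_mult, Cmod_R, Cmod_pow, Rabs_pos_eq by apply lcoef_bounds. lra.
  - apply (ex_pseries_R lcoef (Cmod u)). apply CV_radius_inside, (CV_radius_inside_1 _ 1%R); [apply Rabs_lcoef|].
    rewrite Rabs_pos_eq; lra. }
assert (B2 := re_le_Cmod (CPS lcoef u)). assert (B3 := Rle_abs (Re (CPS lcoef u))).
apply Rle_lt_trans with (Cmod (nome (RtoC (Cmod u)))).
- unfold nome. rewrite !Cmod_mult, !Cmod_Cexp, !Cmod_div by apply sixteen_neq_0.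
  rewrite (Cmod_R (Cmod u)), (Rabs_pos_eq (Cmod u)) by lra. apply Rmult_le_compat_l.
  + apply Rmult_le_pos; [lra|]. left. apply Rinv_0_lt_compat. apply Cmod_gt_0, sixteen_neq_0.
  + rewrite CPS_RtoC. simpl (Re (RtoC _)). change (PSeries lcoef (Cmod u)) with (nomeL (Cmod u)).
    destruct (Req_dec (Re (CPS lcoef u)) (nomeL (Cmod u))) as [->|]; [lra|]. left. apply exp_increasing. lra.
- rewrite nome_RtoC, Cmod_R by auto. rewrite Rabs_pos_eq by (left; apply exp_pos).
  rewrite <- exp_0. apply exp_increasing. assert (P := nomeY_pos _ Hu). lra.
Qed.

Lemma cdiff_nome u : (Cmod u < 1)%R -> exists l, cdiff nome u l.
Proof.
intros Hu. destruct (cdiff_CPS lcoef 1 u Rabs_lcoef Hu) as [l Hl]. eexists.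
apply (cdiff_mult (fun u => u / 16) (fun u => Cexp (CPS lcoef u))).
- apply (cdiff_mult (fun u => u) (fun _ => / 16)); [apply cdiff_id|apply cdiff_const].
- apply (cdiff_comp Cexp (CPS lcoef)); [apply cdiff_exp|exact Hl].
Qed.

Lemma Cmod_Cexp_lt_1 s : (Re s < 0)%R -> (0 < Cmod (Cexp s) < 1)%R.
Proof.
intros Hs. rewrite Cmod_Cexp. split; [apply exp_pos|]. rewrite <- exp_0. now apply exp_increasing.
Qed.

Lemma lambert_RtoC q : (0 < q)%R -> CSeries (fun k => lambert_term k (RtoC q)) = RtoC (lambert q).
Proof.
intros Hq. unfold lambert. rewrite <- CSeries_RtoC. apply CSeries_ext. intros k. unfold lambert_term.
assert (P : (0 <= q ^ (2 * k + 1))%R) by (apply pow_le; lra).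
rewrite <- RtoC_pow, <- RtoC_plus, <- RtoC_div, <- RtoC_mult by lra. reflexivity.
Qed.

(** No cut is met: [nome] and the series depend on e^s only, so a strip wide enough to contain s can
    be used. On the negative axis the identity is [lambert_nomeY]. *)
Lemma lambert_nome_exp s : (Re s < 0)%R ->
  1 - 24 * CSeries (fun k => lambert_term k (nome (Cexp s))) = (1 - 2 * Cexp s) * CPS acoef (Cexp s) ^ 2.
Proof.
intros Hs.
set (f := fun s => (1 + - 24 * CSeries (fun k => lambert_term k (nome (Cexp s)))) +
   (-1 + 2 * Cexp s) * (CPS acoef (Cexp s) * CPS acoef (Cexp s))).
cut (f s = 0).
{ intros E. unfold f in E. set (A := CSeries _) in *. set (B := CPS acoef (Cexp s)) in *.
  replace (1 - 24 * A) with ((1 + - 24 * A + (-1 + 2 * Cexp s) * (B * B)) + (1 - 2 * Cexp s) * B ^ 2) by ring.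
  rewrite E. ring. }
apply (zero_on_strip f (Rabs (Im s) + 1)); auto; [assert (A := Rabs_pos (Im s)); lra| | |lra].
- intros u Hu _. assert (M := Cmod_Cexp_lt_1 u Hu).
  destruct (cdiff_CPS acoef 1 (Cexp u) Rabs_acoef (proj2 M)) as [l1 H1].
  destruct (cdiff_nome (Cexp u) (proj2 M)) as [l2 H2].
  destruct (cdiff_lambert (nome (Cexp u)) (Cmod_nome_lt_1 _ M)) as [l3 H3].
  assert (HE := cdiff_exp u).
  assert (HF := cdiff_comp (CPS acoef) Cexp u _ _ H1 HE).
  eexists. apply (cdiff_plus (fun s => 1 + - 24 * CSeries (fun k => lambert_term k (nome (Cexp s))))
     (fun s => (-1 + 2 * Cexp s) * (CPS acoef (Cexp s) * CPS acoef (Cexp s)))).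
  + apply (cdiff_plus (fun _ => 1) (fun s => - 24 * CSeries (fun k => lambert_term k (nome (Cexp s))))); [apply cdiff_const|].
    apply (cdiff_mult (fun _ => - 24) (fun s => CSeries (fun k => lambert_term k (nome (Cexp s))))); [apply cdiff_const|].
    apply (cdiff_comp (fun q => CSeries (fun k => lambert_term k q)) (fun s => nome (Cexp s))); [exact H3|].
    apply (cdiff_comp nome Cexp); eauto.
  + apply (cdiff_mult (fun s => -1 + 2 * Cexp s) (fun s => CPS acoef (Cexp s) * CPS acoef (Cexp s))).
    * apply (cdiff_plus (fun _ => -1) (fun s => 2 * Cexp s)); [apply cdiff_const|].
      apply (cdiff_mult (fun _ => 2) Cexp); [apply cdiff_const|exact HE].
    * apply (cdiff_mult (fun s => CPS acoef (Cexp s)) (fun s => CPS acoef (Cexp s))); exact HF.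
- intros t Ht. unfold f. rewrite Cexp_RtoC.
  assert (Hx : (0 < exp t < 1)%R) by (split; [apply exp_pos|rewrite <- exp_0; now apply exp_increasing]).
  set (x := exp t) in *. rewrite CPS_RtoC, nome_RtoC by auto.
  rewrite lambert_RtoC by apply exp_pos.
  change (PSeries acoef x) with (hypF x). assert (E := lambert_nomeY x Hx).
  replace (1 + - 24 * lambert (exp (- nomeY x)) + (-1 + 2 * x) * (hypF x * hypF x)) with
   (RtoC ((1 - 24 * lambert (exp (- nomeY x))) - (1 - 2 * x) * hypF x ^ 2)).
  + rewrite E. f_equal. ring.
  + rewrite !RtoC_minus, !RtoC_mult, !RtoC_minus, !RtoC_mult, RtoC_pow. ring.
Qed.

(** The second solution F Y / pi at x = e^s, with s in the place of ln x; it is holomorphic on the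
    whole half-plane Re s < 0, the edges Im s = -pi, pi included. *)
Definition second_branch (s : C) : C := - (CPS acoef (Cexp s) * (s + - ln 16 + CPS lcoef (Cexp s)) * / PI).

Lemma cdiff_second_branch s : (Re s < 0)%R -> exists l, cdiff second_branch s l.
Proof.
intros Hs. assert (M := Cmod_Cexp_lt_1 s Hs).
destruct (cdiff_CPS acoef 1 (Cexp s) Rabs_acoef (proj2 M)) as [l1 H1].
destruct (cdiff_CPS lcoef 1 (Cexp s) Rabs_lcoef (proj2 M)) as [l2 H2].
assert (HE := cdiff_exp s).
assert (HF := cdiff_comp (CPS acoef) Cexp s _ _ H1 HE).
assert (HL := cdiff_comp (CPS lcoef) Cexp s _ _ H2 HE).
eexists. eapply (cdiff_ext_loc (fun s => (- / PI) * (CPS acoef (Cexp s) * (s + - ln 16 + CPS lcoef (Cexp s))))); [apply Rlt_0_1| |].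
- intros v _. unfold second_branch. ring.
- apply (cdiff_mult (fun _ => - / PI) (fun s => CPS acoef (Cexp s) * (s + - ln 16 + CPS lcoef (Cexp s)))); [apply cdiff_const|].
  apply (cdiff_mult (fun s => CPS acoef (Cexp s)) (fun s => s + - ln 16 + CPS lcoef (Cexp s))); [exact HF|].
  apply (cdiff_plus (fun s => s + - ln 16) (fun s => CPS lcoef (Cexp s))); [|exact HL].
  apply (cdiff_plus (fun s => s) (fun _ => - ln 16)); [apply cdiff_id|apply cdiff_const].
Qed.

Lemma PI_C_neq_0 : RtoC PI <> 0.
Proof. intros E. apply RtoC_inj in E. assert (P := PI_RGT_0). lra. Qed.

(** For real s < 0 the point 1 - e^s lies in (0, 1), where F is the Gauss series and
    [nomeY_eq_ratioY] is the connection formula; unique continuation spreads it over the strip. *)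
Lemma principal_branch_exp (F : C -> C) s : principal_branch_2F1 (1 / 2) (1 / 2) 1 F ->
  (Re s < 0)%R -> (Rabs (Im s) < PI)%R -> F (1 - Cexp s) = second_branch s.
Proof.
intros [HF1 HF2] Hs1 Hs2.
set (f := fun s => F (1 + - (1) * Cexp s) + - (1) * second_branch s).
cut (f s = 0).
{ intros E. unfold f in E. replace (1 - Cexp s) with (1 + - (1) * Cexp s) by ring.
  replace (F (1 + - (1) * Cexp s)) with (F (1 + - (1) * Cexp s) + - (1) * second_branch s + second_branch s) by ring.
  rewrite E. ring. }
apply (zero_on_strip f PI); auto; [apply PI_RGT_0| |].
- intros u Hu1 Hu2. destruct (cdiff_second_branch u Hu1) as [l1 H1].
  destruct (ex_derive_cdiff F (1 + - (1) * Cexp u)) as [l2 H2].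
  { apply HF1. intros [A B].
    replace (Im (1 + - (1) * Cexp u)) with (- (exp (Re u) * sin (Im u)))%R in A by (unfold Cexp, Re, Im; simpl; ring).
    replace (Re (1 + - (1) * Cexp u)) with (1 - exp (Re u) * cos (Im u))%R in B by (unfold Cexp, Re, Im; simpl; ring).
    assert (E0 := exp_pos (Re u)).
    (* For |Im u| < pi the point 1 - e^u is real only when Im u = 0, and then it is less than 1; so
       the cut is avoided. *)
    assert (Z : sin (Im u) = 0%R) by nra.
    assert (Iu : Im u = 0%R).
    { apply Rabs_def2 in Hu2. destruct (Rtotal_order (Im u) 0) as [L|[L|L]]; auto; exfalso.
      - assert (X := sin_gt_0 (- Im u) ltac:(lra) ltac:(lra)). rewrite sin_neg in X. lra.
      - assert (X := sin_gt_0 (Im u) ltac:(lra) ltac:(lra)). lra. }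
    rewrite Iu, cos_0 in B. lra. }
  eexists. apply (cdiff_plus (fun s => F (1 + - (1) * Cexp s)) (fun s => - (1) * second_branch s)).
  + apply (cdiff_comp F (fun s => 1 + - (1) * Cexp s)); [exact H2|].
    apply (cdiff_plus (fun _ => 1) (fun s => - (1) * Cexp s)); [apply cdiff_const|].
    apply (cdiff_mult (fun _ => - (1)) Cexp); [apply cdiff_const|apply cdiff_exp].
  + apply (cdiff_mult (fun _ => - (1)) second_branch); [apply cdiff_const|exact H1].
- intros t Ht. unfold f, second_branch. rewrite Cexp_RtoC.
  assert (Hx : (0 < exp t < 1)%R) by (split; [apply exp_pos|rewrite <- exp_0; now apply exp_increasing]).
  assert (Et : t = ln (exp t)) by now rewrite ln_exp. set (x := exp t) in *. clearbody x. subst t.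
  replace (1 + - (1) * x) with (RtoC (1 - x)) by (rewrite RtoC_minus; ring).
  rewrite HF2 by (rewrite Cmod_R, Rabs_pos_eq; lra). rewrite gauss_2F1_CPS, !CPS_RtoC.
  change (PSeries acoef (1 - x)) with (hypF (1 - x)). change (PSeries acoef x) with (hypF x). change (PSeries lcoef x) with (nomeL x).
  assert (E := nomeY_eq_ratioY x Hx). unfold nomeY, ratioY in E. assert (F1 := hypF_ge_1 x ltac:(lra)). assert (HPI := PI_RGT_0).
  assert (EF : hypF (1 - x) = (hypF x * (ln 16 - ln x - nomeL x) / PI)%R) by (rewrite E; field; lra).
  rewrite EF, RtoC_div, RtoC_mult, !RtoC_minus by lra. field. apply PI_C_neq_0.
Qed.

Lemma Cexp_surj (x : C) : x <> 0 -> exists s, Cexp s = x /\ (- PI < Im s <= PI)%R.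
Proof.
intros Hx. assert (Hp : (0 < Cmod x)%R) by now apply Cmod_gt_0.
set (c := (Re x / Cmod x)%R). set (t := (Im x / Cmod x)%R).
assert (Ec : (c ^ 2 + t ^ 2 = 1)%R).
{ unfold c, t. assert (E := Cmod2_alt x). replace ((Re x / Cmod x) ^ 2 + (Im x / Cmod x) ^ 2)%R with ((Re x ^ 2 + Im x ^ 2) / Cmod x ^ 2)%R by (field; lra).
  rewrite <- E. field. lra. }
assert (Hc : (-1 <= c <= 1)%R) by nra.
assert (HPI := PI_RGT_0).
assert (Hth : exists th : R, cos th = c /\ sin th = t /\ (- PI < th <= PI)%R).
{ assert (A := acos_bound c). assert (Cc := cos_acos c Hc). assert (Ss := sin_acos c Hc).
  assert (Sq : sqrt (1 - Rsqr c) = Rabs t).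
  { rewrite <- sqrt_Rsqr_abs. f_equal. unfold Rsqr. lra. }
  destruct (Rle_lt_dec 0 t) as [L|L].
  - exists (acos c). rewrite Ss, Sq, Rabs_pos_eq by auto. repeat split; auto; lra.
  - exists (- acos c)%R. rewrite cos_neg, sin_neg, Ss, Sq, Rabs_left by auto. repeat split; auto; try lra.
    destruct (Req_dec (acos c) PI) as [E|E]; [|lra]. rewrite E, sin_PI in Ss. rewrite Sq, Rabs_left in Ss by auto. lra. }
destruct Hth as [th [H1 [H2 H3]]]. exists (ln (Cmod x), th). split; auto.
unfold Cexp; simpl. rewrite exp_ln, H1, H2 by auto. unfold c, t. destruct x as [a b]; simpl in *. f_equal; field; lra.
Qed.

(* The boundary value is computed along the arc u = 1 - e^s, Im s -> - sg * pi, which stays in the half-plane. *)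
Lemma boundary_value_branch (F : C -> C) (H : C -> Prop) (sg r : R) (w : C) :
  principal_branch_2F1 (1 / 2) (1 / 2) 1 F -> (sg * sg = 1)%R -> (0 < r < 1)%R ->
  (forall u, (0 < sg * Im u)%R -> H u) ->
  boundary_value H F (1 + r)%R w -> w = second_branch (ln r, (- sg * PI)%R).
Proof.
intros HF Hsg Hr HH Hb. assert (HPI := PI_RGT_0).
(* A logarithm of -r. As Im(1 - e^s) = - e^(Re s) sin(Im s), the edge Im s = -pi borders the upper
   side of the cut and Im s = pi the lower one. *)
set (s0 := (ln r, (- sg * PI)%R) : C).
assert (Hln : (ln r < 0)%R) by (rewrite <- ln_1; apply ln_increasing; lra).
destruct (cdiff_second_branch s0 Hln) as [l Hl].
assert (Hsa : Rabs sg = 1%R) by (unfold Rabs; destruct (Rcase_abs sg); nra).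
assert (Cs : cos (sg * PI) = (-1)%R).
{ destruct (Rle_lt_dec 0 sg) as [A|A].
  - rewrite Rabs_pos_eq in Hsa by auto. rewrite Hsa, Rmult_1_l. apply cos_PI.
  - rewrite Rabs_left in Hsa by auto. replace (sg * PI)%R with (- PI)%R by (replace sg with (-1)%R by lra; ring). rewrite cos_neg. apply cos_PI. }
assert (Ss : sin (sg * PI) = 0%R).
{ destruct (Rle_lt_dec 0 sg) as [A|A].
  - rewrite Rabs_pos_eq in Hsa by auto. rewrite Hsa, Rmult_1_l. apply sin_PI.
  - rewrite Rabs_left in Hsa by auto. replace (sg * PI)%R with (- PI)%R by (replace sg with (-1)%R by lra; ring). rewrite sin_neg, sin_PI. ring. }
assert (E0 : Cexp s0 = RtoC (- r)).
{ unfold Cexp, s0, RtoC; simpl. replace (- sg * PI)%R with (- (sg * PI))%R by ring. rewrite cos_neg, sin_neg, Cs, Ss, exp_ln by lra. f_equal; ring. }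
assert (K : (Cmod (w - second_branch s0) <= 0)%R).
{ apply le_epsilon. intros eps He. rewrite Rplus_0_l.
  assert (He2 : (0 < eps / 4)%R) by lra.
  assert (B := proj1 (filterlim_locally _ _) Hb (mkposreal _ He2)).
  destruct B as [d Hd].
  destruct (cdiff_continuous _ _ _ Hl (eps / 4)%R He2) as [d1 [Hd1 H1]].
  destruct (cdiff_continuous _ _ _ (cdiff_exp s0) d (cond_pos d)) as [d2 [Hd2 H2]].
  (* A step of size e away from s0 meets both continuity requirements, stays in the open strip, and
     has sin(pi - e) > 0, which puts 1 - e^s in the prescribed half-plane. *)
  set (e := (Rmin (Rmin (d1 / 2) (d2 / 2)) (PI / 2))%R).
  assert (Hep : (0 < e)%R) by (repeat apply Rmin_pos; lra).
  assert (X1 := Rmin_l (Rmin (d1 / 2) (d2 / 2)) (PI / 2)). assert (X2 := Rmin_r (Rmin (d1 / 2) (d2 / 2)) (PI / 2)). fold e in X1, X2.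
  assert (X3 := Rmin_l (d1 / 2) (d2 / 2)). assert (X4 := Rmin_r (d1 / 2) (d2 / 2)).
  set (s := (ln r, (- sg * (PI - e))%R) : C).
  assert (Ds : Cmod (s - s0) = e).
  { replace (s - s0) with (Ci * RtoC (sg * e)).
    - rewrite Cmod_mult, Cmod_Ci, Cmod_R, Rabs_mult, Hsa, Rabs_pos_eq; lra.
    - unfold s, s0, Ci, RtoC. unfold Cmult, Cminus, Cplus, Copp; simpl. f_equal; ring. }
  specialize (H1 s ltac:(lra)). specialize (H2 s ltac:(lra)).
  set (u := 1 - Cexp s).
  assert (Iu : (0 < sg * Im u)%R).
  { replace (Im u) with (r * sin (sg * (PI - e)))%R.
    2:{ unfold u, Cexp, s, Re, Im; simpl. replace (- sg * (PI - e))%R with (- (sg * (PI - e)))%R by ring. rewrite sin_neg, exp_ln by lra. ring. }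
    assert (Sp : (0 < sin (PI - e))%R) by (apply sin_gt_0; lra).
    destruct (Rle_lt_dec 0 sg) as [A|A].
    - rewrite Rabs_pos_eq in Hsa by auto. rewrite Hsa, !Rmult_1_l. apply Rmult_lt_0_compat; lra.
    - rewrite Rabs_left in Hsa by auto. replace sg with (-1)%R by lra. replace (-1 * (PI - e))%R with (- (PI - e))%R by ring. rewrite sin_neg. nra. }
  assert (Bu : (Cmod (F u - w) < eps / 2)%R).
  { assert (Y : ball w (eps / 4) (F u)).
    { apply Hd; [|now apply HH].
      assert (Z : (Cmod (u - (1 + r)%R) < d)%R).
      { replace (u - (1 + r)%R) with (Cexp s0 - Cexp s) by (unfold u; rewrite E0, RtoC_plus, RtoC_opp; ring).
        rewrite Cmod_minus_sym. exact H2. }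
      first [ exact Z | exact (C_NormedModule_mixin_compat1 _ _ _ Z) ]. }
    destruct Y as [Y1 Y2]. change (Rabs (Re (F u) - Re w) < eps / 4)%R in Y1. change (Rabs (Im (F u) - Im w) < eps / 4)%R in Y2.
    eapply Rle_lt_trans; [apply Cmod_le_re_im|]. change (Re (F u - w)) with (Re (F u) - Re w)%R.
    change (Im (F u - w)) with (Im (F u) - Im w)%R. lra. }
  assert (EF : F u = second_branch s).
  { apply principal_branch_exp; auto. unfold s; simpl. rewrite Rabs_mult, Rabs_Ropp, Hsa, Rabs_pos_eq; lra. }
  rewrite EF in Bu. rewrite Cmod_minus_sym in Bu.
  assert (T := Cmod_triangle (w - second_branch s) (second_branch s - second_branch s0)).
  replace (w - second_branch s + (second_branch s - second_branch s0)) with (w - second_branch s0) in T by ring. lra. }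
assert (Z : w - second_branch s0 = 0) by (apply Cmod_eq_0, Rle_antisym; [exact K|apply Cmod_ge_0]).
replace w with (w - second_branch s0 + second_branch s0) by ring. rewrite Z. ring.
Qed.

(** Reduces all admissible values to one formula: each is [second_branch] at some logarithm of x,
    and on the cut the two sides give logarithms that differ by 2 pi i. *)
Lemma is_2F1_branch x w : (0 < Cmod x < 1)%R -> is_2F1 (1 / 2) (1 / 2) 1 (1 - x) w ->
  exists s, Cexp s = x /\ w = second_branch s.
Proof.
intros Hx [F [HF Hw]]. assert (HPI := PI_RGT_0).
assert (Hx0 : x <> 0) by (apply Cmod_gt_0; lra).
assert (Hre : forall s, Cexp s = x -> (Re s < 0)%R).
{ intros s Hs. apply exp_lt_inv. rewrite <- Cmod_Cexp, Hs, exp_0. lra. }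
destruct Hw as [[Hnc ->]|[[Hc1 Hc2] Hb]].
- destruct (Cexp_surj x Hx0) as [s [Hs1 Hs2]]. exists s. split; auto.
  rewrite <- Hs1. apply principal_branch_exp; auto.
  apply Rabs_def1; [|lra]. destruct (Req_dec (Im s) PI) as [E|E]; [|lra]. exfalso. apply Hnc.
  rewrite <- Hs1. unfold on_cut. replace (Im (1 - Cexp s)) with (- (exp (Re s) * sin (Im s)))%R by (unfold Cexp, Re, Im; simpl; ring).
  replace (Re (1 - Cexp s)) with (1 - exp (Re s) * cos (Im s))%R by (unfold Cexp, Re, Im; simpl; ring).
  rewrite E, sin_PI, cos_PI. assert (P := exp_pos (Re s)). split; lra.
- replace (Im (1 - x)) with (- Im x)%R in Hc1 by (unfold Im; simpl; ring).
  replace (Re (1 - x)) with (1 - Re x)%R in Hc2 by (unfold Re; simpl; ring).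
  set (r := (- Re x)%R).
  assert (Ex : x = RtoC (- r)) by (destruct x as [a b]; unfold r, RtoC in *; simpl in *; f_equal; lra).
  assert (Hr : (0 < r < 1)%R).
  { rewrite Ex, Cmod_R, Rabs_Ropp, Rabs_pos_eq in Hx by (unfold r; lra). exact Hx. }
  replace (1 - x) with (RtoC (1 + r)) in Hb by (rewrite Ex, RtoC_opp, RtoC_plus; ring).
  destruct Hb as [Hb|Hb].
  + exists (ln r, (- (1) * PI)%R). split.
    * unfold Cexp; simpl. replace (- (1) * PI)%R with (- PI)%R by ring. rewrite cos_neg, sin_neg, cos_PI, sin_PI, exp_ln by lra.
      rewrite Ex. unfold RtoC. f_equal; ring.
    * apply (boundary_value_branch F upper_half_plane 1 r w); auto; [ring|]. intros u Hu. unfold upper_half_plane. lra.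
  + exists (ln r, (- (-1) * PI)%R). split.
    * unfold Cexp; simpl. replace (- (-1) * PI)%R with PI by ring. rewrite cos_PI, sin_PI, exp_ln by lra.
      rewrite Ex. unfold RtoC. f_equal; ring.
    * apply (boundary_value_branch F lower_half_plane (-1) r w); auto; [ring|]. intros u Hu. unfold lower_half_plane. lra.
Qed.

Theorem theorem3p1 (x w : C) (hx : (0 < Cmod x < 1)%R)
    (hw : is_2F1 (1 / 2) (1 / 2) 1 (1 - x) w) :
  let z : C := gauss_2F1 (1 / 2) (1 / 2) 1 x in
  let y : C := PI * (w / z) in
  exists s : C,
    is_series
      (fun k : nat =>
         let m : C := 2 * INR (S k) - 1 in
         m / (Cexp (m * y) + 1)) s /\
    1 - 24 * s = (1 - 2 * x) * z ^ 2.
Proof.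
intros z y.
destruct (is_2F1_branch x w hx hw) as [s [Hs Hw]].
assert (Hz : z = CPS acoef x) by apply gauss_2F1_CPS.
assert (Hz0 : CPS acoef x <> 0) by (apply CPS_acoef_neq_0; lra).
assert (Hx0 : x <> 0) by (apply Cmod_gt_0; lra).
(* F(x) cancels in the quotient. Another logarithm s of x shifts y by a multiple of 2 pi i, so
   e^(-y) is the nome for every choice. *)
assert (Ey : y = - (s + - ln 16 + CPS lcoef x)).
{ unfold y. rewrite Hz, Hw. unfold second_branch. rewrite Hs. field. split; [exact PI_C_neq_0|exact Hz0]. }
assert (Hq : Cexp y = / nome x).
{ rewrite Ey, Cexp_opp, !Cexp_plus, Hs. f_equal. unfold nome.
  rewrite <- RtoC_opp, Cexp_RtoC, exp_Ropp, exp_ln, RtoC_inv by lra. reflexivity. }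
set (q := nome x) in *.
assert (Hq1 : (Cmod q < 1)%R) by now apply Cmod_nome_lt_1.
assert (Hq0 : q <> 0).
{ unfold q, nome. repeat apply Cmult_neq_0; auto; [|apply Cexp_neq_0].
  intros E. assert (X := Cinv_r 16 sixteen_neq_0). rewrite E, Cmult_0_r in X. apply RtoC_inj in X. lra. }
exists (CSeries (fun k => lambert_term k q)). split.
- apply is_series_ext with (a := fun k => lambert_term k q); [|now apply is_series_CSeries, ex_series_lambert].
  intros k. cbv zeta.
  (* The index k stands for n = k + 1, so 2n - 1 = 2k + 1; with e^y = 1/q each term is then the
     Lambert term. *)
  replace (2 * INR (S k) - 1) with (RtoC (INR (2 * k + 1))).
  2:{ rewrite S_INR, plus_INR, mult_INR. simpl (INR 2). simpl (INR 1). rewrite !RtoC_plus, RtoC_mult, RtoC_plus. ring. }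
  rewrite Cexp_INR_mult, Hq, Cpow_inv by auto. unfold lambert_term.
  assert (Hn : q ^ (2 * k + 1) <> 0) by now apply Cpow_nz.
  destruct (Cmod_one_plus (q ^ (2 * k + 1)) (Cmod q)) as [_ N]; auto.
  { apply pow_odd_le; [lra|]. split; auto. apply Cmod_ge_0. }
  match goal with |- ?a = ?b => change (@eq C a b) end. field. split; auto.
- rewrite Hz. unfold q. rewrite <- Hs. apply lambert_nome_exp.
  apply exp_lt_inv. rewrite <- Cmod_Cexp, Hs, exp_0. lra.
Qed.
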